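(* Let $F_\varepsilon$ be a smooth ($C^\infty$ or analytic) family of area-preserving maps of a neighbourhood of the origin of $\mathbb{R}^2$ into $\mathbb{R}^2$ with $F_\varepsilon(0)=0$ for all small $\varepsilon$, such that the origin is a resonant elliptic fixed point of $F_0$. Let $n\ge3$ be the order of the resonance and $\alpha$ the rotation angle of $DF_0(0)$. Let $A(I,\varepsilon)$, $B(I,\varepsilon)$ denote the coefficients of the leading-order normal form of the family (see context), and assume that $\partial_IA(0,0)\cdot B(0,0)\ne0$ if $n\ge4$, and that $B(0,0)\neq0$ if $n=3$. Then there are a formal Hamiltonian $H_\varepsilon$ and a formal canonical change of variables which conjugates $F_\varepsilon$ with $R_\alpha\circ\Phi^1_{H_\varepsilon}$, where $H_\varepsilon$ has the form $$H_\varepsilon(I,\varphi)=I\,A(I,\varepsilon)+I^{n/2}B(I,\varepsilon)\cos n\varphi$$ with the following series with real coefficients: (i) if $n\ge4$ (and $\partial_IA(0,0)\cdot B(0,0)\neq0$), $$A(I,\varepsilon)=\sum_{k,m\ge0}a_{k,m}I^k\varepsilon^m,\qquad B(I,\varepsilon)=\sum_{k,m\ge0}b_{k,m}I^{2k}\varepsilon^m,\qquad a_{0,0}=0;$$ (ii) if $n=3$ (and $B(0,0)\ne0$), $$A(I,\varepsilon)=\sum_{\substack{k,m\ge0\\ k\not\equiv1\ (\mathrm{mod}\ 3)}}a_{k,m}I^k\varepsilon^m,\quad a_{0,0}=a_{1,0}=0,\qquad B(I,\varepsilon)=\sum_{\substack{k,m\ge0\\ k\not\equiv2\ (\mathrm{mod}\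 3)}}b_{k,m}I^k\varepsilon^m.$$ For $\varepsilon=0$, $H_\varepsilon$ coincides with the unique resonant normal form $H$ of the individual map $F_0$ (see context). Moreover, the coefficients of the series $A$ and $B$ are defined uniquely by the family $F_\varepsilon$ provided the leading order is normalised so that $b_{0,0}>0$.
   Context: A fixed point at the origin of an area-preserving map $F_0$ is elliptic if the eigenvalues $\mu,\mu^{-1}$ of $DF_0(0)$ are not real; then $|\mu|=1$. By a linear area- and orientation-preserving change of variables $DF_0(0)$ takes the form of the rotation $R_\alpha=\begin{pmatrix}\cos\alpha&-\sin\alpha\\ \sin\alpha&\cos\alpha\end{pmatrix}$, $\mu=e^{i\alpha}$; $\alpha$ is the rotation angle. The fixed point is resonant if $\mu^n=1$ for some $n\in\mathbb{N}$; the least positive such $n$ is the order of the resonance. Symplectic polar coordinates: $x=\sqrt{2I}\cos\varphi$, $y=\sqrt{2I}\sin\varphi$; so $I=(x^2+y^2)/2$ and $I^{n/2}\cos n\varphi=2^{-n/2}\,\mathrm{Re}\,(x+iy)^n$. The family is identified with its Taylor series in $(x,y,\varepsilon)$. A formal canonical change of variables (depending on $\varepsilon$) is a pair of formal power series in $(x,y,\varepsilon)$ with real coefficients, vanishing at $(x,y)=(0,0)$, invertible as a map in $(x,y)$, and preserving $dx\wedge dy$ (with $\varepsilon$ treated as a parameter). All series may diverge. For a formal Hamiltonian $H_\varepsilon$, a formal power series in $(x,y,\varepsilon)$ whose terms have total order at least 3 in $(x,y,\varepsilon)$ and order at least 2 in $(x,y)$, $\Phi^1_{H_\varepsilon}=\exp(L_{H_\varepsilon})\,\mathrm{id}$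 is the formal time-one map of $\dot x=\partial H_\varepsilon/\partial y$, $\dot y=-\partial H_\varepsilon/\partial x$, where $L_Hg=\frac{\partial g}{\partial x}\frac{\partial H}{\partial y}-\frac{\partial g}{\partial y}\frac{\partial H}{\partial x}$. Leading-order normal form of the family: by the classical theory, $F_\varepsilon$ is conjugate by a formal canonical change of variables to $R_\alpha\circ\Phi^1_{H_\varepsilon}$ with $H_\varepsilon\circ R_\alpha=H_\varepsilon$ and $$H_\varepsilon(I,\varphi)=I\,A(I,\varepsilon)+I^{n/2}B(I,\varepsilon)\cos n\varphi+O(I^{n/2+1}).$$ The nondegeneracy assumptions refer to $\partial_IA(0,0)$ and $B(0,0)$ in this form. Unique resonant normal form of the individual map $F_0$ (under the same nondegeneracy assumptions): the unique formal Hamiltonian $H$ such that $F_0$ is conjugate to $R_\alpha\circ\Phi^1_H$ by a formal canonical change of variables and: for $n\ge4$, $H=I^2\sum_{k\ge0}a_kI^k+I^{n/2}\cos n\varphi\sum_{k\ge0}b_kI^{2k}$ with $b_0>0$; for $n=3$, $H=I^3\sum_{k\not\equiv2\,(\mathrm{mod}\,3)}a_kI^k+I^{3/2}\cos3\varphi\sum_{k\not\equiv2\,(\mathrm{mod}\,3)}b_kI^k$ with $b_0>0$ (sums over $k\ge0$). *)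

(* Defs.v *)
From HB Require Import structures.
From mathcomp Require Import all_boot all_order all_algebra.
From mathcomp Require Import all_classical all_reals all_analysis.
From mathcomp.real_closed Require Import complex.

Set Implicit Arguments.
Unset Strict Implicit.
Unset Printing Implicit Defensive.

Import Order.TTheory GRing.Theory Num.Theory.
Import numFieldNormedType.Exports.

Local Open Scope ring_scope.

Section Families.
Variable R : realType.

(* A family (F_eps) is given as F : R -> R * R -> R * R, read F eps (x, y);
   its components are viewed as functions of (x, y, eps). *)
Definition comp1 (F : R -> R * R -> R * R) : R -> R -> R -> R :=
  fun x y e => (F e (x, y)).1.
Definition comp2 (F : R -> R * R -> R * R) : R -> R -> R -> R :=
  fun x y e => (F e (x, y)).2.

Variant coord := Cx | Cy | Ceps.

Definition slice (c : coord) (f : R -> R -> R -> R) (x y e : R) : R -> R :=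
  match c with
  | Cx => fun t => f t y e
  | Cy => fun t => f x t e
  | Ceps => fun t => f x y t
  end.

Definition slice_pt (c : coord) (x y e : R) : R :=
  match c with Cx => x | Cy => y | Ceps => e end.

Definition pderivable (c : coord) (f : R -> R -> R -> R) (x y e : R) : Prop :=
  derivable (slice c f x y e) (slice_pt c x y e) 1.

Definition pderive (c : coord) (f : R -> R -> R -> R) : R -> R -> R -> R :=
  fun x y e => derive1 (slice c f x y e) (slice_pt c x y e).

Definition iter_pderive (w : seq coord) (f : R -> R -> R -> R) :=
  foldr pderive f w.

(* C^infinity, jointly in (x, y, eps), on the open cube of half-side r:
   all iterated partial derivatives, in any order, exist and are continuous. *)
Definition smooth_on_cube (r : R) (f : R -> R -> R -> R) : Prop :=
  forall (w : seq coord) (x y e : R), `|x| < r -> `|y| < r -> `|e| < r ->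
    {for (x, y, e), continuous
       (fun p : R * R * R => iter_pderive w f p.1.1 p.1.2 p.2)} /\
    forall c : coord, pderivable c (iter_pderive w f) x y e.

(* Matrix of the differential of F_e at (x, y), acting on column vectors. *)
Definition diff_mx (F : R -> R * R -> R * R) (x y e : R) : 'M[R]_2 :=
  \matrix_(i < 2, j < 2)
    pderive (if j == 0 then Cx else Cy)
            (if i == 0 then comp1 F else comp2 F) x y e.

(* Only values of F near (x, y, eps) = (0, 0, 0) matter; area preservation is
   preservation of the form dx /\ dy. *)
Definition area_preserving_family (F : R -> R * R -> R * R) : Prop :=
  exists2 r : R, 0 < r &
    [/\ smooth_on_cube r (comp1 F) /\ smooth_on_cube r (comp2 F),
        forall e, `|e| < r -> F e (0, 0) = (0, 0) &
        forall x y e, `|x| < r -> `|y| < r -> `|e| < r ->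
          \det (diff_mx F x y e) = 1].

Definition complex_eigenvalue (M : 'M[R]_2) (mu : R[i]) : bool :=
  eigenvalue (map_mx (real_complex R) M) mu.

Definition elliptic (M : 'M[R]_2) : Prop :=
  forall mu : R[i], complex_eigenvalue M mu -> complex.Im mu != 0.

(* [n.-primitive_root mu] says that n is the least positive integer with
   mu ^+ n = 1. *)
Definition resonance_order (M : 'M[R]_2) (n : nat) : Prop :=
  exists2 mu : R[i], complex_eigenvalue M mu & n.-primitive_root mu.

Definition rot_mx (alpha : R) : 'M[R]_2 :=
  \matrix_(i < 2, j < 2)
    if i == j then cos alpha else if i == 0 then - sin alpha else sin alpha.

Definition rotation_angle (M : 'M[R]_2) (alpha : R) : Prop :=
  exists2 P : 'M[R]_2, \det P = 1 & P *m M *m invmx P = rot_mx alpha.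

End Families.

Section FormalSeries.
Variable R : realType.

(* f i j k is the coefficient of x^i y^j eps^k. *)
Definition fps3 := nat -> nat -> nat -> R.

Definition fadd (f g : fps3) : fps3 := fun i j k => f i j k + g i j k.
Definition fsub (f g : fps3) : fps3 := fun i j k => f i j k - g i j k.
Definition fscale (c : R) (f : fps3) : fps3 := fun i j k => c * f i j k.
Definition fmul (f g : fps3) : fps3 := fun i j k =>
  \sum_(a < i.+1) \sum_(b < j.+1) \sum_(c < k.+1)
    f a b c * g (i - a)%N (j - b)%N (k - c)%N.

Definition fzero : fps3 := fun _ _ _ => 0.
Definition fone : fps3 := fun i j k => ((i == 0) && (j == 0) && (k == 0))%N%:R.
Definition fx : fps3 := fun i j k => ((i == 1) && (j == 0) && (k == 0))%N%:R.
Definition fy : fps3 := fun i j k => ((i == 0) && (j == 1) && (k == 0))%N%:R.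

Definition fpow (f : fps3) (n : nat) : fps3 := iter n (fmul f) fone.

Definition fdx (f : fps3) : fps3 := fun i j k => i.+1%:R * f i.+1 j k.
Definition fdy (f : fps3) : fps3 := fun i j k => j.+1%:R * f i j.+1 k.

Definition formal_map := (fps3 * fps3)%type.

Definition fid : formal_map := (fx, fy).

Definition vanishes_at_origin (G : formal_map) : Prop :=
  forall k, G.1 0%N 0%N k = 0 /\ G.2 0%N 0%N k = 0.

(* f (G.1, G.2, eps), for G vanishing at (x, y) = (0, 0): then
   G.1^a G.2^b has order at least a + b in (x, y), so that the terms left out
   of the sums below do not contribute. *)
Definition fsubst (f : fps3) (G : formal_map) : fps3 := fun i j k =>
  \sum_(a < (i + j).+1) \sum_(b < (i + j).+1) \sum_(c < k.+1)
    f a b c * fmul (fpow G.1 a) (fpow G.2 b) i j (k - c)%N.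

Definition fcomp (F G : formal_map) : formal_map :=
  (fsubst F.1 G, fsubst F.2 G).

Definition fjac (G : formal_map) : fps3 :=
  fsub (fmul (fdx G.1) (fdy G.2)) (fmul (fdy G.1) (fdx G.2)).

Definition finvertible (T : formal_map) : Prop :=
  exists S : formal_map,
    [/\ vanishes_at_origin S, fcomp T S = fid & fcomp S T = fid].

Definition canonical_change (T : formal_map) : Prop :=
  [/\ vanishes_at_origin T, finvertible T & fjac T = fone].

Definition frot (alpha : R) : formal_map :=
  (fsub (fscale (cos alpha) fx) (fscale (sin alpha) fy),
   fadd (fscale (sin alpha) fx) (fscale (cos alpha) fy)).

Definition formal_hamiltonian (H : fps3) : Prop :=
  forall i j k, (i + j < 2)%N || (i + j + k < 3)%N -> H i j k = 0.

Definition lie (H g : fps3) : fps3 :=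
  fsub (fmul (fdx g) (fdy H)) (fmul (fdy g) (fdx H)).

(* exp (L_H) g for a formal Hamiltonian H: L_H raises the total order in
   (x, y, eps), so that L_H^l g has no term of total degree less than l. *)
Definition fexp_lie (H g : fps3) : fps3 := fun i j k =>
  \sum_(l < (i + j + k).+1) (l`!%:R)^-1 * iter l (lie H) g i j k.

Definition time_one (H : fps3) : formal_map := (fexp_lie H fx, fexp_lie H fy).

(* T o F o T^-1 = R_alpha o Phi^1_H *)
Definition conjugates (T F : formal_map) (alpha : R) (H : fps3) : Prop :=
  fcomp T F = fcomp (fcomp (frot alpha) (time_one H)) T.

Definition formally_conjugate (F : formal_map) (alpha : R) (H : fps3) : Prop :=
  formal_hamiltonian H /\
  exists2 T : formal_map, canonical_change T & conjugates T F alpha H.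

Definition fI : fps3 := fscale 2^-1 (fadd (fpow fx 2) (fpow fy 2)).

(* Real and imaginary parts of (x + i y)^n. *)
Fixpoint fcpow (n : nat) : fps3 * fps3 :=
  if n is m.+1 then
    let z := fcpow m in
    (fsub (fmul fx z.1) (fmul fy z.2), fadd (fmul fx z.2) (fmul fy z.1))
  else (fone, fzero).

(* I^(n/2) cos (n phi) = 2^(-n/2) Re (x + i y)^n *)
Definition fIcos (n : nat) : fps3 := fscale (Num.sqrt 2 ^- n) (fcpow n).1.

(* A k m is the coefficient of I^k eps^m. *)
Definition fps2 := nat -> nat -> R.

(* Series in (I, eps), rewritten in (x, y, eps); I^k has order 2 k in (x, y). *)
Definition of_I (A : fps2) : fps3 := fun i j m =>
  \sum_(k < (i + j).+1) A k m * fpow fI k i j 0%N.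

Definition dI (A : fps2) : fps2 := fun k m => k.+1%:R * A k.+1 m.

(* I A(I, eps) + I^(n/2) B(I, eps) cos (n phi) *)
Definition hamAB (n : nat) (A B : fps2) : fps3 :=
  fadd (fmul fI (of_I A)) (fmul (fIcos n) (of_I B)).

(* The remainder O(I^(n/2+1)) consists of terms of order at least n + 2
   in (x, y). *)
Definition leading_normal_form (n : nat) (alpha : R) (F : formal_map)
    (H : fps3) (A B : fps2) : Prop :=
  [/\ formally_conjugate F alpha H, fsubst H (frot alpha) = H &
      forall i j k, (i + j < n + 2)%N -> H i j k = hamAB n A B i j k].

Definition family_shape_ge4 (A B : fps2) : Prop :=
  A 0%N 0%N = 0 /\ forall k m, odd k -> B k m = 0.

Definition family_shape_3 (A B : fps2) : Prop :=
  [/\ forall k m, (k %% 3 = 1)%N -> A k m = 0,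
      A 0%N 0%N = 0, A 1%N 0%N = 0 &
      forall k m, (k %% 3 = 2)%N -> B k m = 0].

Definition family_shape (n : nat) (A B : fps2) : Prop :=
  ((4 <= n)%N -> family_shape_ge4 A B) /\ (n = 3%N -> family_shape_3 A B).

(* Objects attached to an individual map are series that do not involve eps. *)
Definition at_eps0 (f : fps3) : fps3 := fun i j k =>
  if k == 0%N then f i j 0%N else 0.
Definition map_at_eps0 (G : formal_map) : formal_map :=
  (at_eps0 G.1, at_eps0 G.2).
Definition eps_free (G : formal_map) : Prop := map_at_eps0 G = G.

Definition of_I1 (a : nat -> R) : fps3 :=
  of_I (fun k m => if m == 0%N then a k else 0).

Definition map_ham_ge4 (n : nat) (a b : nat -> R) : fps3 :=
  fadd (fmul (fpow fI 2) (of_I1 a))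
       (fmul (fIcos n) (of_I1 (fun k => if odd k then 0 else b k./2))).

Definition map_ham_3 (a b : nat -> R) : fps3 :=
  fadd (fmul (fpow fI 3) (of_I1 (fun k => if (k %% 3 == 2)%N then 0 else a k)))
       (fmul (fIcos 3) (of_I1 (fun k => if (k %% 3 == 2)%N then 0 else b k))).

Definition map_ham (n : nat) (a b : nat -> R) : fps3 :=
  if n == 3%N then map_ham_3 a b else map_ham_ge4 n a b.

Definition map_normal_form (n : nat) (alpha : R) (F0 : formal_map) (H : fps3)
    : Prop :=
  [/\ exists a b : nat -> R, 0 < b 0%N /\ H = map_ham n a b,
      formal_hamiltonian H &
      exists T : formal_map,
        [/\ canonical_change T, eps_free T & conjugates T F0 alpha H]].

End FormalSeries.

Section Taylor.
Variable R : realType.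

Definition taylor (f : R -> R -> R -> R) : fps3 R := fun i j k =>
  iter_pderive (nseq i Cx ++ nseq j Cy ++ nseq k Ceps) f 0 0 0
    / (i`! * j`! * k`!)%N%:R.

Definition taylor_map (F : R -> R * R -> R * R) : formal_map R :=
  (taylor (comp1 F), taylor (comp2 F)).

End Taylor.

(* Main.v *)
Require Import Defs.
From HB Require Import structures.
From mathcomp Require Import all_boot all_order all_algebra.
From mathcomp Require Import all_classical all_reals all_analysis.
From mathcomp.real_closed Require Import complex.
From mathcomp Require Import ring lra zify.

(** Formal maps act on power series by substitution, so that a conjugacy is an
    identity between automorphisms of R[[x, y, eps]]. In the coordinates
    z = x + i y, zb = x - i y, a Hamiltonian that commutes with R_alpha only
    contains monomials z^p zb^q eps^m with p = q modulo n. Give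
    (z zb)^k z^(n j) eps^m the weight g k + (g + 1) j + 2 m, where g = 1 if
    n >= 4 and g = 2 if n = 3. By nondegeneracy the part of lowest weight is
    a (z zb)^2 + b (z^n + zb^n), without the first term if n = 3. The bracket
    with it raises the weight by 1 and acts on the coefficients of a given weight
    as a recurrence in the frequency j; solving these recurrences weight by
    weight brings the Hamiltonian to the normal form.
    For uniqueness, let T conjugate R_alpha o Phi_H to R_alpha o Phi_H'. The n-th
    powers of these maps are time-n flows, and uniqueness of the formal logarithm
    gives H = H' o T and T o R_alpha = R_alpha o T. Up to a rotation T is then the
    flow of some chi. The part of lowest weight of chi solves the homogeneous
    recurrence, hence comes from a combination zeta of the eps^m H'^M; the flow of
    zeta preserves H', and composing with its inverse raises the weight of chi. *)

Set Implicit Arguments.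
Unset Strict Implicit.
Unset Printing Implicit Defensive.

Import Order.TTheory GRing.Theory Num.Theory.
Import numFieldNormedType.Exports.

Local Open Scope ring_scope.

(** The weights serve several ends at once. A bracket removes one factor z zb, of weight g, while
    the leading part has weight g + 1. The weight of a product is at least the sum of the weights
    because z^n zb^n = (z zb)^n has weight g n >= 2 (g + 1); equality, for n = 3 and n = 4, couples
    the frequencies j and j + 2. The weight 2 of eps keeps eps z zb above the leading part, so that
    nondegeneracy at eps = 0 suffices. The congruences on the exponents come from the recurrence:
    its diagonal factor s - (g + 1) k vanishes at the top frequency exactly when g + 1 divides s. In
    that case a homogeneous solution is at hand and removes one more term, provided that it does not
    vanish at the lowest frequency; otherwise the term stays in the normal form. The nonvanishing
    rests on the signs of the coefficients for n >= 4, and on the decoupling of odd and even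
    frequencies for n = 3. *)

Definition ps (K : Type) := nat -> K.

HB.instance Definition _ (K : zmodType) := GRing.Zmodule.copy (ps K) (nat -> K).

(** * Rings of formal power series in one and in three variables *)

Section PowerSeriesRing.
Variable K : comNzRingType.
Implicit Types f g h : ps K.

Definition psC (c : K) : ps K := fun i => if i == 0%N then c else 0.
Definition psX : ps K := fun i => (i == 1)%N%:R.
Definition ps_mul f g : ps K := fun i => \sum_(a < i.+1) f a * g (i - a)%N.

Lemma psD f g i : (f + g) i = f i + g i. Proof. by []. Qed.
Lemma ps0 i : (0 : ps K) i = 0. Proof. by []. Qed.

Lemma ps_sum (I : Type) (r : seq I) (P : pred I) (F : I -> ps K) i :
  (\sum_(j <- r | P j) F j) i = \sum_(j <- r | P j) F j i.
Proof. by elim/big_rec2: _ => //= j y1 y2 _ <-. Qed.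

(** Coefficients of a product below N only involve coefficients below N, so the ring laws and the
    Leibniz rule can be borrowed from polynomials by truncation. *)
Lemma ps_mul_coef N f g i : (i < N)%N ->
  ps_mul f g i = (\poly_(a < N) f a * \poly_(a < N) g a)`_i.
Proof.
move=> iN; rewrite coefM; apply: eq_bigr => a _.
have aN : (a < N)%N by apply: leq_ltn_trans iN; rewrite -ltnS.
by rewrite !coef_poly aN (leq_ltn_trans (leq_subr a i) iN).
Qed.

Lemma ps_mulC : commutative ps_mul.
Proof. by move=> f g; apply/funext => i; rewrite !(@ps_mul_coef i.+1) // mulrC. Qed.

Lemma ps_mulA : associative ps_mul.
Proof.
move=> f g h; apply/funext => i.
pose P (u : ps K) := \poly_(a < i.+1) u a.
have lt (a : 'I_i.+1) : (i - a < i.+1)%N by rewrite ltnS leq_subr.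
have E u v w : ps_mul u (ps_mul v w) i = (P u * (P v * P w))`_i.
  rewrite coefM; apply: eq_bigr => a _.
  by rewrite (@ps_mul_coef i.+1 v w) // coef_poly ltn_ord.
by rewrite E ps_mulC E [P h * _]mulrC mulrA.
Qed.

Lemma ps_mul1 : left_id (psC 1) ps_mul.
Proof.
move=> f; apply/funext => i; rewrite /ps_mul big_ord_recl subn0 mul1r.
by rewrite big1 ?addr0 // => a _; rewrite mul0r.
Qed.

Lemma ps_mulD : left_distributive ps_mul +%R.
Proof.
move=> f g h; apply/funext => i; rewrite psD -big_split.
by apply: eq_bigr => a _; rewrite psD mulrDl.
Qed.

Lemma ps_1neq0 : psC 1 != 0 :> ps K.
Proof. by apply/eqP => /(congr1 (fun f => f 0%N)) /eqP; rewrite oner_eq0. Qed.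

End PowerSeriesRing.

HB.instance Definition _ (K : comNzRingType) :=
  GRing.Zmodule_isComNzRing.Build (ps K) (@ps_mulA K) (@ps_mulC K)
    (@ps_mul1 K) (@ps_mulD K) (@ps_1neq0 K).

Section PowerSeriesTheory.
Variable K : comNzRingType.
Implicit Types f g : ps K.

Lemma psME f g i : (f * g) i = \sum_(a < i.+1) f a * g (i - a)%N.
Proof. by []. Qed.

Lemma psCM (c : K) f i : (psC c * f) i = c * f i.
Proof.
rewrite psME big_ord_recl subn0 big1 ?addr0 // => a _.
by rewrite /psC /= mul0r.
Qed.

Lemma psXM f i : (psX K * f) i = if i is j.+1 then f j else 0.
Proof.
rewrite psME big_ord_recl /psX mul0r add0r; case: i => [|j].
  by rewrite big_ord0.
rewrite big_ord_recl mul1r big1 ?addr0 => [|a _]; last by rewrite mul0r.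
by rewrite /bump /= subn1.
Qed.

Definition ps_deriv f : ps K := fun i => f i.+1 *+ i.+1.

Lemma ps_derivM f g : ps_deriv (f * g) = ps_deriv f * g + f * ps_deriv g.
Proof.
apply/funext => i; rewrite psD /ps_deriv.
pose P (u : ps K) := \poly_(a < i.+2) u a.
have E : (f * g) i.+1 *+ i.+1 = ((P f * P g)^`())`_i.
  by rewrite coef_deriv; congr (_ *+ _); apply: ps_mul_coef.
rewrite E derivM coefD; congr (_ + _); rewrite coefM; apply: eq_bigr => a _.
  rewrite coef_deriv !coef_poly ltnS ltn_ord.
  by rewrite (leq_ltn_trans (leq_subr a i)).
have /= := ltn_ord a; rewrite ltnS => ai.
by rewrite coef_deriv !coef_poly !ltnS leq_subr (leqW ai).
Qed.

End PowerSeriesTheory.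

Definition ser (K : Type) := ps (ps (ps K)).

(* The operations on series in three variables are sealed: otherwise failing
   unification problems unfold them. *)
HB.lock Definition ser_zero (K : comNzRingType) : ser K := (0 : ps (ps (ps K))).
HB.lock Definition ser_one (K : comNzRingType) : ser K := (1 : ps (ps (ps K))).
HB.lock Definition ser_opp (K : comNzRingType) (f : ser K) : ser K :=
  - (f : ps (ps (ps K))).
HB.lock Definition ser_add (K : comNzRingType) (f g : ser K) : ser K :=
  (f : ps (ps (ps K))) + (g : ps (ps (ps K))).
HB.lock Definition ser_mul (K : comNzRingType) (f g : ser K) : ser K :=
  (f : ps (ps (ps K))) * (g : ps (ps (ps K))).

Section SerOps.
Variable K : comNzRingType.
Local Notation A := (ps (ps (ps K))).
Lemma ser_addA : associative (@ser_add K).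
Proof. by rewrite ser_add.unlock; exact (@addrA A). Qed.
Lemma ser_addC : commutative (@ser_add K).
Proof. by rewrite ser_add.unlock; exact (@addrC A). Qed.
Lemma ser_add0 : left_id (ser_zero K) (@ser_add K).
Proof. by rewrite ser_add.unlock ser_zero.unlock; exact (@add0r A). Qed.
Lemma ser_addN : left_inverse (ser_zero K) (@ser_opp K) (@ser_add K).
Proof.
by rewrite ser_add.unlock ser_zero.unlock ser_opp.unlock; exact (@addNr A).
Qed.
Lemma ser_mulA : associative (@ser_mul K).
Proof. by rewrite ser_mul.unlock; exact (@mulrA A). Qed.
Lemma ser_mulC : commutative (@ser_mul K).
Proof. by rewrite ser_mul.unlock; exact (@mulrC A). Qed.
Lemma ser_mul1 : left_id (ser_one K) (@ser_mul K).
Proof. by rewrite ser_mul.unlock ser_one.unlock; exact (@mul1r A). Qed.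
Lemma ser_mulD : left_distributive (@ser_mul K) (@ser_add K).
Proof. by rewrite ser_mul.unlock ser_add.unlock; exact (@mulrDl A). Qed.
Lemma ser_one_neq0 : ser_one K <> ser_zero K.
Proof.
rewrite ser_one.unlock ser_zero.unlock => e.
by have := oner_eq0 A; rewrite [1](e : (1 : A) = 0) eqxx.
Qed.
End SerOps.

HB.instance Definition _ (K : comNzRingType) := Choice.copy (ser K) (ps (ps (ps K))).
HB.instance Definition _ (K : comNzRingType) :=
  GRing.isZmodule.Build (ser K) (@ser_addA K) (@ser_addC K) (@ser_add0 K) (@ser_addN K).
HB.instance Definition _ (K : comNzRingType) :=
  GRing.Zmodule_isComNzRing.Build (ser K) (@ser_mulA K) (@ser_mulC K) (@ser_mul1 K)
    (@ser_mulD K) (introN eqP (@ser_one_neq0 K)).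

HB.lock Definition sC (K : comNzRingType) (c : K) : ser K := psC (psC (psC c)).
HB.lock Definition sX (K : comNzRingType) : ser K := psX (ps (ps K)).
HB.lock Definition sY (K : comNzRingType) : ser K := psC (psX (ps K)).
HB.lock Definition sE (K : comNzRingType) : ser K := psC (psC (psX K)).
Arguments sC {K} c. Arguments sX {K}. Arguments sY {K}. Arguments sE {K}.

Section Ser.
Variable K : comNzRingType.
Local Notation ser := (ser K).
Implicit Types f g h : ser.

Lemma serD f g i j k : (f + g) i j k = f i j k + g i j k.
Proof. by rewrite -[f + g]/(ser_add f g) ser_add.unlock. Qed.
Lemma serN f i j k : (- f) i j k = - f i j k.
Proof. by rewrite -[- f]/(ser_opp f) ser_opp.unlock. Qed.
Lemma serB f g i j k : (f - g) i j k = f i j k - g i j k.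
Proof. by rewrite serD serN. Qed.
Lemma ser0 i j k : (0 : ser) i j k = 0.
Proof. by rewrite -[0 : ser]/(ser_zero K) ser_zero.unlock. Qed.

Lemma serMn f n i j k : (f *+ n) i j k = f i j k *+ n.
Proof. by elim: n => [|n IH]; rewrite ?mulr0n ?ser0 // !mulrS serD IH. Qed.

Lemma ser_ext f g : (forall i j k, f i j k = g i j k) -> f = g.
Proof. by move=> E; do 3!apply/funext => ?. Qed.

Lemma ser_sum (I : Type) (r : seq I) (P : pred I) (F : I -> ser) i j k :
  (\sum_(l <- r | P l) F l) i j k = \sum_(l <- r | P l) F l i j k.
Proof.
by elim/big_rec2: _ => [|l y1 y2 _ <-]; rewrite ?ser0 ?serD.
Qed.

Lemma serM f g i j k : (f * g) i j k =
  \sum_(a < i.+1) \sum_(b < j.+1) \sum_(c < k.+1)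
    f a b c * g (i - a)%N (j - b)%N (k - c)%N.
Proof.
rewrite -[f * g]/(ser_mul f g) ser_mul.unlock.
rewrite psME !ps_sum; apply: eq_bigr => a _.
by rewrite psME ps_sum; apply: eq_bigr => b _; rewrite psME.
Qed.

Lemma serM_neq0 f g i j k : (f * g) i j k != 0 ->
  exists a b c a' b' c', [/\ i = (a + a')%N, j = (b + b')%N, k = (c + c')%N,
    f a b c != 0 & g a' b' c' != 0].
Proof.
rewrite serM => nz.
suff [a [b [c nabc]]] : exists (a : 'I_i.+1) (b : 'I_j.+1) (c : 'I_k.+1),
    f a b c * g (i - a)%N (j - b)%N (k - c)%N != 0.
  exists a, b, c, (i - a)%N, (j - b)%N, (k - c)%N.
  rewrite !subnKC -1?ltnS //; split=> //; apply: contraNneq nabc => ->;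
  by rewrite ?mul0r ?mulr0.
apply: contrapT => H; move/eqP: nz; apply.
rewrite big1 // => a _; rewrite big1 // => b _; rewrite big1 // => c _.
by apply/eqP; apply: contraT => n; case: H; exists a, b, c.
Qed.

Lemma sCM (c : K) f i j k : (sC c * f) i j k = c * f i j k.
Proof.
by rewrite -[_ * f]/(ser_mul _ f) ser_mul.unlock sC.unlock !psCM.
Qed.

Let sXM f i j k : (sX * f) i j k = if i is i'.+1 then f i' j k else 0.
Proof.
by rewrite -[_ * f]/(ser_mul _ f) ser_mul.unlock sX.unlock psXM; case: i.
Qed.
Let sYM f i j k : (sY * f) i j k = if j is j'.+1 then f i j' k else 0.
Proof.
rewrite -[_ * f]/(ser_mul _ f) ser_mul.unlock sY.unlock.
by rewrite psCM psXM; case: j.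
Qed.
Let sEM f i j k : (sE * f) i j k = if k is k'.+1 then f i j k' else 0.
Proof.
rewrite -[_ * f]/(ser_mul _ f) ser_mul.unlock sE.unlock.
by rewrite !psCM psXM; case: k.
Qed.

Lemma sXnM n f i j k :
  (sX ^+ n * f) i j k = if (n <= i)%N then f (i - n)%N j k else 0.
Proof.
elim: n i => [|n IH] i; first by rewrite expr0 mul1r subn0.
by rewrite exprS -mulrA sXM; case: i => // i; rewrite IH ltnS subSS.
Qed.

Lemma sYnM n f i j k :
  (sY ^+ n * f) i j k = if (n <= j)%N then f i (j - n)%N k else 0.
Proof.
elim: n j => [|n IH] j; first by rewrite expr0 mul1r subn0.
by rewrite exprS -mulrA sYM; case: j => // j; rewrite IH ltnS subSS.
Qed.

Lemma sEnM n f i j k :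
  (sE ^+ n * f) i j k = if (n <= k)%N then f i j (k - n)%N else 0.
Proof.
elim: n k => [|n IH] k; first by rewrite expr0 mul1r subn0.
by rewrite exprS -mulrA sEM; case: k => // k; rewrite IH ltnS subSS.
Qed.

Lemma ser1E i j k : (1 : ser) i j k = ((i == 0) && (j == 0) && (k == 0))%N%:R.
Proof.
rewrite -[1 : ser]/(ser_one K) ser_one.unlock.
by case: i j k => [|i] [|j] [|k].
Qed.

Lemma sCE (c : K) i j k :
  sC c i j k = if (i == 0)%N && (j == 0)%N && (k == 0)%N then c else 0.
Proof. by rewrite sC.unlock; case: i j k => [|i] [|j] [|k]. Qed.
Lemma sXE i j k : (sX : ser) i j k = ((i == 1) && (j == 0) && (k == 0))%N%:R.
Proof. by rewrite sX.unlock; case: i j k => [|[|i]] [|j] [|k]. Qed.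
Lemma sYE i j k : (sY : ser) i j k = ((i == 0) && (j == 1) && (k == 0))%N%:R.
Proof. by rewrite sY.unlock; case: i j k => [|i] [|[|j]] [|k]. Qed.
Lemma sEE i j k : (sE : ser) i j k = ((i == 0) && (j == 0) && (k == 1))%N%:R.
Proof. by rewrite sE.unlock; case: i j k => [|i] [|j] [|[|k]]. Qed.

Definition mon i j k : ser := sX ^+ i * (sY ^+ j * sE ^+ k).

Lemma monE i j k a b c : mon i j k a b c = ((a == i) && (b == j) && (c == k))%N%:R.
Proof.
rewrite /mon sXnM sYnM -[sE ^+ k]mulr1 sEnM ser1E !subn_eq0.
rewrite ![(_ == _ :> nat)]eqn_leq.
by case: (i <= a)%N; case: (j <= b)%N; case: (k <= c)%N; rewrite /= ?andbF ?andbT.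
Qed.

Lemma sC_D : {morph @sC K : c d / c + d}.
Proof.
by move=> c d; apply: ser_ext => -[|i] [|j] [|k]; rewrite serD sC.unlock /psC /= ?addr0.
Qed.
Lemma sC_M : {morph @sC K : c d / c * d}.
Proof.
move=> c d; apply: ser_ext => i j k; rewrite sCM sC.unlock /psC.
by case: i => [|i]; case: j => [|j]; case: k => [|k]; rewrite /= ?mulr0.
Qed.
Lemma sC1 : sC (1 : K) = 1.
Proof. by apply: ser_ext => i j k; rewrite ser1E sC.unlock; case: i j k => [|i] [|j] [|k]. Qed.
Lemma sC0 : sC (0 : K) = 0.
Proof. by apply: (addrI (sC (0 : K))); rewrite -sC_D !addr0. Qed.
Lemma sC_N (c : K) : sC (- c) = - sC c.
Proof. by apply/eqP; rewrite -subr_eq0 opprK -sC_D addNr sC0. Qed.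

Definition ordge N f := forall i j k, (i + j + k < N)%N -> f i j k = 0.

Lemma ordgeP N f :
  (forall i j k, f i j k != 0 -> (N <= i + j + k)%N) -> ordge N f.
Proof. by move=> H i j k l; apply/eqP; apply: contraTT l => /H; rewrite -leqNgt. Qed.

Lemma ordge_neq0 N f i j k : ordge N f -> f i j k != 0 -> (N <= i + j + k)%N.
Proof. by move=> H; apply: contraNT; rewrite -ltnNge => /H ->. Qed.

Lemma ordge0 N : ordge N 0. Proof. by move=> i j k _; rewrite ser0. Qed.
Lemma ordge_trivial f : ordge 0 f. Proof. by []. Qed.

Lemma ordgeW N M f : (M <= N)%N -> ordge N f -> ordge M f.
Proof. by move=> MN H i j k l; apply: H; apply: leq_trans MN. Qed.

Lemma ordgeD N f g : ordge N f -> ordge N g -> ordge N (f + g).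
Proof. by move=> F G i j k l; rewrite serD F // G // addr0. Qed.
Lemma ordgeN N f : ordge N f -> ordge N (- f).
Proof. by move=> F i j k l; rewrite serN F // oppr0. Qed.
Lemma ordgeB N f g : ordge N f -> ordge N g -> ordge N (f - g).
Proof. by move=> F G; apply: ordgeD => //; apply: ordgeN. Qed.

Lemma ordge_sum N (I : Type) (r : seq I) (P : pred I) (F : I -> ser) :
  (forall l, P l -> ordge N (F l)) -> ordge N (\sum_(l <- r | P l) F l).
Proof.
by move=> H; apply: big_ind => //; [exact: ordge0 | move=> f g; apply: ordgeD].
Qed.

Lemma ordgeM M N f g : ordge M f -> ordge N g -> ordge (M + N) (f * g).
Proof.
move=> F G; apply: ordgeP => i j k /serM_neq0 [a [b [c [a' [b' [c' [-> -> ->]]]]]]].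
by move=> /(ordge_neq0 F) ? /(ordge_neq0 G) ?; lia.
Qed.

Lemma ordgeX M f n : ordge M f -> ordge (n * M) (f ^+ n).
Proof. by move=> F; elim: n => // n IH; rewrite exprS mulSn; apply: ordgeM. Qed.

Lemma ordgeMl N f g : ordge N g -> ordge N (f * g).
Proof. by move=> G; rewrite -[N]add0n; apply: ordgeM. Qed.
Lemma ordgeMr N f g : ordge N f -> ordge N (f * g).
Proof. by rewrite mulrC; apply: ordgeMl. Qed.

Lemma ordge_eq f g : (forall N, ordge N (f - g)) -> f = g.
Proof.
move=> H; apply: ser_ext => i j k; apply/eqP; rewrite -subr_eq0.
by rewrite -serB (H (i + j + k).+1).
Qed.

Lemma ordge_eq_coef N f g i j k : ordge N (f - g) -> (i + j + k < N)%N ->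
  f i j k = g i j k.
Proof. by move=> H /H /eqP; rewrite serB subr_eq0 => /eqP. Qed.

Lemma ordge_trans N f g h : ordge N (f - g) -> ordge N (g - h) -> ordge N (f - h).
Proof. by move=> F G; rewrite -(subrKA g); apply: ordgeD. Qed.

Lemma ordge_mulB N f g f' g' : ordge N (f - f') -> ordge N (g - g') ->
  ordge N (f * g - f' * g').
Proof.
move=> F G; have -> : f * g - f' * g' = (f - f') * g + f' * (g - g') by ring.
by apply: ordgeD; [apply: ordgeMr | apply: ordgeMl].
Qed.

Lemma ordge_sX : ordge 1 (sX : ser).
Proof. by rewrite sX.unlock => -[|i] [|j] [|k]. Qed.
Lemma ordge_sY : ordge 1 (sY : ser).
Proof. by rewrite sY.unlock => -[|i] [|j] [|k]. Qed.
Lemma ordge_sE : ordge 1 (sE : ser).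
Proof. by rewrite sE.unlock => -[|i] [|j] [|k]. Qed.

(** In total degree below N each exponent is below N, so a finite cube of monomials is enough. This
    reduces identities between continuous additive maps to monomials. *)
Lemma ser_expansion N f : ordge N
  (f - \sum_(i < N) \sum_(j < N) \sum_(k < N) sC (f i j k) * mon i j k).
Proof.
move=> a b c l; rewrite serB ser_sum; apply/eqP; rewrite subr_eq0; apply/eqP.
have [aN bN cN] : [/\ a < N, b < N & c < N]%N by split; lia.
rewrite (bigD1 (Ordinal aN)) //= ser_sum (bigD1 (Ordinal bN)) //=.
rewrite ser_sum (bigD1 (Ordinal cN)) //= sCM monE !eqxx mulr1.
rewrite !big1 ?addr0 // => u.
- rewrite -val_eqE /= => nu; rewrite ser_sum big1 // => v _.
  rewrite ser_sum big1 // => w _; rewrite sCM monE.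
  by rewrite [a == u]eq_sym (negPf nu) mulr0.
- rewrite -val_eqE /= => nu; rewrite ser_sum big1 // => w _; rewrite sCM monE.
  by rewrite [b == u]eq_sym (negPf nu) andbF mulr0.
- rewrite -val_eqE /= => nu; rewrite sCM monE.
  by rewrite [c == u]eq_sym (negPf nu) andbF mulr0.
Qed.

(* The sum of a sequence whose l-th term has total order at least l. *)
Definition tsum (F : nat -> ser) : ser := fun i j k =>
  \sum_(l < (i + j + k).+1) F l i j k.
Definition tame (F : nat -> ser) := forall l, ordge l (F l).

Lemma tsumE F N i j k : tame F -> (i + j + k < N)%N ->
  tsum F i j k = \sum_(l < N) F l i j k.
Proof.
move=> tF lt; rewrite /tsum (big_ord_widen _ (fun l => F l i j k) lt).
rewrite big_mkcond; apply: eq_bigr => l _; case: ifPn => //.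
by rewrite -leqNgt => H; rewrite tF.
Qed.

Lemma tsum_trunc N F : tame F -> ordge N (tsum F - \sum_(l < N) F l).
Proof.
by move=> tF i j k l; rewrite serB ser_sum (tsumE tF l) subrr.
Qed.
Arguments tsum_trunc N {F} _.

Lemma tsumD F G : tsum (fun l => F l + G l) = tsum F + tsum G.
Proof.
apply: ser_ext => i j k; rewrite serD /tsum -big_split.
by apply: eq_bigr => l _; rewrite serD.
Qed.

Lemma tsum_ord N F : (forall l, ordge N (F l)) -> ordge N (tsum F).
Proof. by move=> H i j k l; rewrite /tsum big1 // => a _; apply: H. Qed.

Lemma tsum_single F l0 : ordge l0 (F l0) -> (forall l, l != l0 -> F l = 0) ->
  tsum F = F l0.
Proof.
move=> t0 H; have tF : tame F.
  by move=> l; have [->//|/H ->] := eqVneq l l0; apply: ordge0.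
apply: ser_ext => i j k.
rewrite (@tsumE F (i + j + k + l0).+1) // ?ltnS ?leq_addr //.
have lt : (l0 < (i + j + k + l0).+1)%N by rewrite ltnS leq_addl.
rewrite (bigD1 (Ordinal lt)) //= big1 ?addr0 // => l.
by rewrite -val_eqE /= => /H ->; rewrite ser0.
Qed.

End Ser.

Arguments mon {K}. Arguments tsum_trunc {K} N {F} _.

(** The product on the left is the Cauchy product of the two sequences. It differs from the product
    of the truncated sums only in terms whose indices add up to at least N, and these have order at
    least N. *)
Lemma tsumM (K : comNzRingType) (F G : ps (ser K)) : tame F -> tame G ->
  tsum (F * G : ps (ser K)) = tsum F * tsum G.
Proof.
move=> tF tG; have tFG : tame (F * G : ps (ser K)).
  move=> l; rewrite psME; apply: ordge_sum => a _.
  by rewrite -[l in ordge l](@subnKC a) -1?ltnS //; apply: ordgeM.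
apply: ordge_eq => N; apply: ordge_trans (tsum_trunc N tFG) _.
(* The truncated sums are the values at 1 of polynomials whose coefficients are the terms; the
   Cauchy product then appears as polynomial multiplication. *)
pose P (u : ps (ser K)) := \poly_(a < N) u a.
have E (u : ps (ser K)) : \sum_(l < N) u l = (P u).[1].
  by rewrite horner_poly; apply: eq_bigr => a _; rewrite expr1n mulr1.
apply: ordge_trans (_ : ordge N ((\sum_(l < N) F l) * (\sum_(l < N) G l) - _));
  last first.
  by rewrite -opprB; apply: ordgeN; apply: ordge_mulB; apply: tsum_trunc.
rewrite !E -hornerM (@horner_coef_wide _ (N + N) (P F * P G)); last first.
  apply: leq_trans (size_polyMleq _ _) _; apply: leq_trans (leq_pred _) _.
  by apply: leq_add; apply: size_poly.
rewrite big_split_ord /= horner_poly opprD addrA -sumrB.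
apply: ordgeB; apply: ordge_sum => l _; rewrite ?expr1n ?mulr1.
  by rewrite -ps_mul_coef // subrr; apply: ordge0.
rewrite coefM; apply: ordge_sum => a _; rewrite !coef_poly.
have [_|_] := ifP; last by rewrite ?mul0r ?mulr0; apply: ordge0.
have [_|_] := ifP; last by rewrite ?mul0r ?mulr0; apply: ordge0.
apply: (@ordgeW _ (a + (N + l - a))); last exact: ordgeM.
by rewrite subnKC ?leq_addr // -ltnS.
Qed.

(** * Substitution homomorphisms *)

Section Homs.

Definition rhom (A B : nzRingType) (phi : A -> B) :=
  [/\ {morph phi : a b / a + b}, {morph phi : a b / a * b} & phi 1 = 1].

Lemma rhom0 (A B : nzRingType) (phi : A -> B) : rhom phi -> phi 0 = 0.
Proof. by case=> D _ _; apply: (addrI (phi 0)); rewrite -D !addr0. Qed.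

Definition evs (A : nzRingType) (K : comNzRingType) (phi : A -> ser K)
  (g : ser K) (f : ps A) : ser K := tsum (fun l => phi (f l) * g ^+ l).

Variables (A : comNzRingType) (K : comNzRingType) (phi : A -> ser K) (g : ser K).
Hypotheses (hphi : rhom phi) (hg : ordge 1 g).

Lemma evs_tame (f : ps A) : tame (fun l => phi (f l) * g ^+ l).
Proof. by move=> l; apply: ordgeMl; rewrite -[l in ordge l]muln1; apply: ordgeX. Qed.

Lemma evs_psC c : evs phi g (psC c) = phi c.
Proof.
rewrite /evs (@tsum_single _ _ 0%N) ?mulr1 // => l /negPf nl.
by rewrite /psC nl (rhom0 hphi) mul0r.
Qed.

Lemma evs_psX : evs phi g (psX A) = g.
Proof.
have p1 : phi 1 = 1 by case: hphi.
rewrite /evs (@tsum_single _ _ 1%N) ?p1 ?mul1r //.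
move=> l /negPf nl; by rewrite /psX nl (rhom0 hphi) mul0r.
Qed.

Lemma evs_rhom : rhom (evs phi g).
Proof.
case: (hphi) => pD pM p1; split.
- move=> f f'; rewrite /evs -tsumD; congr tsum; apply/funext => l.
  by rewrite psD pD mulrDl.
- move=> f f'; rewrite /evs -tsumM; try exact: evs_tame.
  congr tsum; apply/funext => l; rewrite !psME.
  have -> : phi (\sum_(a < l.+1) f a * f' (l - a)%N) =
            \sum_(a < l.+1) phi (f a * f' (l - a)%N).
    by apply: (big_morph phi pD (rhom0 hphi)).
  rewrite big_distrl /=; apply: eq_bigr => a _.
  have -> : g ^+ l = g ^+ a * g ^+ (l - a) by rewrite -exprD subnKC // -ltnS.
  by rewrite pM; ring.
- by rewrite -[RHS]p1; apply: (evs_psC 1).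
Qed.

Lemma evs_ord N (f : ps A) : (forall l, ordge (N - l) (phi (f l))) ->
  ordge N (evs phi g f).
Proof.
move=> H; apply: tsum_ord => l; apply: (@ordgeW _ (N - l + l * 1)); first by lia.
by apply: ordgeM; [apply: H | apply: ordgeX].
Qed.

End Homs.

(** The last field is continuity for the order filtration; thanks to it such a map is determined by
    its values on the constants and on the three variables. *)
Record ghom (K1 K2 : comNzRingType) (phi : ser K1 -> ser K2) : Prop := Ghom {
  ghD : {morph phi : a b / a + b};
  ghM : {morph phi : a b / a * b};
  gh1 : phi 1 = 1;
  gh_ord : forall N f, ordge N f -> ordge N (phi f) }.

Section GhomTheory.
Variables (K1 K2 : comNzRingType) (phi : ser K1 -> ser K2).
Hypothesis hphi : ghom phi.

Lemma gh0 : phi 0 = 0.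
Proof. by apply: (addrI (phi 0)); rewrite -(ghD hphi) !addr0. Qed.
Lemma ghN f : phi (- f) = - phi f.
Proof. by apply/eqP; rewrite -subr_eq0 opprK -(ghD hphi) addNr gh0. Qed.
Lemma ghB f g : phi (f - g) = phi f - phi g.
Proof. by rewrite (ghD hphi) ghN. Qed.
Lemma gh_exp f n : phi (f ^+ n) = phi f ^+ n.
Proof. by elim: n => [|n IH]; rewrite ?(gh1 hphi) // !exprS (ghM hphi) IH. Qed.
Lemma gh_sum (I : Type) (r : seq I) (P : pred I) (F : I -> ser K1) :
  phi (\sum_(l <- r | P l) F l) = \sum_(l <- r | P l) phi (F l).
Proof. exact: (big_morph phi (ghD hphi) gh0). Qed.
Lemma gh_tsum F : tame F -> phi (tsum F) = tsum (fun l => phi (F l)).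
Proof.
move=> tF; have tpF : tame (fun l => phi (F l)) by move=> l; apply: (gh_ord hphi).
apply: ordge_eq => N; apply: ordge_trans (_ : ordge N (phi (\sum_(l < N) F l) - _)).
  by rewrite -ghB; apply: (gh_ord hphi); apply: tsum_trunc.
by rewrite gh_sum -opprB; apply: ordgeN; apply: tsum_trunc.
Qed.
End GhomTheory.

Lemma ghom_id (K : comNzRingType) : ghom (@id (ser K)).
Proof. by []. Qed.

Lemma ghom_comp (K1 K2 K3 : comNzRingType) (psi : ser K2 -> ser K3)
    (phi : ser K1 -> ser K2) : ghom psi -> ghom phi -> ghom (psi \o phi).
Proof.
move=> hp hq; split=> [a b|a b||N f Hf] /=.
- by rewrite (ghD hq) (ghD hp).
- by rewrite (ghM hq) (ghM hp).
- by rewrite (gh1 hq) (gh1 hp).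
- by apply: (gh_ord hp); apply: (gh_ord hq).
Qed.

(** Both maps are continuous with a loss of at most d degrees (0 for homomorphisms, 1 for
    derivations), so they can be compared on truncated expansions. *)
Lemma additive_eq (K1 K2 : comNzRingType) (phi psi : ser K1 -> ser K2) d :
  {morph phi : a b / a + b} -> {morph psi : a b / a + b} ->
  (forall N f, ordge (N + d) f -> ordge N (phi f)) ->
  (forall N f, ordge (N + d) f -> ordge N (psi f)) ->
  (forall c i j k, phi (sC c * mon i j k) = psi (sC c * mon i j k)) ->
  phi =1 psi.
Proof.
move=> pD qD po qo E f; apply: ordge_eq => N.
have a0 (u : ser K1 -> ser K2) : {morph u : a b / a + b} -> u 0 = 0.
  by move=> uD; apply: (addrI (u 0)); rewrite -uD !addr0.
have aB (u : ser K1 -> ser K2) : {morph u : a b / a + b} ->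
    forall a b, u (a - b) = u a - u b.
  by move=> uD a b; apply/eqP; rewrite eq_sym subr_eq -uD subrK.
pose S := \sum_(i < N + d) \sum_(j < N + d) \sum_(k < N + d) sC (f i j k) * mon i j k.
have eS : phi S = psi S.
  rewrite !(big_morph _ pD (a0 _ pD)) !(big_morph _ qD (a0 _ qD)).
  apply: eq_bigr => i _; rewrite !(big_morph _ pD (a0 _ pD)) !(big_morph _ qD (a0 _ qD)).
  apply: eq_bigr => j _; rewrite !(big_morph _ pD (a0 _ pD)) !(big_morph _ qD (a0 _ qD)).
  by apply: eq_bigr => k _.
have oS := @ser_expansion _ (N + d) f.
apply: ordge_trans (_ : ordge N (phi S - _)); first by rewrite -aB //; apply: po.
by rewrite eS -opprB -aB //; apply: ordgeN; apply: qo.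
Qed.

Lemma ghom_eq (K1 K2 : comNzRingType) (phi psi : ser K1 -> ser K2) :
  ghom phi -> ghom psi -> (forall c, phi (sC c) = psi (sC c)) ->
  phi sX = psi sX -> phi sY = psi sY -> phi sE = psi sE -> phi =1 psi.
Proof.
move=> hp hq eC eX eY eE.
apply: (@additive_eq _ _ _ _ 0); rewrite ?(ghD hp) ?(ghD hq) //.
- exact: ghD.
- exact: ghD.
- by move=> N f; rewrite addn0; apply: gh_ord.
- by move=> N f; rewrite addn0; apply: gh_ord.
- move=> c i j k; rewrite !(ghM hp) !(ghM hq) !(gh_exp hp) !(gh_exp hq).
  by rewrite eC eX eY eE.
Qed.

(** The map [b] acts on the coefficients: one construction covers real substitutions, the passage to
    complex coefficients and complex conjugation. *)
HB.lock Definition gsub (K1 K2 : comNzRingType) (b : K1 -> K2) (G1 G2 G3 : ser K2) :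
  ser K1 -> ser K2 := evs (evs (evs (@sC K2 \o b) G3) G2) G1.

Arguments gsub {K1 K2} b G1 G2 G3 _.

Section Gsub.
Variables (K1 K2 : comNzRingType) (b : K1 -> K2) (G1 G2 G3 : ser K2).
Hypotheses (hb : rhom b) (h1 : ordge 1 G1) (h2 : ordge 1 G2) (h3 : ordge 1 G3).

Let r0 : rhom (@sC K2 \o b).
Proof.
case: hb => bD bM b1; split=> [x y|x y|] /=; rewrite ?bD ?bM ?b1 ?sC1 //.
  exact: sC_D. exact: sC_M.
Qed.
Let r1 : rhom (evs (@sC K2 \o b) G3). Proof. exact: evs_rhom. Qed.
Let r2 : rhom (evs (evs (@sC K2 \o b) G3) G2). Proof. exact: evs_rhom. Qed.
Let r3 : rhom (gsub b G1 G2 G3).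
Proof.
have [D M O] := evs_rhom r2 h1; rewrite gsub.unlock; split=> [f g|f g|].
- by rewrite -[f + g]/(ser_add f g) ser_add.unlock; exact (D f g).
- by rewrite -[f * g]/(ser_mul f g) ser_mul.unlock; exact (M f g).
- by rewrite -[1 in LHS]/(ser_one K1) ser_one.unlock; exact O.
Qed.

Lemma gsub_ghom : ghom (gsub b G1 G2 G3).
Proof.
split; try by case: r3.
move=> N f Hf; rewrite gsub.unlock; apply: evs_ord => // i; apply: evs_ord => // j.
apply: evs_ord => // k.
have [le|lt] := leqP (N - i - j - k) 0; first exact: ordgeW le _.
have e0 : f i j k = 0 by apply: Hf; lia.
by rewrite /= e0 (rhom0 hb) sC0; apply: ordge0.
Qed.
Lemma gsub_C c : gsub b G1 G2 G3 (sC c) = sC (b c).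
Proof.
rewrite gsub.unlock (_ : sC c = psC (psC (psC c))); last by rewrite sC.unlock.
exact: etrans (evs_psC G1 r2 _) (etrans (evs_psC G2 r1 _) (evs_psC G3 r0 c)).
Qed.
Lemma gsub_X : gsub b G1 G2 G3 sX = G1.
Proof. by rewrite gsub.unlock sX.unlock; exact (evs_psX r2 h1). Qed.
Lemma gsub_Y : gsub b G1 G2 G3 sY = G2.
Proof.
by rewrite gsub.unlock sY.unlock; exact: etrans (evs_psC G1 r2 _) (evs_psX r1 h2).
Qed.
Lemma gsub_E : gsub b G1 G2 G3 sE = G3.
Proof.
rewrite gsub.unlock sE.unlock.
exact: etrans (evs_psC G1 r2 _) (etrans (evs_psC G2 r1 _) (evs_psX r0 h3)).
Qed.

Lemma gsubP : [/\ ghom (gsub b G1 G2 G3), forall c, gsub b G1 G2 G3 (sC c) = sC (b c),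
  gsub b G1 G2 G3 sX = G1, gsub b G1 G2 G3 sY = G2 & gsub b G1 G2 G3 sE = G3].
Proof.
split; [exact: gsub_ghom|exact: gsub_C|exact gsub_X|exact gsub_Y|exact gsub_E].
Qed.

Lemma gsub_neq0 f i j k : gsub b G1 G2 G3 f i j k != 0 ->
  exists a c d, f a c d != 0 /\ (G1 ^+ a * (G2 ^+ c * G3 ^+ d)) i j k != 0.
Proof.
move=> nz; apply: contrapT => H; move/eqP: nz; apply.
rewrite (ordge_eq_coef (N := (i + j + k).+1) (g := gsub b G1 G2 G3
  (\sum_(a < (i + j + k).+1) \sum_(c < (i + j + k).+1)
    \sum_(d < (i + j + k).+1) sC (f a c d) * mon a c d))) //; last first.
  by rewrite -(ghB gsub_ghom); apply: (gh_ord gsub_ghom); apply: ser_expansion.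
rewrite (gh_sum gsub_ghom) ser_sum big1 // => a _.
rewrite (gh_sum gsub_ghom) ser_sum big1 // => c _.
rewrite (gh_sum gsub_ghom) ser_sum big1 // => d _.
rewrite !(ghM gsub_ghom) !(gh_exp gsub_ghom) gsub_X gsub_Y gsub_E gsub_C sCM.
apply/eqP; apply: contraT => n; case: H; exists a, c, d; split.
  by apply: contraNneq n => ->; rewrite (rhom0 hb) mul0r.
by apply: contraNneq n => ->; rewrite mulr0.
Qed.
End Gsub.

Lemma ghom_gsub (K1 K2 : comNzRingType) (phi : ser K1 -> ser K2) (b : K1 -> K2) :
  ghom phi -> rhom b -> (forall c, phi (sC c) = sC (b c)) ->
  forall f, phi f = gsub b (phi sX) (phi sY) (phi sE) f.
Proof.
move=> hp hb hc; have hX := gh_ord hp (@ordge_sX K1).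
have hY := gh_ord hp (@ordge_sY K1); have hE := gh_ord hp (@ordge_sE K1).
apply: ghom_eq => //; first exact: gsub_ghom.
- by move=> c; rewrite gsub_C.
- by rewrite gsub_X.
- by rewrite gsub_Y.
- by rewrite gsub_E.
Qed.

Lemma rhom_id (A : nzRingType) : rhom (@id A). Proof. by []. Qed.
#[export] Hint Resolve rhom_id ghom_id : core.

(** * Poisson brackets *)

Section Derivations.
Variable K : comNzRingType.
Implicit Types f g h : ser K.

Lemma psMn (A : comNzRingType) (f : ps A) n i : (f *+ n) i = f i *+ n.
Proof. by elim: n => // n IH; rewrite !mulrS psD IH. Qed.

Definition dx f : ser K := fun i j k => f i.+1 j k *+ i.+1.
Definition dy f : ser K := fun i j k => f i j.+1 k *+ j.+1.

Lemma dxD : {morph dx : f g / f + g}.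
Proof. by move=> f g; apply: ser_ext => i j k; rewrite /dx /dy !serD mulrnDl. Qed.
Lemma dyD : {morph dy : f g / f + g}.
Proof. by move=> f g; apply: ser_ext => i j k; rewrite /dx /dy !serD mulrnDl. Qed.
Lemma dxN f : dx (- f) = - dx f.
Proof. by apply: ser_ext => i j k; rewrite /dx !serN mulNrn. Qed.
Lemma dyN f : dy (- f) = - dy f.
Proof. by apply: ser_ext => i j k; rewrite /dy !serN mulNrn. Qed.

Lemma dxM f g : dx (f * g) = dx f * g + f * dx g.
Proof.
have dxE u : dx u = ps_deriv (u : ps (ps (ps K))).
  by apply: ser_ext => i j k; rewrite /dx /ps_deriv !psMn.
rewrite -[f * g]/(ser_mul f g) -[dx f * g + _]/(ser_add (ser_mul _ _) (ser_mul _ _)).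
by rewrite ser_mul.unlock ser_add.unlock !dxE; exact: ps_derivM.
Qed.

Lemma dyM f g : dy (f * g) = dy f * g + f * dy g.
Proof.
have dyE u i : dy u i = ps_deriv (u i).
  by do 2!apply/funext => ?; rewrite /dy /ps_deriv !psMn.
rewrite -[f * g]/(ser_mul f g) -[dy f * g + _]/(ser_add (ser_mul _ _) (ser_mul _ _)).
rewrite ser_mul.unlock ser_add.unlock.
apply/funext => i; rewrite dyE psD !psME -big_split /=.
have pD : {morph @ps_deriv (ps K) : u v / u + v}.
  by move=> u v; apply/funext => j; rewrite psD -mulrnDl.
have p0 : ps_deriv (0 : ps (ps K)) = 0.
  by apply/funext => j; rewrite /ps_deriv mul0rn.
rewrite (big_morph _ pD p0); apply: eq_bigr => a _.
by rewrite ps_derivM !dyE.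
Qed.

Lemma dx_ord N f : ordge N.+1 f -> ordge N (dx f).
Proof. by move=> H i j k l; rewrite /dx H ?mul0rn //; lia. Qed.
Lemma dy_ord N f : ordge N.+1 f -> ordge N (dy f).
Proof. by move=> H i j k l; rewrite /dy H ?mul0rn //; lia. Qed.

Lemma dx_C c : dx (sC c) = 0 :> ser K.
Proof.
by apply: ser_ext => i j k; rewrite /dx /dy ser0 sCE /= ?andbF ?mul0rn.
Qed.
Lemma dy_C c : dy (sC c) = 0 :> ser K.
Proof.
by apply: ser_ext => i j k; rewrite /dx /dy ser0 sCE /= ?andbF ?mul0rn.
Qed.
Lemma dx_E : dx sE = 0 :> ser K.
Proof.
by apply: ser_ext => i j k; rewrite /dx /dy ser0 sEE /= ?andbF ?mul0rn.
Qed.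
Lemma dy_E : dy sE = 0 :> ser K.
Proof.
by apply: ser_ext => i j k; rewrite /dx /dy ser0 sEE /= ?andbF ?mul0rn.
Qed.
Lemma dx_Y : dx sY = 0 :> ser K.
Proof.
by apply: ser_ext => i j k; rewrite /dx /dy ser0 sYE /= ?andbF ?mul0rn.
Qed.
Lemma dy_X : dy sX = 0 :> ser K.
Proof.
by apply: ser_ext => i j k; rewrite /dx /dy ser0 sXE /= ?andbF ?mul0rn.
Qed.
Lemma dx_X : dx sX = 1 :> ser K.
Proof.
apply: ser_ext => i j k; rewrite /dx ser1E sXE eqSS.
by case: i => [|i]; rewrite ?mulr1n // mul0rn.
Qed.
Lemma dy_Y : dy sY = 1 :> ser K.
Proof.
apply: ser_ext => i j k; rewrite /dy ser1E sYE eqSS.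
by case: j => [|j]; rewrite ?mulr1n // !andbF mul0rn.
Qed.

Definition pb f g := dx f * dy g - dy f * dx g.

Definition ham_lie H g := pb g H.

Lemma pbDl f g h : pb (f + g) h = pb f h + pb g h.
Proof. by rewrite /pb dxD dyD; ring. Qed.
Lemma pbDr f g h : pb f (g + h) = pb f g + pb f h.
Proof. by rewrite /pb dxD dyD; ring. Qed.
Lemma pbNl f h : pb (- f) h = - pb f h.
Proof. by rewrite /pb dxN dyN; ring. Qed.
Lemma pbNr f h : pb f (- h) = - pb f h.
Proof. by rewrite /pb dxN dyN; ring. Qed.
Lemma pbC f g : pb f g = - pb g f. Proof. by rewrite /pb; ring. Qed.
Lemma pbMl f g h : pb (f * g) h = pb f h * g + f * pb g h.
Proof. by rewrite /pb dxM dyM; ring. Qed.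
Lemma pb_Cl c f : pb (sC c) f = 0. Proof. by rewrite /pb dx_C dy_C; ring. Qed.
Lemma pb_El f : pb sE f = 0. Proof. by rewrite /pb dx_E dy_E; ring. Qed.
Lemma pb_CMl c f g : pb (sC c * f) g = sC c * pb f g.
Proof. by rewrite pbMl pb_Cl mul0r add0r. Qed.
Lemma pb_CMr c f g : pb f (sC c * g) = sC c * pb f g.
Proof. by rewrite pbC pb_CMl pbC mulrN opprK. Qed.
Lemma pb_Xl f : pb sX f = dy f. Proof. by rewrite /pb dx_X dy_X; ring. Qed.
Lemma pb_Yl f : pb sY f = - dx f. Proof. by rewrite /pb dx_Y dy_Y; ring. Qed.
Lemma pb_XY : pb sX sY = 1. Proof. by rewrite pb_Xl dy_Y. Qed.
Lemma pbff f : pb f f = 0. Proof. by rewrite /pb; ring. Qed.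

Lemma pb_ord M N f g : ordge M.+1 f -> ordge N.+1 g -> ordge (M + N) (pb f g).
Proof.
move=> F G; apply: ordgeB; apply: ordgeM;
  by [apply: dx_ord | apply: dy_ord].
Qed.

Lemma lie_ord d N H f : ordge d.+2 H -> ordge N f -> ordge (N + d) (ham_lie H f).
Proof.
case: N => [|N] HH Hf; last by rewrite addSnnS; apply: pb_ord.
have H1 := dx_ord HH; have H2 := dy_ord HH.
by apply: ordgeB; apply: ordgeMl; apply: ordgeW (leqnSn _) _.
Qed.

End Derivations.

(** Derivations along a homomorphism. Like homomorphisms they are determined by constants and
    variables, and the chain rule is an equality between two of them. *)
Record pder (K1 K2 : comNzRingType) (phi d : ser K1 -> ser K2) : Prop := Pder {
  pdD : {morph d : a b / a + b};
  pdM : forall a b, d (a * b) = d a * phi b + phi a * d b;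
  pd_ord : forall N f, ordge (N + 1) f -> ordge N (d f) }.

Lemma pder_eq (K1 K2 : comNzRingType) (phi d d' : ser K1 -> ser K2) :
  pder phi d -> pder phi d' -> (forall c, d (sC c) = d' (sC c)) ->
  d sX = d' sX -> d sY = d' sY -> d sE = d' sE -> d =1 d'.
Proof.
move=> p p' eC eX eY eE.
apply: (@additive_eq _ _ _ _ 1); try exact: pdD p; try exact: pdD p'.
- exact: pd_ord p.
- exact: pd_ord p'.
move=> c i j k.
have ex f n : d f = d' f -> d (f ^+ n) = d' (f ^+ n).
  move=> e; elim: n => [|n IH]; first by rewrite expr0 -(sC1 K1) eC.
  by rewrite exprS (pdM p) (pdM p') IH e.
by rewrite !(pdM p) !(pdM p') !eC !(ex _ _ eX) !(ex _ _ eY) !(ex _ _ eE).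
Qed.

Section Chain.
Variables (K1 K2 : comNzRingType) (phi : ser K1 -> ser K2) (b : K1 -> K2).
Hypotheses (hphi : ghom phi) (hC : forall c, phi (sC c) = sC (b c)) (hE : phi sE = sE).

Lemma chain_rule (d : ser K2 -> ser K2) : pder id d -> (forall c, d (sC c) = 0) ->
  d sE = 0 ->
  forall f, d (phi f) = phi (dx f) * d (phi sX) + phi (dy f) * d (phi sY).
Proof.
move=> pd dC dE; apply: (@pder_eq _ _ phi).
- split=> [a c|a c|N f Hf]; rewrite ?(ghD hphi) ?(pdD pd) //.
    by rewrite (ghM hphi) (pdM pd).
  by apply: (pd_ord pd); apply: (gh_ord hphi).
- split=> [a c|a c|N f]; rewrite ?dxD ?dyD ?dxM ?dyM.
  + by rewrite !(ghD hphi); ring.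
  + by rewrite !(ghD hphi) !(ghM hphi); ring.
  rewrite addn1 => Hf; apply: ordgeD; apply: ordgeMr; apply: (gh_ord hphi).
    exact: dx_ord.
  exact: dy_ord.
- by move=> c; rewrite hC dC dx_C dy_C (gh0 hphi) !mul0r addr0.
- by rewrite dx_X dy_X (gh0 hphi) (gh1 hphi); ring.
- by rewrite dx_Y dy_Y (gh0 hphi) (gh1 hphi); ring.
- by rewrite hE dE dx_E dy_E (gh0 hphi) !mul0r addr0.
Qed.

Lemma pder_dx : pder id (@dx K2).
Proof. by split=> [||N f]; [exact: dxD|exact: dxM|rewrite addn1; apply: dx_ord]. Qed.
Lemma pder_dy : pder id (@dy K2).
Proof. by split=> [||N f]; [exact: dyD|exact: dyM|rewrite addn1; apply: dy_ord]. Qed.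

(** The last factor is the Jacobian determinant: 1 for canonical maps, a constant for the passage to
    complex coordinates. *)
Lemma pb_gh f g : pb (phi f) (phi g) = phi (pb f g) * pb (phi sX) (phi sY).
Proof.
have cx := chain_rule pder_dx (@dx_C K2) (@dx_E K2).
have cy := chain_rule pder_dy (@dy_C K2) (@dy_E K2).
rewrite {1}/pb (cx f) (cx g) (cy f) (cy g).
by rewrite {1}/pb (ghB hphi) !(ghM hphi) /pb; ring.
Qed.
End Chain.

Section XYorder.
Variable K : comNzRingType.
Implicit Types f g : ser K.
(** The order in (x, y) alone, with eps as a parameter; [xyge 1] expresses vanishing at the origin
    for every eps. *)
Definition xyge N f := forall i j k, (i + j < N)%N -> f i j k = 0.

Lemma xygeP N f : (forall i j k, f i j k != 0 -> (N <= i + j)%N) -> xyge N f.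
Proof. by move=> H i j k l; apply/eqP; apply: contraTT l => /H; rewrite -leqNgt. Qed.
Lemma xyge_neq0 N f i j k : xyge N f -> f i j k != 0 -> (N <= i + j)%N.
Proof. by move=> H; apply: contraNT; rewrite -ltnNge => /H ->. Qed.
Lemma xygeD N f g : xyge N f -> xyge N g -> xyge N (f + g).
Proof. by move=> F G i j k l; rewrite serD F // G // addr0. Qed.
Lemma xygeN N f : xyge N f -> xyge N (- f).
Proof. by move=> F i j k l; rewrite serN F // oppr0. Qed.
Lemma xygeM M N f g : xyge M f -> xyge N g -> xyge (M + N) (f * g).
Proof.
move=> F G; apply: xygeP => i j k /serM_neq0 [a [b [c [a' [b' [c' [-> -> _]]]]]]].
by move=> /(xyge_neq0 F) ? /(xyge_neq0 G) ?; lia.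
Qed.
Lemma xygeX M f n : xyge M f -> xyge (n * M) (f ^+ n).
Proof. by move=> F; elim: n => // n IH; rewrite exprS mulSn; apply: xygeM. Qed.
Lemma xyge_tsum N F : (forall l, xyge N (F l)) -> xyge N (tsum F).
Proof. by move=> H i j k l; rewrite /tsum big1 // => a _; apply: H. Qed.
Lemma dx_xy N f : xyge N.+1 f -> xyge N (dx f).
Proof. by move=> H i j k l; rewrite /dx H ?mul0rn //; lia. Qed.
Lemma dy_xy N f : xyge N.+1 f -> xyge N (dy f).
Proof. by move=> H i j k l; rewrite /dy H ?mul0rn //; lia. Qed.
Lemma lie_xy N H f : xyge 2 H -> xyge N.+1 f -> xyge N.+1 (ham_lie H f).
Proof.
move=> HH Hf; rewrite -addn1.
by apply: xygeD; [|apply: xygeN]; apply: xygeM;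
  (exact: dx_xy || exact: dy_xy).
Qed.
Lemma xyge_CM N c f : xyge N f -> xyge N (sC c * f).
Proof. by move=> H i j k l; rewrite sCM H // mulr0. Qed.
Lemma ordge_CM N c f : ordge N f -> ordge N (sC c * f).
Proof. exact: ordgeMl. Qed.
Lemma xyge_sX : xyge 1 (sX : ser K).
Proof. by move=> [|i] j k; rewrite sXE. Qed.
Lemma xyge_sY : xyge 1 (sY : ser K).
Proof. by move=> i [|j] k; rewrite sYE ?andbF // addnS. Qed.
End XYorder.

Section ZeroDivisors.
Lemma ps_mul_eq0 (K : comNzRingType) :
  (forall a b : K, a * b = 0 -> a = 0 \/ b = 0) ->
  forall f g : ps K, f * g = 0 -> f = 0 \/ g = 0.
Proof.
move=> H f g fg0; apply: contrapT => /not_orP[nf ng].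
have ex (u : ps K) : u <> 0 -> exists i, u i != 0.
  move=> nu; apply: contrapT => E; apply: nu; apply/funext => i.
  by apply/eqP; apply: contraT => n; case: E; exists i.
case: (ex_minnP (ex _ nf)) => m fm mf; case: (ex_minnP (ex _ ng)) => p gp pg.
have := congr1 (fun u : ps K => u (m + p)%N) fg0; rewrite psME ps0.
have lt : (m < (m + p).+1)%N by rewrite ltnS leq_addr.
rewrite (bigD1 (Ordinal lt)) //= addKn big1 ?addr0 => [/H[] e|i ni].
- by rewrite e eqxx in fm.
- by rewrite e eqxx in gp.
have [lt1|gt1|e] := ltngtP i m.
- by have [->|/mf] := eqVneq (f i) 0; rewrite ?mul0r // leqNgt lt1.
- have [->|/pg] := eqVneq (g (m + p - i)%N) 0; rewrite ?mulr0 //.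
  by have := ltn_ord i; lia.
- by case/eqP: ni; apply: val_inj.
Qed.

Lemma ser_mul_eq0 (K : idomainType) (f g : ser K) : f * g = 0 -> f = 0 \/ g = 0.
Proof.
rewrite -[f * g]/(ser_mul f g) -[0]/(ser_zero K) ser_mul.unlock ser_zero.unlock.
apply: ps_mul_eq0; apply: ps_mul_eq0; apply: ps_mul_eq0 => a b /eqP.
by rewrite mulf_eq0 => /orP[] /eqP; [left|right].
Qed.
End ZeroDivisors.

Lemma cauchy_sum (V : nmodType) (A : nat -> nat -> V) N :
  (forall a b, (N <= a + b)%N -> A a b = 0) ->
  \sum_(l < N) \sum_(a < l.+1) A a (l - a)%N = \sum_(a < N) \sum_(b < N) A a b.
Proof.
move=> H.
under eq_bigr => l _.
  rewrite (big_ord_widen N (fun a => A a (l - a)%N)) // big_mkcond /=.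
  over.
rewrite exchange_big /=; apply: eq_bigr => a _.
rewrite -(big_mkord xpredT (fun b => A a b)).
rewrite -(big_mkord xpredT (fun l => if (a < l.+1)%N then A a (l - a)%N else 0)).
have aN : (a <= N)%N by apply: ltnW.
rewrite (@big_cat_nat _ _ _ a 0 N) //= big_nat big1 ?add0r; last first.
  by move=> i; rewrite ltnS; case: (leqP a i).
rewrite -{1}[val a]add0n big_addn [RHS](@big_cat_nat _ _ _ (N - a) 0 N) ?leq_subr //=.
rewrite [X in _ = _ + X]big_nat [X in _ = _ + X]big1 ?addr0; last first.
  by move=> i /andP[h _]; apply: H; lia.
by apply: eq_bigr => b _; rewrite ltnS leq_addl addnK.
Qed.

Lemma tsum_cauchy (K : comNzRingType) (A : nat -> nat -> ser K) :
  (forall a b, ordge (a + b) (A a b)) ->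
  tsum (fun l => \sum_(a < l.+1) A a (l - a)%N) = tsum (fun a => tsum (A a)).
Proof.
move=> H; have tA a : tame (A a).
  by move=> b; apply: ordgeW (H a b); apply: leq_addl.
have tS : tame (fun a => tsum (A a)).
  by move=> a; apply: tsum_ord => b; apply: ordgeW (H a b); apply: leq_addr.
have tL : tame (fun l => \sum_(a < l.+1) A a (l - a)%N).
  move=> l; apply: ordge_sum => a _; apply: ordgeW (H _ _).
  by rewrite subnKC // -ltnS.
apply: ser_ext => i j k; have lt := ltnSn (i + j + k).
rewrite (tsumE tL lt) (tsumE tS lt).
under eq_bigr do rewrite ser_sum.
under [RHS]eq_bigr do rewrite (tsumE (tA _) lt).
by apply: (cauchy_sum (A := fun a b => A a b i j k)) => a b h; apply: H.
Qed.

(** * Exponentials of Hamiltonian vector fields *)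

Section Exp.
Variable R : numFieldType.
Implicit Types H f g : ser R.

Definition Fam H f : ps (ser R) := fun l => sC (l`!%:R^-1) * iter l (ham_lie H) f.
Definition Exp H f : ser R := tsum (Fam H f).

Lemma lieD H : {morph ham_lie H : f g / f + g}.
Proof. by move=> f g; rewrite /ham_lie pbDl. Qed.
Lemma lieM H f g : ham_lie H (f * g) = ham_lie H f * g + f * ham_lie H g.
Proof. exact: pbMl. Qed.
Lemma lie_CM H c f : ham_lie H (sC c * f) = sC c * ham_lie H f.
Proof. exact: pb_CMl. Qed.
Lemma lieN H f : ham_lie H (- f) = - ham_lie H f.
Proof. exact: pbNl. Qed.
Lemma lieB H f g : ham_lie H (f - g) = ham_lie H f - ham_lie H g.
Proof. by rewrite lieD lieN. Qed.

Lemma iter_lieD H l : {morph iter l (ham_lie H) : f g / f + g}.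
Proof. by move=> f g; elim: l => //= l ->; rewrite lieD. Qed.
Lemma iter_lie_CM H l c f : iter l (ham_lie H) (sC c * f) = sC c * iter l (ham_lie H) f.
Proof. by elim: l => //= l ->; rewrite lie_CM. Qed.
Lemma iter_lie_ord H l N f : ordge 3 H -> ordge N f ->
  ordge (N + l) (iter l (ham_lie H) f).
Proof.
move=> HH Hf; elim: l => [|l IH]; first by rewrite addn0.
by rewrite addnS -addn1; apply: (lie_ord HH IH).
Qed.

Lemma Fam_ord H N l f : ordge 3 H -> ordge N f -> ordge (N + l) (Fam H f l).
Proof. by move=> HH Hf; apply: ordge_CM; apply: iter_lie_ord. Qed.
Lemma Fam_tame H f : ordge 3 H -> tame (Fam H f).
Proof. by move=> HH l; apply: (@Fam_ord H 0). Qed.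

Lemma Fam_rec H f l : Fam H f l.+1 *+ l.+1 = ham_lie H (Fam H f l).
Proof.
rewrite /Fam lie_CM /= -mulrnAl; congr (_ * _).
have -> : forall c : R, sC c *+ l.+1 = sC (c *+ l.+1).
  by move=> c; elim: l.+1 => [|m IH]; rewrite ?mulr0n ?sC0 // !mulrS IH sC_D.
by congr sC; rewrite factS natrM invfM -[LHS]mulr_natl mulrA mulfV ?mul1r ?pnatr_eq0.
Qed.

Lemma ser_nat_inj (f g : ser R) n : f *+ n.+1 = g *+ n.+1 -> f = g.
Proof.
move=> e; apply: ser_ext => i j k; have := congr1 (fun u : ser R => u i j k) e.
rewrite !serMn => /eqP; rewrite -subr_eq0 -mulrnBl mulrn_eq0 /= subr_eq0.
by move/eqP.
Qed.

(** Viewed as power series in time, both sides solve u' = L_H u with the same initial value, because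
    L_H is a derivation; in characteristic 0 the solution is unique. *)
Lemma FamM H f g : Fam H (f * g) = Fam H f * Fam H g.
Proof.
have dF u : ps_deriv (Fam H u) = (fun l => ham_lie H (Fam H u l)).
  by apply/funext => l; rewrite -Fam_rec.
apply/funext; elim => [|l IH].
  rewrite psME big_ord_recl big_ord0 addr0 subn0 /Fam /= fact0 invr1 sC1.
  by rewrite !mul1r.
apply: (@ser_nat_inj _ _ l); rewrite Fam_rec IH.
have -> : (Fam H f * Fam H g) l.+1 *+ l.+1 = ps_deriv (Fam H f * Fam H g) l by [].
rewrite ps_derivM !dF psD !psME -big_split /=.
have l0 : ham_lie H 0 = 0 by apply: (addrI (ham_lie H 0)); rewrite -lieD !addr0.
rewrite (big_morph _ (lieD H) l0); apply: eq_bigr => a _; exact: lieM.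
Qed.

Section ExpHom.
Variable H : ser R.
Hypothesis oH : ordge 3 H.

Lemma Exp_const f : ham_lie H f = 0 -> Exp H f = f.
Proof.
move=> e; have l0 : ham_lie H 0 = 0 by apply: (addrI (ham_lie H 0)); rewrite -lieD !addr0.
have z l : iter l.+1 (ham_lie H) f = 0 by elim: l => [|l IH]; rewrite iterS ?IH.
rewrite /Exp (@tsum_single _ (Fam H f) 0%N) //.
  by rewrite /Fam /= fact0 invr1 sC1 mul1r.
by case=> // l _; rewrite /Fam z mulr0.
Qed.

Lemma ExpD : {morph Exp H : f g / f + g}.
Proof.
move=> f g; rewrite /Exp -tsumD; congr tsum; apply/funext => l.
by rewrite /Fam iter_lieD mulrDr.
Qed.

Lemma Exp_C c : Exp H (sC c) = sC c.
Proof. by apply: Exp_const; apply: pb_Cl. Qed.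
Lemma Exp_E : Exp H sE = sE.
Proof. by apply: Exp_const; apply: pb_El. Qed.
Lemma Exp_H : Exp H H = H.
Proof. by apply: Exp_const; apply: pbff. Qed.

Lemma Exp_ghom : ghom (Exp H).
Proof.
split; [exact: ExpD| |by rewrite -(sC1 R) Exp_C|].
- by move=> f g; rewrite /Exp FamM tsumM //; apply: Fam_tame.
- move=> N f Hf; apply: tsum_ord => l.
  by apply: ordgeW (Fam_ord oH Hf); apply: leq_addr.
Qed.

Lemma Exp_near f N : ordge N f -> ordge N.+1 (Exp H f - f).
Proof.
move=> Hf.
have -> : Exp H f - f = tsum (fun l => Fam H f l - (if l is _.+1 then 0 else f)).
  apply: ser_ext => i j k; rewrite serB /tsum /Exp.
  under [RHS]eq_bigr do rewrite serB.
  rewrite sumrB; congr (_ - _); rewrite big_ord_recl big1 ?addr0 // => l _.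
  by rewrite ser0.
apply: tsum_ord => -[|l] /=.
  by rewrite /Fam fact0 invr1 sC1 mul1r subrr; apply: ordge0.
by rewrite subr0; apply: ordgeW (Fam_ord oH Hf); rewrite addnS ltnS leq_addr.
Qed.

Lemma Exp_xy N f : xyge 2 H -> xyge N.+1 f -> xyge N.+1 (Exp H f).
Proof.
move=> xH xf; apply: xyge_tsum => l; apply: xyge_CM.
by elim: l => //= l IH; apply: lie_xy.
Qed.

Lemma Exp_lie_comm f : Exp H (ham_lie H f) = ham_lie H (Exp H f).
Proof.
have tF := Fam_tame f oH.
apply: ordge_eq => N.
have S := tsum_trunc N tF.
have l0 : ham_lie H 0 = 0 by apply: (addrI (ham_lie H 0)); rewrite -lieD !addr0.
apply: ordge_trans (_ : ordge N (ham_lie H (\sum_(l < N) Fam H f l) - _)); last first.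
  by rewrite -lieB -opprB lieN; apply: ordgeN; apply: ordgeW (lie_ord oH S); rewrite leq_addr.
rewrite (big_morph _ (lieD H) l0).
have -> : \sum_(l < N) ham_lie H (Fam H f l) = \sum_(l < N) Fam H (ham_lie H f) l.
  by apply: eq_bigr => l _; rewrite /Fam lie_CM -iterS iterSr.
exact: tsum_trunc (Fam_tame _ oH).
Qed.

Lemma Exp_eq0 f : Exp H f = 0 -> f = 0.
Proof.
move=> e; apply: ordge_eq => N; rewrite subr0.
elim: N => // N IH; have := Exp_near IH; rewrite e sub0r => /ordgeN.
by rewrite opprK.
Qed.

(* With D the Jacobian, conservation of H under its own flow gives
   E{f,H} = {Ef,EH} = D E{f,H}; power series have no zero divisors. *)
Lemma Exp_jac : pb (Exp H sX) (Exp H sY) = 1.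
Proof.
set D := pb _ _.
have key f : Exp H (ham_lie H f) * (D - 1) = 0.
  have e := pb_gh Exp_ghom Exp_C Exp_E f H; rewrite Exp_H -/D in e.
  rewrite mulrBr mulr1 -e; apply/eqP; rewrite subr_eq0; apply/eqP.
  by rewrite [RHS]Exp_lie_comm.
have [/Exp_eq0 D1|] := ser_mul_eq0 (key sX); last by move/eqP; rewrite subr_eq0 => /eqP.
have [/Exp_eq0 D2|] := ser_mul_eq0 (key sY); last by move/eqP; rewrite subr_eq0 => /eqP.
by rewrite /D !Exp_const // pb_XY.
Qed.
End ExpHom.
End Exp.

Section ExpGroup.
Variable R : numFieldType.
Implicit Types H f g : ser R.

Lemma iter_lie_scale H c l f :
  iter l (ham_lie (sC c * H)) f = sC (c ^+ l) * iter l (ham_lie H) f.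
Proof.
elim: l => [|l IH]; first by rewrite /= expr0 sC1 mul1r.
by rewrite !iterS IH lie_CM {1}/ham_lie pb_CMr mulrA -sC_M -exprSr.
Qed.

Lemma Exp_add H (s t : R) f : ordge 3 H ->
  Exp (sC s * H) (Exp (sC t * H) f) = Exp (sC (s + t) * H) f.
Proof.
move=> oH; have o c : ordge 3 (sC c * H) by apply: ordge_CM.
have tF c u : tame (Fam (sC c * H) u) by apply: Fam_tame.
(* The double sum is regrouped by the total power of the Lie derivative, where the coefficients add
   up by the binomial formula. *)
pose A a b := sC (s ^+ a / a`!%:R * (t ^+ b / b`!%:R)) * iter (a + b) (ham_lie H) f.
have oA a b : ordge (a + b) (A a b).
  by apply: ordge_CM; apply: (@iter_lie_ord _ _ _ 0).
transitivity (tsum (fun a => tsum (A a))).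
  apply: ordge_eq => N.
  have E1 : Exp (sC s * H) (Exp (sC t * H) f) =
    tsum (fun a => tsum (fun b => Fam (sC s * H) (Fam (sC t * H) f b) a)).
    rewrite {1}/Exp; congr tsum; apply/funext => a.
    have oF b : ordge b (Fam (sC t * H) f b) by apply: Fam_tame.
    apply: ordge_eq => M.
    have FB u v : Fam (sC s * H) (u - v) a = Fam (sC s * H) u a - Fam (sC s * H) v a.
      have iB l : iter l (ham_lie (sC s * H)) (u - v) = iter l (ham_lie (sC s * H)) u - iter l (ham_lie (sC s * H)) v.
        by elim: l => //= l ->; rewrite lieB.
      by rewrite /Fam iB mulrBr.
    have FS : Fam (sC s * H) (\sum_(b < M) Fam (sC t * H) f b) a =
              \sum_(b < M) Fam (sC s * H) (Fam (sC t * H) f b) a.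
      apply: (big_morph (fun u => Fam (sC s * H) u a)) => [u v|].
        by rewrite /Fam iter_lieD mulrDr.
      by rewrite -[in LHS](subrr 0) FB subrr.
    apply: ordge_trans (_ : ordge M (Fam (sC s * H) (\sum_(b < M) Fam (sC t * H) f b) a - _)).
      by rewrite -FB; apply: ordgeW (Fam_ord (o s) (tsum_trunc M (tF t f))); rewrite leq_addr.
    rewrite FS -opprB; apply: ordgeN; apply: tsum_trunc => b.
    by apply: ordgeW (Fam_ord (o s) (oF b)); rewrite leq_addr.
  rewrite E1; have -> : (fun a => tsum (fun b => Fam (sC s * H) (Fam (sC t * H) f b) a)) =
    (fun a => tsum (A a)).
    apply/funext => a; congr tsum; apply/funext => b.
    rewrite /Fam /A !iter_lie_scale iter_lie_CM iter_lie_CM -iterD !mulrA -!sC_M.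
    by congr (sC _ * _); rewrite [s ^+ a / _]mulrC; ring.
  by rewrite subrr; apply: ordge0.
rewrite -tsum_cauchy //; congr tsum; apply/funext => l.
rewrite /Fam iter_lie_scale mulrA -sC_M.
rewrite (eq_bigr (fun a : 'I_l.+1 => sC (s ^+ a / a`!%:R * (t ^+ (l - a) / (l - a)`!%:R)) * iter l (ham_lie H) f)); last first.
  by move=> a _; rewrite /A subnKC // -ltnS.
rewrite -mulr_suml; congr (_ * _).
rewrite -(big_morph (@sC R) (@sC_D R) (sC0 R)); congr sC.
rewrite addrC exprDn mulr_sumr; apply: eq_bigr => a _.
have al : (a <= l)%N by rewrite -ltnS.
have := bin_fact al => /(congr1 (fun m => m%:R : R)); rewrite !natrM => e.
have nz m : m`!%:R != 0 :> R by rewrite pnatr_eq0 -lt0n fact_gt0.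
rewrite -mulr_natr -e; field.
by rewrite !nz pnatr_eq0 -lt0n bin_gt0.
Qed.

Lemma Exp0 f : Exp 0 f = f.
Proof.
have l0 g : ham_lie 0 g = 0.
  by apply: (addrI (ham_lie 0 g)); rewrite /ham_lie -pbDr !addr0.
by apply: Exp_const; rewrite l0.
Qed.

Lemma ExpK H f : ordge 3 H -> Exp (- H) (Exp H f) = f.
Proof.
move=> oH; have := @Exp_add H (-1) 1 f oH.
by rewrite addNr sC0 mul0r Exp0 sC_N sC1 mulN1r mul1r.
Qed.

Lemma ExpNK H f : ordge 3 H -> Exp H (Exp (- H) f) = f.
Proof. by move=> oH; rewrite -{1}[H]opprK ExpK //; apply: ordgeN. Qed.

Lemma iter_Exp H m f : ordge 3 H -> iter m (Exp H) f = Exp (sC m%:R * H) f.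
Proof.
move=> oH; elim: m => [|m IH]; first by rewrite sC0 mul0r Exp0.
by rewrite iterS IH -{1}[H]mul1r -(sC1 R) Exp_add // -natr1 addrC.
Qed.

Lemma Exp_nat (phi : ser R -> ser R) H f : ghom phi -> (forall c, phi (sC c) = sC c) ->
  (forall f g, phi (pb f g) = pb (phi f) (phi g)) -> ordge 3 H ->
  phi (Exp H f) = Exp (phi H) (phi f).
Proof.
move=> hp hC hpb oH; rewrite /Exp (gh_tsum hp); last exact: Fam_tame.
congr tsum; apply/funext => l; rewrite /Fam (ghM hp) hC; congr (_ * _).
by elim: l => //= l IH; rewrite {1}/ham_lie hpb IH.
Qed.

Section Perturb.
(** An abstract decreasing filtration; the total order and the weight are the two instances. *)
Variable P : nat -> ser R -> Prop.
Hypotheses (PD : forall v f g, P v f -> P v g -> P v (f + g))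
  (PC : forall v c f, P v f -> P v (sC c * f))
  (PS : forall v F, (forall l, P v (F l)) -> P v (tsum F))
  (PW : forall u v f, (u <= v)%N -> P v f -> P u f)
  (P0 : forall v, P v 0).
Variables (H H' : ser R) (r : nat).
Hypotheses (oH : ordge 3 H) (oH' : ordge 3 H')
  (PH : forall v f, P v f -> P v.+1 (ham_lie H f))
  (PH' : forall v f, P v f -> P v.+1 (ham_lie H' f))
  (Pd : forall v f, P v f -> P (v + r) (ham_lie (H' - H) f)).

(* exp(A + B) = exp(A) + B up to terms of higher order than B *)
Lemma Exp_perturb v f : P v f ->
  P (v + r.+1) (Exp H' f - Exp H f - ham_lie (H' - H) f).
Proof.
move=> Pf; have PN u g : P u g -> P u (- g).
  by move=> Pg; rewrite -[g]mul1r -sC1 -mulNr -sC_N; apply: PC.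
have PB u g h : P u g -> P u h -> P u (g - h) by move=> ? ?; apply: PD => //; apply: PN.
have iH l : P (v + l) (iter l (ham_lie H) f).
  by elim: l => [|l IH]; rewrite ?addn0 // addnS; apply: PH.
have D l : P (v + r + l) (iter l.+1 (ham_lie H') f - iter l.+1 (ham_lie H) f).
  have e (g h : ser R) : ham_lie H' g - ham_lie H h = ham_lie H' (g - h) + ham_lie (H' - H) h.
    by rewrite lieB /ham_lie pbDr pbNr; ring.
  elim: l => [|l IH].
    rewrite /= e subrr addn0; have -> : ham_lie H' 0 = 0.
      by apply: (addrI (ham_lie H' 0)); rewrite -lieD !addr0.
    by rewrite add0r; apply: Pd.
  rewrite iterS [iter l.+2 (ham_lie H) f]iterS e; apply: PD.
    by rewrite addnS; apply: PH'.
  by rewrite addnAC; apply: Pd; apply: iH.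
pose L := ham_lie (H' - H) f.
have oL : ordge 1 L.
  exact (@lie_ord _ 1 0 _ f (ordgeB oH' oH) (@ordge_trivial _ f)).
pose T l := Fam H' f l - Fam H f l - (if l is 1%N then L else 0).
have -> : Exp H' f - Exp H f - L = tsum T.
  have <- : tsum (fun l => if l is 1%N then L else 0) = L.
    by apply: (@tsum_single _ _ 1%N) => // -[|[|l]].
  apply: ser_ext => i j k; rewrite !serB /tsum /Exp -!sumrB.
  by apply: eq_bigr => l _; rewrite /T !serB.
apply: PS => l; rewrite /T /Fam -mulrBr; case: l => [|[|l]].
- by rewrite /= subrr mulr0 subr0.
- rewrite (_ : 1`!%:R^-1 = 1 :> R) ?invr1 // sC1 mul1r /=.
  have -> : ham_lie H' f - ham_lie H f - L = 0 by rewrite /L /ham_lie pbDr pbNr subrr.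
  exact: P0.
- by rewrite subr0; apply: PC; apply: PW (D l.+1); lia.
Qed.
End Perturb.

Lemma Exp_perturb_ord H H' r N f : ordge 3 H -> ordge 3 H' -> ordge r.+2 (H' - H) ->
  ordge N f -> ordge (N + r.+1) (Exp H' f - Exp H f - ham_lie (H' - H) f).
Proof.
move=> oH oH' od; apply: (@Exp_perturb (fun v f => ordge v f)) => //.
- by move=> v g h; apply: ordgeD.
- by move=> v c g; apply: ordge_CM.
- by move=> v F; apply: tsum_ord.
- by move=> u v g uv; apply: ordgeW.
- by move=> v; apply: ordge0.
- by move=> v g; rewrite -addn1; apply: lie_ord.
- by move=> v g; rewrite -addn1; apply: lie_ord.
- by move=> v g; apply: lie_ord.
Qed.

Lemma Exp_cong H H' N f : ordge 3 H -> ordge 3 H' -> ordge N.+2 (H' - H) ->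
  ordge N (Exp H' f - Exp H f).
Proof.
move=> oH oH' od; have e := Exp_perturb_ord oH oH' od (@ordge_trivial _ f).
have l := lie_ord od (@ordge_trivial _ f); rewrite !add0n in e l.
rewrite -[X in ordge N X](subrK (ham_lie (H' - H) f)); apply: ordgeD => //.
exact: ordgeW e.
Qed.

Definition fham H := xyge 2 H /\ ordge 3 H.

Lemma fhamD H H' : fham H -> fham H' -> fham (H + H').
Proof. by move=> [a b] [c d]; split; [apply: xygeD|apply: ordgeD]. Qed.
Lemma fhamN H : fham H -> fham (- H).
Proof. by move=> [a b]; split; [apply: xygeN|apply: ordgeN]. Qed.
Lemma fham_CM c H : fham H -> fham (sC c * H).
Proof. by move=> [a b]; split; [apply: xyge_CM|apply: ordge_CM]. Qed.

(** In the lowest degree where H and H' differ, the two flows of x and y differ by the partial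
    derivatives of H' - H. A series in eps alone would be invisible; it is excluded by the order 2
    in (x, y). *)
Lemma Exp_inj H H' : fham H -> fham H' -> Exp H sX = Exp H' sX ->
  Exp H sY = Exp H' sY -> H = H'.
Proof.
move=> [xH oH] [xH' oH'] eX eY; apply/esym; apply: ordge_eq => N.
elim: N => // N IH; have [N3|N3] := ltnP N 3.
  by apply: ordgeW N3 _; apply: ordgeB.
case: N N3 IH => [|[|r]] // r1 IH.
have key f : ordge 1 f -> Exp H f = Exp H' f -> ordge r.+2 (ham_lie (H' - H) f).
  move=> o1 e; have := Exp_perturb_ord oH oH' IH o1.
  by rewrite e subrr sub0r add1n => /ordgeN; rewrite opprK.
have dY : ordge r.+2 (dy (H' - H)) by rewrite -pb_Xl; apply: key => //; apply: ordge_sX.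
have dX : ordge r.+2 (dx (H' - H)).
  by rewrite -[dx _]opprK -pb_Yl; apply: ordgeN; apply: key => //; apply: ordge_sY.
have nz (c : R) m : c *+ m.+1 = 0 -> c = 0.
  by move/eqP; rewrite mulrn_eq0 /= => /eqP.
move=> [|i] [|j] k l.
- by rewrite serB xH // xH' // subrr.
- by apply: (@nz _ j); apply: dY; lia.
- by apply: (@nz _ i); apply: dX; lia.
- by apply: (@nz _ i); apply: dX; lia.
Qed.

(** * Logarithms of canonical maps tangent to the identity *)

Section Log.
Variable phi : ser R -> ser R.
Hypotheses (hphi : ghom phi) (hC : forall c, phi (sC c) = sC c) (hE : phi sE = sE)
  (xX : xyge 1 (phi sX)) (xY : xyge 1 (phi sY)) (oX : ordge 2 (phi sX - sX))
  (oY : ordge 2 (phi sY - sY)) (jac : pb (phi sX) (phi sY) = 1).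

(* The Hamiltonian, homogeneous of degree N + 1, of the degree N part of the
   vector field (P, Q). *)
Let ham_part N (P Q : ser R) : ser R := fun i j k =>
  if (i + j + k == N.+1)%N then
    if j is j'.+1 then P i j' k / j'.+1%:R
    else if i is i'.+1 then - (Q i' 0%N k / i'.+1%:R) else 0
  else 0.

Let step N chi := chi + ham_part N (phi sX - Exp chi sX) (phi sY - Exp chi sY).
(** Hamiltonians start in degree 3, so the first correction is made at M = 2; [log_seq N] is final
    in the degrees up to N. *)
Fixpoint log_seq N : ser R := if N is M.+1 then (if (M < 2)%N then 0 else step M (log_seq M)) else 0.

Let Inv N chi := [/\ fham chi, ordge N (phi sX - Exp chi sX) &
  ordge N (phi sY - Exp chi sY)].

Let step_diff N chi : ordge N.+1 (step N chi - chi).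
Proof.
by rewrite /step addrC addKr => i j k l; rewrite /ham_part; case: eqP => // e; lia.
Qed.

Let step_inv N chi : (2 <= N)%N -> Inv N chi -> Inv N.+1 (step N chi).
Proof.
move=> N2 [[xc oc] ox oy].
have [P eP0] : {P | P = phi sX - Exp chi sX} by exists (phi sX - Exp chi sX).
have [Q eQ0] : {Q | Q = phi sY - Exp chi sY} by exists (phi sY - Exp chi sY).
rewrite -eP0 in ox; rewrite -eQ0 in oy.
have xP : xyge 1 P by rewrite eP0; apply: xygeD => //; apply: xygeN; apply: Exp_xy => //; apply: xyge_sX.
have xQ : xyge 1 Q by rewrite eQ0; apply: xygeD => //; apply: xygeN; apply: Exp_xy => //; apply: xyge_sY.
have od := @step_diff N chi; pose psi := ham_part N P Q.
have epsi : step N chi - chi = psi by rewrite /step addrC addKr -eP0 -eQ0.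
have fpsi : fham psi.
  split=> i j k l; rewrite /psi /ham_part; last by case: eqP => // e; lia.
  case: eqP => // e; case: j e l => [|j] e l; last by rewrite xP ?mul0r //; lia.
  by case: i e l => [|i] e l //; rewrite xQ ?mul0r ?oppr0 //; lia.
have fs : fham (step N chi) by rewrite /step -eP0 -eQ0; apply: fhamD.
(* Both Jacobians are 1. Comparing them shows that the part of degree N of the error (P, Q) is free
   of divergence, hence a Hamiltonian vector field. *)
have div : ordge N (dx P + dy Q).
  have o1 : ordge 2 (Exp chi sX - sX) by apply: Exp_near => //; apply: ordge_sX.
  have o2 : ordge 2 (Exp chi sY - sY) by apply: Exp_near => //; apply: ordge_sY.
  have : pb (Exp chi sX + P) (Exp chi sY + Q) = 1.
    by rewrite eP0 eQ0 ![Exp chi _ + _]addrC !subrK.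
  rewrite pbDl !pbDr (Exp_jac oc) => e.
  have {}e : pb (Exp chi sX) Q + pb P (Exp chi sY) + pb P Q = 0.
    by apply: (addrI 1); rewrite addr0; apply: (etrans _ e); ring.
  have e1 : pb (Exp chi sX) Q = dy Q + pb (Exp chi sX - sX) Q.
    by rewrite pbDl pbNl pb_Xl; ring.
  have e2 : pb P (Exp chi sY) = dx P + pb P (Exp chi sY - sY).
    by rewrite pbDr pbNr [pb P sY]pbC pb_Yl; ring.
  have -> : dx P + dy Q = - (pb (Exp chi sX - sX) Q + pb P (Exp chi sY - sY) + pb P Q).
    rewrite e1 e2 in e; apply/eqP; rewrite -addr_eq0; apply/eqP.
    by apply: (etrans _ e); ring.
  case: N N2 ox oy {od psi epsi fpsi fs} => [|N] // N2 ox oy.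
  apply: ordgeN; apply: ordgeD; first apply: ordgeD.
  + by rewrite -add1n; apply: pb_ord.
  + by rewrite -addn1; apply: pb_ord.
  + by apply: (@ordgeW _ (N + N)); [lia | apply: pb_ord].
have nz m : m.+1%:R != 0 :> R by rewrite pnatr_eq0.
have eP : ordge N.+1 (P - dy psi).
  move=> i j k l; rewrite serB /dy /psi /ham_part.
  case: eqP => e; last by rewrite mul0rn subr0 ox //; lia.
  by rewrite -[_ *+ _]mulr_natr divfK ?subrr.
have eQ : ordge N.+1 (Q + dx psi).
  move=> i j k l; rewrite serD /dx /psi /ham_part.
  case: eqP => e; last by rewrite mul0rn addr0 oy //; lia.
  case: j e l => [|j] e l.
    by rewrite -[_ *+ _]mulr_natr mulNr divfK ?subrr.
  (* For positive exponents of y, [psi] was found by integrating P in y; that it also matches Q is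
     the vanishing of the divergence. *)
  have lt : (i + j + k < N)%N by lia.
  have := div i j k lt; rewrite serD /dx /dy.
  move/eqP; rewrite addrC addr_eq0 => /eqP ed; apply: (mulIf (nz j)).
  rewrite mulrDl mul0r [Q i _ k * _]mulr_natr ed.
  have -> : (P i.+1 j k / j.+1%:R) *+ i.+1 * j.+1%:R = P i.+1 j k *+ i.+1.
    by rewrite mulrnAl divfK.
  by rewrite addNr.
have pert f : ordge 1 f -> ordge N.+1 (Exp (step N chi) f - Exp chi f - ham_lie psi f).
  move=> of_; rewrite -epsi; have -> : N.+1 = (1 + N.-1.+1)%N by lia.
  apply: Exp_perturb_ord => //; first by case: fs.
  by apply: ordgeW od; lia.
split=> //.
- rewrite (_ : _ - _ = P - dy psi - (Exp (step N chi) sX - Exp chi sX - ham_lie psi sX)).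
    by apply: ordgeB => //; apply: pert; apply: ordge_sX.
  by rewrite eP0 /ham_lie pb_Xl; ring.
- rewrite (_ : _ - _ = Q + dx psi - (Exp (step N chi) sY - Exp chi sY - ham_lie psi sY)).
    by apply: ordgeB => //; apply: pert; apply: ordge_sY.
  by rewrite eQ0 /ham_lie pb_Yl; ring.
Qed.

Let log_inv N : Inv N.+2 (log_seq N.+2).
Proof.
elim: N => [|N IH]; last by apply: step_inv => //; rewrite ltnS.
rewrite /= /Inv; split; first by split=> i j k _; rewrite ser0.
  by rewrite Exp0.
by rewrite Exp0.
Qed.

Lemma seq_diff_ord (c : nat -> ser R) N M :
  (forall m, (N <= m)%N -> ordge N.+1 (c m.+1 - c m)) -> (N <= M)%N ->
  ordge N.+1 (c M - c N).
Proof.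
move=> H; elim: M => [|M IH]; first by rewrite leqn0 => /eqP ->; rewrite subrr; apply: ordge0.
rewrite leq_eqVlt => /orP[/eqP -> |]; first by rewrite subrr; apply: ordge0.
by rewrite ltnS => NM; apply: ordge_trans (H _ NM) (IH NM).
Qed.

Lemma log_exists : exists2 chi, fham chi & phi =1 Exp chi.
Proof.
pose chi : ser R := fun i j k => log_seq (i + j + k) i j k.
have near N : ordge N.+1 (chi - log_seq N).
  move=> i j k l; rewrite serB /chi -serB -opprB serN.
  rewrite (@seq_diff_ord log_seq (i + j + k) N) ?oppr0 // => m mN.
  have := @step_diff m (log_seq m); rewrite /=; case: ltnP => m2 od; last first.
    by apply: ordgeW od; rewrite ltnS.
  case: m m2 mN {od} => [|[|]] // _ _ /=; rewrite subrr; apply: ordge0.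
have fc : fham chi.
  split=> i j k l; have [[x o] _ _] := log_inv (i + j + k).
    rewrite (@ordge_eq_coef _ (i + j + k).+3 _ (log_seq (i + j + k).+2)) ?x //; lia.
  rewrite (@ordge_eq_coef _ (i + j + k).+3 _ (log_seq (i + j + k).+2)) ?o //; lia.
exists chi => //; have [xc oc] := fc.
have key f : (forall N, ordge N.+2 (phi f - Exp (log_seq N.+2) f)) -> phi f = Exp chi f.
  move=> H; apply: ordge_eq => N; apply: ordge_trans (_ : ordge N (Exp (log_seq N.+2) f - _)).
    by apply: ordgeW (H N); lia.
  have [[x o] _ _] := log_inv N.
  by apply: Exp_cong => //; rewrite -opprB; apply: ordgeN; apply: ordgeW (near N.+2); lia.
apply: (ghom_eq hphi (Exp_ghom oc)).
- by move=> c; exact (etrans (hC c) (esym (Exp_C chi c))).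
- by apply: key => N; case: (log_inv N).
- by apply: key => N; case: (log_inv N).
- exact (etrans hE (esym (Exp_E chi))).
Qed.
End Log.
End ExpGroup.

Lemma rhom_rmorphism (A B : nzRingType) (f : {rmorphism A -> B}) : rhom f.
Proof. by split=> [a b|a b|]; rewrite ?rmorphD ?rmorphM ?rmorph1. Qed.

(** * Complex coordinates *)

Section MonomialSubst.
Variables (K1 K2 : comNzRingType) (b : K1 -> K2).
Hypothesis hb : rhom b.

Lemma ordge_scale (K : comNzRingType) c N (f : ser K) : ordge N f -> ordge N (sC c * f).
Proof. exact: ordgeMl. Qed.

Lemma sC_exp (K : comNzRingType) (w : K) m : sC w ^+ m = sC (w ^+ m).
Proof. by elim: m => [|m IH]; rewrite ?expr0 ?sC1 // !exprS IH sC_M. Qed.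

(* Additivity makes it enough to check the formula on monomials. *)
Lemma coef_gsub_scale u v f i j k :
  gsub b (sC u * sX) (sC v * sY) sE f i j k = b (f i j k) * (u ^+ i * v ^+ j).
Proof.
have [gh gC gX gY gE] := gsubP hb (ordge_scale u (@ordge_sX K2))
  (ordge_scale v (@ordge_sY K2)) (@ordge_sE K2).
set phi := gsub _ _ _ _ in gh gC gX gY gE *.
suff E : phi f = (fun i j k => b (f i j k) * (u ^+ i * v ^+ j)) by rewrite E.
move: f; apply: (@additive_eq _ _ phi _ 0); first exact: ghD gh.
- move=> f g; apply: ser_ext => a c d; rewrite !serD; case: hb => -> _ _.
  by rewrite mulrDl.
- by move=> N f; rewrite addn0; apply: gh_ord gh _ _.
- by move=> N f; rewrite addn0 => H a c d l; rewrite ?ser0 H // (rhom0 hb) mul0r.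
move=> c i' j' k'; rewrite !(ghM gh) !(gh_exp gh) gC gX gY gE.
rewrite !exprMn !sC_exp.
have -> : sC (u ^+ i') * sX ^+ i' * (sC (v ^+ j') * sY ^+ j' * sE ^+ k') =
   sC (u ^+ i' * v ^+ j') * mon i' j' k' by rewrite sC_M /mon; ring.
apply: ser_ext => x y z; rewrite mulrA -sC_M !sCM !monE.
case: (hb) => _ bM b1; rewrite bM.
have [->|_] := eqVneq x i'; last by rewrite /= !mulr0 (rhom0 hb) mulr0 mul0r.
have [->|_] := eqVneq y j'; last by rewrite /= !mulr0 (rhom0 hb) mulr0 mul0r.
by case: eqP => _; rewrite /= ?b1 ?(rhom0 hb) ?mulr1 // !mulr0 mul0r.
Qed.

Lemma coef_gsub_swap f i j k : gsub b sY sX sE f i j k = b (f j i k).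
Proof.
have [gh gC gX gY gE] := gsubP hb (@ordge_sY K2) (@ordge_sX K2) (@ordge_sE K2).
set phi := gsub _ _ _ _ in gh gC gX gY gE *.
suff E : phi f = (fun i j k => b (f j i k)) by rewrite E.
move: f; apply: (@additive_eq _ _ phi _ 0); first exact: ghD gh.
- by move=> f g; apply: ser_ext => a c d; rewrite !serD; case: hb => -> _ _.
- by move=> N f; rewrite addn0; apply: gh_ord gh _ _.
- by move=> N f; rewrite addn0 => H a c d l; rewrite H ?(rhom0 hb) // addnC addnA addnAC; lia.
move=> c i' j' k'; rewrite !(ghM gh) !(gh_exp gh) gC gX gY gE.
have -> : (sY : ser K2) ^+ i' * (sX ^+ j' * sE ^+ k') = mon j' i' k' by rewrite /mon; ring.
apply: ser_ext => x y z; rewrite !sCM !monE.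
case: (hb) => _ bM b1; rewrite bM; congr (_ * _).
by rewrite [(x == j') && _]andbC; case: (_ && _); rewrite ?b1 ?(rhom0 hb).
Qed.
End MonomialSubst.

Section Homogeneous.
Variable K : comNzRingType.
Definition linear_ser (G : ser K) := forall i j k, G i j k != 0 -> (i + j = 1)%N /\ k = 0%N.

Lemma linear_serD G G' : linear_ser G -> linear_ser G' -> linear_ser (G + G').
Proof.
move=> H H' i j k; rewrite serD; have [->|/H //] := eqVneq (G i j k) 0.
by rewrite add0r => /H'.
Qed.
Lemma linear_ser_C c G : linear_ser G -> linear_ser (sC c * G).
Proof. by move=> H i j k; rewrite sCM => nz; apply: H; apply: contraNneq nz => ->; rewrite mulr0. Qed.
Lemma linear_mon a b : (a + b = 1)%N -> linear_ser (mon a b 0%N).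
Proof.
move=> ab i j k; rewrite monE; case: andP => [[/andP[/eqP-> /eqP->] /eqP->] //|_].
by rewrite eqxx.
Qed.
Lemma linear_sX : linear_ser sX.
Proof.
by have <- : mon 1%N 0%N 0%N = sX :> ser K; [rewrite /mon expr1 !expr0 !mulr1 | apply: linear_mon].
Qed.
Lemma linear_sY : linear_ser sY.
Proof.
by have <- : mon 0%N 1%N 0%N = sY :> ser K; [rewrite /mon expr1 !expr0 mulr1 mul1r | apply: linear_mon].
Qed.
Lemma linear_ord G : linear_ser G -> ordge 1 G.
Proof. by move=> H; apply: ordgeP => i j k /H [e _]; lia. Qed.

Lemma linear_exp G m i j k : linear_ser G -> (G ^+ m) i j k != 0 -> (i + j = m)%N /\ k = 0%N.
Proof.
move=> H; elim: m i j k => [|m IH] i j k.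
  by rewrite expr0 ser1E; case: i j k => [|i] [|j] [|k]; rewrite /= ?eqxx.
rewrite exprS => /serM_neq0 [a [b [c [a' [b' [c' [-> -> ->]]]]]]].
by move=> /H [e ->] /IH [e' ->]; split; lia.
Qed.

Variable (K1 : comNzRingType) (b : K1 -> K) (G1 G2 : ser K).
Hypotheses (hb : rhom b) (l1 : linear_ser G1) (l2 : linear_ser G2).

(** Linear substitutions preserve the degree in (x, y) and the power of eps. Applied to the complex
    coordinates and to their inverse, this transports order conditions both ways. *)
Lemma gsub_linear_neq0 f i j k : gsub b G1 G2 sE f i j k != 0 ->
  exists a c, (a + c = i + j)%N /\ f a c k != 0.
Proof.
move=> /(gsub_neq0 hb (linear_ord l1) (linear_ord l2) (@ordge_sE K)) [a [c [d [nz]]]].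
move=> /serM_neq0 [a1 [a2 [a3 [c1 [c2 [c3 [-> -> ->]]]]]]] /(linear_exp l1) [e1 ->].
move=> /serM_neq0 [b1 [b2 [b3 [d1 [d2 [d3 [-> -> ->]]]]]]] /(linear_exp l2) [e2 ->].
rewrite -[sE ^+ d]mulr1 sEnM; case: (leqP d d3) => le; last by rewrite eqxx.
rewrite ser1E; case: d1 d2 => [|?] [|?]; rewrite /= ?eqxx //.
have [z _|_] := eqVneq (d3 - d)%N 0%N; last by rewrite eqxx.
have e : d3 = d by lia.
by exists a, c; split; [lia | rewrite e !add0n].
Qed.
End Homogeneous.

Section ComplexCoordinates.
Variable R : rcfType.
Local Notation C := R[i].
Local Notation cR := (real_complex R).
Local Notation sC' := (@sC C).
Local Notation sX' := (@sX C).
Local Notation sY' := (@sY C).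

Definition ic : C := Complex 0 1.

Lemma ic2 : ic * ic = -1.
Proof. by rewrite -expr2 sqr_i. Qed.
Lemma ic_conj : conjc ic = - ic.
Proof. by apply/eqP; rewrite /ic eq_complex /= oppr0 !eqxx. Qed.
Lemma ic_neq0 : ic != 0.
Proof. by apply: contra_eq_neq ic2 => ->; rewrite mul0r eq_sym oppr_eq0 oner_eq0. Qed.

Definition c2 : C := 2^-1.
Lemma c2E : c2 + c2 = 1.
Proof. by rewrite /c2 -mulr2n -[LHS]mulr_natr mulVf // pnatr_eq0. Qed.
Lemma c2_conj : conjc c2 = c2.
Proof. by rewrite /c2 conjc_inv (conjc_nat R 2). Qed.

Lemma icc2_conj : conjc (- ic * c2) = ic * c2.
Proof.
have E : conjc (- ic * c2) = conjc (- ic) * conjc c2 by exact: (rmorphM (@conjc R)).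
have E' : conjc (- ic) = - conjc ic by exact: (rmorphN (@conjc R)).
by rewrite E E' ic_conj c2_conj opprK.
Qed.

(* f((z + zb)/2, (z - zb)/(2i), eps), with (z, zb) in the slots of (x, y) *)
Definition iX : ser C := sC c2 * (sX + sY).
Definition iY : ser C := sC (- ic * c2) * (sX - sY).
Definition zcoords : ser R -> ser C := gsub cR iX iY sE.

Lemma rhom_cR : rhom cR. Proof. exact: rhom_rmorphism. Qed.
Lemma rhom_conj : rhom (@conjc R). Proof. exact: (rhom_rmorphism (@conjc R)). Qed.
#[local] Hint Resolve rhom_cR rhom_conj : core.

Lemma linear_subXY : linear_ser (sX - sY : ser C).
Proof.
rewrite -[- sY]mulN1r -(sC1 C) -sC_N; apply: linear_serD; first exact: linear_sX.
by apply: linear_ser_C; apply: linear_sY.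
Qed.
Lemma linear_iX : linear_ser iX.
Proof. by apply: linear_ser_C; apply: linear_serD; [exact: linear_sX|exact: linear_sY]. Qed.
Lemma linear_iY : linear_ser iY.
Proof. by apply: linear_ser_C; exact: linear_subXY. Qed.

Lemma iotaP : [/\ ghom zcoords, forall c, zcoords (sC c) = sC (cR c),
  zcoords sX = iX, zcoords sY = iY & zcoords sE = sE].
Proof.
apply: (gsubP rhom_cR (linear_ord linear_iX) (linear_ord linear_iY) (@ordge_sE C)).
Qed.
Lemma iota_gh : ghom zcoords. Proof. by case: iotaP. Qed.
Lemma iota_C c : zcoords (sC c) = sC (cR c). Proof. by case: iotaP. Qed.
Lemma iota_E : zcoords sE = sE. Proof. by case: iotaP. Qed.
Lemma iota_X : zcoords sX = iX. Proof. by case: iotaP. Qed.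
Lemma iota_Y : zcoords sY = iY. Proof. by case: iotaP. Qed.

Definition kX : ser C := sX + sC ic * sY.
Definition kY : ser C := sX - sC ic * sY.
(** Resubstitution of z = x + i y and zb = x - i y: the inverse of [zcoords] once the coefficients
    are complex. *)
Definition kappa : ser C -> ser C := gsub id kX kY sE.

Lemma linear_kX : linear_ser kX.
Proof. by apply: linear_serD; [exact: linear_sX|apply: linear_ser_C; exact: linear_sY]. Qed.
Lemma linear_kY : linear_ser kY.
Proof.
apply: linear_serD; first exact: linear_sX.
by rewrite -mulNr -sC_N; apply: linear_ser_C; exact: linear_sY.
Qed.
Lemma kappaP : [/\ ghom kappa, forall c, kappa (sC c) = sC c,
  kappa sX = kX, kappa sY = kY & kappa sE = sE].
Proof.
exact: (gsubP (rhom_id C) (linear_ord linear_kX) (linear_ord linear_kY) (@ordge_sE C)).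
Qed.

Definition map_ser (K1 K2 : comNzRingType) (b : K1 -> K2) (f : ser K1) : ser K2 :=
  fun i j k => b (f i j k).

Lemma map_serE (K1 K2 : comNzRingType) (b : K1 -> K2) : rhom b ->
  map_ser b =1 gsub b sX sY sE.
Proof.
move=> hb f; apply: ser_ext => i j k; have := coef_gsub_scale hb 1 1 f i j k.
by rewrite !expr1n !mulr1 !sC1 !mul1r => ->.
Qed.

Lemma map_serP (K1 K2 : comNzRingType) (b : K1 -> K2) : rhom b ->
  [/\ ghom (map_ser b), forall c, map_ser b (sC c) = sC (b c),
  map_ser b sX = sX, map_ser b sY = sY & map_ser b sE = sE].
Proof.
move=> hb; have [gh gC gX gY gE] := gsubP hb (@ordge_sX K2) (@ordge_sY K2) (@ordge_sE K2).
have -> : map_ser b = gsub b sX sY sE by apply/funext => f; rewrite map_serE.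
by split.
Qed.

Lemma sC_c2E : sC' c2 + sC' c2 = 1.
Proof. by rewrite -sC_D c2E sC1. Qed.

Lemma kappa_iota f : kappa (zcoords f) = map_ser cR f.
Proof.
have [kh kC kXE kYE kE] := kappaP; have [mh mC mX mY mE] := map_serP rhom_cR.
move: f; apply: (ghom_eq (ghom_comp kh iota_gh) mh) => [c|||] /=.
- by rewrite iota_C kC mC.
- rewrite iota_X mX /iX (ghM kh) kC (ghD kh) kXE kYE /kX /kY.
  transitivity ((sC' c2 + sC' c2) * sX'); first ring.
  by rewrite sC_c2E mul1r.
- rewrite iota_Y mY /iY (ghM kh) kC (ghB kh) kXE kYE /kX /kY.
  rewrite sC_M sC_N.
  transitivity (- (sC' ic * sC' ic) * ((sC' c2 + sC' c2) * sY')); first ring.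
  by rewrite -sC_M ic2 sC_N opprK sC_c2E sC1 !mul1r.
- by rewrite iota_E kE mE.
Qed.

Lemma iota_inj f g : zcoords f = zcoords g -> f = g.
Proof.
move=> e0; have e1 := congr1 kappa e0.
rewrite (kappa_iota f) in e1.
rewrite (kappa_iota g) in e1.
clear e0.
apply: ser_ext => i j k.
have := congr1 (fun u : ser C => u i j k) e1; rewrite /map_ser; clear e1.
by case.
Qed.

Lemma iota_conj f p q m : zcoords f q p m = conjc (zcoords f p q m).
Proof.
rewrite -(coef_gsub_swap rhom_conj); congr (_ q p m).
have [gh gC gX gY gE] := gsubP rhom_conj (@ordge_sY C) (@ordge_sX C) (@ordge_sE C).
move: f; apply: (ghom_eq iota_gh (ghom_comp gh iota_gh)) => [c|||] /=.
- by rewrite iota_C gC conjc_real.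
- by rewrite iota_X /iX (ghM gh) (ghD gh) gC gX gY c2_conj [sX + _]addrC.
- rewrite iota_Y /iY (ghM gh) (ghB gh) gC gX gY icc2_conj.
  by rewrite mulNr sC_N; ring.
- by rewrite iota_E gE.
Qed.

(** The reality condition: by [iota_conj] and [iota_surj] it characterises the series that come from
    real ones. *)
Definition csym (h : ser C) := forall p q m, h q p m = conjc (h p q m).

Lemma iota_surj h : csym h -> exists f, zcoords f = h.
Proof.
move=> sh; pose f : ser R := fun i j k => complex.Re (kappa h i j k).
have [kh kC kXE kYE kE] := kappaP; have [mh mC mX mY mE] := map_serP rhom_cR.
have [ch cC cX cY cE] := map_serP rhom_conj.
have [gh gC gX gY gE] := gsubP rhom_conj (@ordge_sY C) (@ordge_sX C) (@ordge_sE C).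
have ck u : map_ser (@conjc R) (kappa u) = kappa (gsub (@conjc R) sY sX sE u).
  move: u; apply: (ghom_eq (ghom_comp ch kh) (ghom_comp kh gh)) => [c|||] /=.
  - by rewrite kC cC gC kC.
  - by rewrite kXE gX kYE /kX /kY (ghD ch) (ghM ch) cC cX cY ic_conj sC_N mulNr.
  - by rewrite kYE gY kXE /kX /kY (ghB ch) (ghM ch) cC cX cY ic_conj sC_N mulNr opprK.
  - by rewrite kE cE gE kE.
(* The symmetry of h says that [kappa h] is fixed by conjugation of its coefficients, so that taking
   real parts loses nothing. *)
have re : map_ser cR f = kappa h.
  have e : gsub (@conjc R) sY sX sE h = h.
    by apply: ser_ext => p q m; rewrite (coef_gsub_swap rhom_conj) -sh.
  apply: ser_ext => i j k; rewrite /map_ser /f.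
  have := congr1 (fun u : ser C => u i j k) (ck h); rewrite e /map_ser.
  case: (kappa h i j k) => x y [] /eqP; rewrite eq_sym -addr_eq0 -mulr2n mulrn_eq0 /=.
  by move=> /eqP ->.
exists f; pose io := gsub id iX iY (@sE C).
have [ih iC iXE iYE iE] : [/\ ghom io, forall c, io (sC c) = sC c,
  io sX = iX, io sY = iY & io sE = sE].
  exact: (gsubP (rhom_id C) (linear_ord linear_iX) (linear_ord linear_iY) (@ordge_sE C)).
have e1 u : zcoords u = io (map_ser cR u).
  move: u; apply: (ghom_eq iota_gh (ghom_comp ih mh)) => [c|||] /=.
  - by rewrite iota_C mC iC.
  - by rewrite iota_X mX iXE.
  - by rewrite iota_Y mY iYE.
  - by rewrite iota_E mE iE.
rewrite e1 re; move: h {f sh re}; apply: (ghom_eq (ghom_comp ih kh) (ghom_id C)) => [c|||] /=.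
- by rewrite kC iC.
- rewrite kXE /kX (ghD ih) (ghM ih) iC iXE iYE /iX /iY sC_M sC_N.
  transitivity (sC' c2 * (sX' + sY') - (sC' ic * sC' ic) * sC' c2 * (sX' - sY')); first ring.
  rewrite -sC_M ic2 sC_N sC1; transitivity ((sC' c2 + sC' c2) * sX'); first ring.
  by rewrite sC_c2E mul1r.
- rewrite kYE /kY (ghB ih) (ghM ih) iC iXE iYE /iX /iY sC_M sC_N.
  transitivity (sC' c2 * (sX' + sY') + (sC' ic * sC' ic) * sC' c2 * (sX' - sY')); first ring.
  rewrite -sC_M ic2 sC_N sC1; transitivity ((sC' c2 + sC' c2) * sY'); first ring.
  by rewrite sC_c2E mul1r.
- by rewrite kE iE.
Qed.

(** The bracket of z and zb is - 2 i; its sign is absorbed by exchanging the arguments. *)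
Lemma iota_lie H g : zcoords (ham_lie H g) = sC (2 * ic) * pb (zcoords H) (zcoords g).
Proof.
rewrite (pb_gh iota_gh iota_C iota_E) iota_X iota_Y.
have -> : pb iX iY = sC (ic * c2).
  rewrite /iX /iY pb_CMl pb_CMr pbDl !pbDr !pbNr !pb_Xl !pb_Yl.
  rewrite dx_X dx_Y dy_X dy_Y sC_M sC_N.
  transitivity (sC' ic * sC' c2 * (sC' c2 + sC' c2)); first ring.
  by rewrite -!sC_M -sC_D c2E -sC_M mulr1.
have e : 2 * ic * (ic * c2) = -1.
  have -> : 2 * ic * (ic * c2) = (c2 + c2) * (ic * ic) by ring.
  by rewrite c2E mul1r ic2.
by rewrite mulrCA -sC_M e sC_N sC1 mulrN1 -(ghN iota_gh) /ham_lie pbC.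
Qed.
End ComplexCoordinates.

(** * The homological equation *)

Section Recurrence.
Variable F : realFieldType.
Variables (s e : nat).

(* Coefficient of frequency k + 1 of the bracket of the leading part
   a (z zb)^2 + b (z^n + zb^n) with a homogeneous term of weight s, up to
   normalisation. *)
Definition hop (th ka : F) (y : nat -> F) (k : nat) : F :=
  (s%:R - (e * k)%:R) * y k - th * k.+1%:R * y k.+1 - ka * (s + e * k.+2)%:R * y k.+2.

Lemma hop_lin th ka (u v : nat -> F) c k :
  hop th ka (fun j => u j + c * v j) k = hop th ka u k + c * hop th ka v k.
Proof. by rewrite /hop; ring. Qed.

(** The recurrence is solved downwards from K: the diagonal factor s - e k is nonzero below K, and
    the value at K is free. *)
Lemma hop_solve th ka K c (rho : nat -> F) : (forall k, (k < K)%N -> (e * k < s)%N) ->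
  exists y : nat -> F, [/\ y K = c, forall j, (K < j)%N -> y j = 0 &
    forall k, (k < K)%N -> hop th ka y k = rho k].
Proof.
move=> H.
suff [y [? ? Hy]] : exists y : nat -> F, [/\ y K = c, forall j, (K < j)%N -> y j = 0 &
    forall k, (K - K <= k < K)%N -> hop th ka y k = rho k].
  by exists y; split=> // k kK; apply: Hy; rewrite subnn.
have : (K <= K)%N by [].
(* Only the length d of the solved range K - d <= k < K varies in the induction. *)
elim: {1 6}K => [|d IH] dK.
  exists (fun j => if j == K then c else 0); split=> [|j|k]; rewrite ?eqxx //.
    by move=> Kj; rewrite gtn_eqF.
  by rewrite subn0; case: leqP.
have [y [y1 y2 y3]] := IH (ltnW dK).
pose k0 := (K - d.+1)%N.
have k0K : (k0 < K)%N by rewrite /k0; lia.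
have nz : s%:R - (e * k0)%:R != 0 :> F.
  by rewrite subr_eq0 eqr_nat eq_sym ltn_eqF // H.
pose v := (rho k0 + th * k0.+1%:R * y k0.+1 + ka * (s + e * k0.+2)%:R * y k0.+2) / (s%:R - (e * k0)%:R).
have ne j : (k0 < j)%N -> (j == k0) = false by move=> h; rewrite gtn_eqF.
exists (fun j => if j == k0 then v else y j); split=> [|j jK|k /andP[ka1 kb]].
- by rewrite ne.
- by rewrite ne ?y2 //; lia.
- rewrite /hop !(ne k.+1) ?(ne k.+2); [|by rewrite /k0 in ka1 *; lia..].
  case: eqP => [->|nk]; last by apply: y3; rewrite /k0 in nk ka1; lia.
  by rewrite /v mulrC divfK //; ring.
Qed.

Lemma hop_zero th ka K k0 y : (forall k, (k < K)%N -> (e * k < s)%N) ->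
  (forall j, (K <= j)%N -> y j = 0) ->
  (forall k, (k0 <= k < K)%N -> hop th ka y k = 0) -> forall j, (k0 <= j)%N -> y j = 0.
Proof.
move=> H y0 Hy.
suff E d j : (k0 <= j)%N -> (K <= j + d)%N -> y j = 0.
  by move=> j kj; apply: (E K) => //; apply: leq_addl.
elim: d j => [|d IH] j kj; first by rewrite addn0; apply: y0.
move=> le; have [Kj|jK] := leqP K j; first exact: y0.
have := Hy j; rewrite kj jK /hop (IH j.+1) ?(IH j.+2) //; try lia.
move=> /(_ isT) /eqP; rewrite !mulr0 !subr0 mulf_eq0 subr_eq0 eqr_nat.
by rewrite eq_sym ltn_eqF ?H //= => /eqP.
Qed.

(** Each equation expresses a positive multiple of [y k] as a positive multiple of [y k.+1] plus a
    nonnegative multiple of [y k.+2]. *)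
Lemma hop_pos th ka K y : 0 < th -> 0 <= ka -> (forall k, (k < K)%N -> (e * k < s)%N) ->
  y K = 1 -> (forall j, (K < j)%N -> y j = 0) ->
  (forall k, (k < K)%N -> hop th ka y k = 0) -> forall j, (j <= K)%N -> 0 < y j.
Proof.
move=> th0 ka0 H yK y0 Hy.
suff E d j : (j <= K)%N -> (K <= j + d)%N -> 0 < y j.
  by move=> j jK; apply: (E K) => //; apply: leq_addl.
elim: d j => [|d IH] j jK le.
  by have -> : j = K; [lia | rewrite yK].
move: jK; rewrite leq_eqVlt => /orP[/eqP ->|jK]; first by rewrite yK.
have p1 : 0 < y j.+1 by apply: IH => //; lia.
have p2 : 0 <= y j.+2.
  by have [h|/y0 ->//] := leqP j.+2 K; apply: ltW; apply: IH => //; lia.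
have d0 : 0 < s%:R - (e * j)%:R :> F by rewrite subr_gt0 ltr_nat H.
have := Hy j jK; rewrite /hop => /eqP; rewrite -addrA -opprD subr_eq0 => /eqP e1.
rewrite -(pmulr_rgt0 _ d0) e1; apply: ltr_pwDl.
  by rewrite !mulr_gt0 // ltr0n.
by rewrite !mulr_ge0 // ler0n.
Qed.

(** After normalisation to [y K = 1] this is positivity. For negative [th] the signs of y are
    alternated, which reverses [th] and leaves [ka] alone. *)
Lemma hop_neq0 th ka K y : th != 0 -> 0 <= ka -> (forall k, (k < K)%N -> (e * k < s)%N) ->
  y K != 0 -> (forall j, (K < j)%N -> y j = 0) ->
  (forall k, (k < K)%N -> hop th ka y k = 0) -> y 0%N != 0.
Proof.
move=> th0 ka0 H yK y0 Hy.
have [lt|gt|e0] := ltgtP 0 th; last by rewrite -e0 eqxx in th0.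
  suff : 0 < (y K)^-1 * y 0%N by apply: contraTneq => ->; rewrite mulr0 ltxx.
  apply: (@hop_pos th ka K (fun j => (y K)^-1 * y j)) => //.
  - by rewrite mulVf.
  - by move=> j /y0 ->; rewrite mulr0.
  move=> k kK; rewrite -[RHS](mulr0 ((y K)^-1)) -(Hy k kK) /hop; ring.
suff : 0 < (y K)^-1 * ((-1) ^+ (K - 0) * y 0%N).
  by apply: contraTneq => ->; rewrite !mulr0 ltxx.
apply: (@hop_pos (- th) ka K (fun j => (y K)^-1 * ((-1) ^+ (K - j) * y j))) => //.
- by rewrite oppr_gt0.
- by rewrite subnn mul1r mulVf.
- by move=> j /y0 ->; rewrite !mulr0.
move=> k kK; rewrite -[RHS](mulr0 ((y K)^-1 * (-1) ^+ (K - k))) -(Hy k kK) /hop.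
have -> : (K - k = (K - k.+1).+1)%N by lia.
have [lt2|/y0 ->] := leqP k.+2 K; last by rewrite exprS; ring.
have e5 : (K - k.+1 = (K - k.+2).+1)%N by lia.
by rewrite e5 !exprS; ring.
Qed.

(** For n = 3 there is no term in [y k.+1]: the recurrence has step 2, and nonvanishing at K
    propagates only to the frequencies of the parity of K. *)
Lemma hop0_neq0 ka K y i : 0 < ka -> (forall k, (k < K)%N -> (e * k < s)%N) ->
  y K != 0 -> (forall k, (k < K)%N -> hop 0 ka y k = 0) -> (i.*2 <= K)%N ->
  y (K - i.*2)%N != 0.
Proof.
move=> ka0 H yK Hy; elim: i => [|i IH]; first by rewrite subn0.
rewrite doubleS => le; have := IH; rewrite (_ : (i.*2 <= K)%N = true); last by lia.
move=> /(_ isT).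
have -> : (K - i.*2 = (K - i.*2.+2).+2)%N by lia.
apply: contraNneq => z; have lt : (K - i.*2.+2 < K)%N by lia.
have := Hy _ lt; rewrite /hop z mulr0 !mul0r subr0 sub0r => /eqP.
rewrite oppr_eq0 !mulf_eq0 (gt_eqF ka0) pnatr_eq0 /= => /orP[/eqP|//].
by move: (H _ lt) => /[swap]; case: s => // /eqP; rewrite addn_eq0.
Qed.

Lemma sub_half q : (q - q./2.*2 = odd q)%N.
Proof. by rewrite -{1}(odd_double_half q) addnK. Qed.
Lemma half_leq q : (q./2.*2 <= q)%N.
Proof. by rewrite -{2}(odd_double_half q) leq_addl. Qed.

(* Solvability of the homological equation at weight s + 1.  [yR], [yI] are
   the real and imaginary parts of the unknown, [N0], [N1] the parts absorbed by
   the normal form; g = 1 if n >= 4 and g = 2 if n = 3. *)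
Section Homological.
Variables (g : nat) (th ka mu la : F).
Hypotheses (eg : e = g.+1) (hg : (g == 1)%N || (g == 2)%N) (ka0 : 0 <= ka)
  (la0 : la != 0) (h1 : g = 1%N -> th != 0)
  (h2 : g = 2%N -> [/\ th = 0, 0 < ka & (1 < s)%N -> mu != 0]).

Let eM : (s = e * (s %/ e) + s %% e)%N.
Proof. by rewrite mulnC -divn_eq. Qed.

Let modlt : (s %% e < e)%N. Proof. by rewrite ltn_mod eg. Qed.

Let eMle k q : (k <= q)%N -> (e * k <= e * q)%N.
Proof. exact: leq_mul. Qed.

Let coefM k : (k < s %/ e)%N -> (e * k < s)%N.
Proof.
move=> /eMle; rewrite mulnS; move: eM modlt.
by move: (e * (s %/ e))%N (s %% e)%N (e * k)%N => A B C; lia.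
Qed.

Let coefM1 k : ~~ (e %| s)%N -> (k < (s %/ e).+1)%N -> (e * k < s)%N.
Proof.
rewrite /dvdn ltnS => nd /eMle; move: eM nd.
by move: (e * (s %/ e))%N (s %% e)%N (e * k)%N => A B C; lia.
Qed.

Let e2 : (2 <= e)%N. Proof. by rewrite eg; case/orP: hg => /eqP ->. Qed.

Let rangeF k : (e %| s)%N -> (e * k.+1 <= s.+1)%N -> (k < s %/ e)%N.
Proof.
rewrite /dvdn => /eqP d; rewrite mulnS ltnNge => h; apply/negP => /eMle.
move: eM e2 h; rewrite d.
by move: (e * (s %/ e))%N (e * k)%N => A B; lia.
Qed.

Let rangeF' k : (e %| s)%N -> (k < s %/ e)%N -> (e * k.+1 <= s.+1)%N.
Proof.
move=> d /eMle h; apply: leqW; apply: leq_trans h _.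
by rewrite mulnC divnK.
Qed.

Let rangeN k : (e * k.+1 <= s.+1)%N -> (k < (s %/ e).+1)%N.
Proof.
move=> h; rewrite ltnS leq_divRL; last by rewrite eg.
by move: h e2; rewrite mulnS mulnC; move: (k * e)%N; lia.
Qed.

(** The imaginary chain is the constrained one: [yI 0] must vanish because diagonal coefficients are
    real, and [yI 1] enters the diagonal equation for t0. If e divides s, its free top coefficient
    serves to meet a constraint; otherwise N1 takes up the error. For g = 2 the parity of s leaves
    only one of the two constraints; for g = 1 the second one is met by N0. *)
Lemma homological_solve (tR tI : nat -> F) (t0 : F) :
  exists (yR yI : nat -> F) (N0 N1 : F),
  [/\ forall k, (e * k.+1 <= s.+1)%N -> hop th ka yR k = - (tI k / la),
      forall k, (e * k.+1 <= s.+1)%N -> hop th ka yI k = (tR k - (if k == 0%N then N1 else 0)) / la,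
      ((g %| s)%N -> yI 0%N = 0) /\ (forall j, (s < e * j)%N -> yR j = 0 /\ yI j = 0),
      ((g %| s.+1)%N -> t0 - N0 + mu * yI 1%N = 0) &
      (N1 != 0 -> ~~ (e %| s)%N) /\ (N0 != 0 -> g = 1%N \/ ~~ (e %| s)%N)].
Proof.
pose M := (s %/ e)%N.
have big j : (s < e * j)%N -> (M < j)%N.
  by move=> h; rewrite /M ltn_divLR ?eg //; rewrite eg mulnC in h.
have [df|nd] := orP (orbN (e %| s)%N); last first.
  have [yR [R0 R1 R2]] := hop_solve th ka 0 (fun k => - (tI k / la)) (fun k => @coefM1 k nd).
  have [yI [I0 I1 I2]] := hop_solve th ka 0 (fun k => tR k / la) (fun k => @coefM1 k nd).
  (* Resetting the coefficient of frequency 0 disturbs only the equation k = 0, which is the one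
     where N1 occurs. *)
  pose y j := if j == 0%N then 0 else yI j.
  have Z u j : u M.+1 = 0 -> (forall j, (M.+1 < j)%N -> u j = 0) -> (M < j)%N -> u j = 0 :> F.
    by move=> a b; rewrite leq_eqVlt => /orP[/eqP <-//|/b].
  exists yR, y, (t0 + mu * y 1%N), (tR 0%N - la * hop th ka y 0); split.
  - by move=> k hk; apply: R2; apply: rangeN.
  - case=> [|k] hk /=; first by rewrite opprB addrC subrK mulrC mulKf.
    by rewrite subr0 -I2 //; apply: rangeN.
  - split=> // j /big jM; split; first exact: Z jM.
    by rewrite /y; case: j jM => // j jM; apply: Z jM.
  - by move=> _; ring.
  - by split=> // _; right.
have [yR [R0 R1 R2]] := hop_solve th ka 0 (fun k => - (tI k / la)) coefM.
have [yI [I0 I1 I2]] := hop_solve th ka 0 (fun k => tR k / la) coefM.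
have [h [H0 H1 H2]] := hop_solve th ka 1 (fun=> 0) coefM.
have hM : h M != 0 by rewrite H0 oner_eq0.
(* Adding a multiple of the homogeneous solution h keeps all the equations with N1 = 0; it remains
   to choose the multiple. *)
have fin c N0 : ((g %| s)%N -> yI 0%N + c * h 0%N = 0) ->
    ((g %| s.+1)%N -> t0 - N0 + mu * (yI 1%N + c * h 1%N) = 0) -> (N0 != 0 -> g = 1%N) ->
  exists (yR yI : nat -> F) (N0 N1 : F),
  [/\ forall k, (e * k.+1 <= s.+1)%N -> hop th ka yR k = - (tI k / la),
      forall k, (e * k.+1 <= s.+1)%N -> hop th ka yI k = (tR k - (if k == 0%N then N1 else 0)) / la,
      ((g %| s)%N -> yI 0%N = 0) /\ (forall j, (s < e * j)%N -> yR j = 0 /\ yI j = 0),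
      ((g %| s.+1)%N -> t0 - N0 + mu * yI 1%N = 0) &
      (N1 != 0 -> ~~ (e %| s)%N) /\ (N0 != 0 -> g = 1%N \/ ~~ (e %| s)%N)].
  move=> c1 c2 c3; exists yR, (fun j => yI j + c * h j), N0, 0; split=> //.
  - by move=> k hk; apply: R2; apply: rangeF.
  - move=> k hk; rewrite if_same subr0 hop_lin I2 ?H2 ?mulr0 ?addr0 //;
    exact: rangeF.
  - split=> // j /big jM; split; first exact: R1.
    by rewrite I1 // H1 // mulr0 addr0.
  - by split=> [|/c3]; [rewrite eqxx|left].
case/orP: hg => /eqP g1.
  have hn : h 0%N != 0 by apply: (hop_neq0 (h1 g1) ka0 coefM hM H1 H2).
  refine (fin (- (yI 0%N / h 0%N)) (t0 + mu * (yI 1%N - yI 0%N / h 0%N * h 1%N)) _ _ _) => //.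
  - by rewrite mulNr divfK ?subrr.
  - by move=> _; ring.
have [th0 kap mu0] := h2 g1; have e3 : e = 3%N by rewrite eg g1.
have sM : s = (3 * M)%N by rewrite -e3 mulnC divnK.
have H20 k : (k < M)%N -> hop 0 ka h k = 0 by move=> /H2; rewrite th0.
(* Here s = 3 M. For odd M the diagonal equation has to hold with N0 = 0, which is achieved through
   [h 1]; for even M it is [yI 0] that must vanish, through [h 0]. *)
have [oM|oM] := boolP (odd M).
  have hn : h 1%N != 0.
    have := hop0_neq0 (i := M./2) kap coefM hM H20.
    by rewrite sub_half oM; apply; apply: half_leq.
  have m0 : mu != 0.
      apply: mu0; rewrite sM (leq_trans (_ : 1 < 3 * 1)%N) // leq_pmul2l //.
      exact: odd_gt0.
  apply: (fin ((- t0 / mu - yI 1%N) / h 1%N) 0).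
  - by rewrite g1 sM dvdn2 oddM oM.
  - by move=> _; rewrite divfK // subr0; field.
  - by rewrite eqxx.
have hn : h 0%N != 0.
  have := hop0_neq0 (i := M./2) kap coefM hM H20.
  by rewrite sub_half (negPf oM); apply; apply: half_leq.
apply: (fin (- (yI 0%N / h 0%N)) 0) => [|d|].
- by rewrite mulNr divfK ?subrr.
- by move: d; rewrite g1 sM dvdn2 /= oddM (negPf oM).
- by rewrite eqxx.
Qed.

(** The dichotomy read backwards. If e does not divide s, no coefficient is free and downward
    recursion kills everything. If e divides s, then N1 = 0, and a nonzero top coefficient of yI
    would propagate down to frequency 0 or 1, against the constraint there; only the real chain
    keeps a free coefficient. *)
Lemma homological_unique (yR yI : nat -> F) (N0 N1 : F) :
  (forall k, (e * k.+1 <= s.+1)%N -> hop th ka yR k = 0) ->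
  (forall k, (e * k.+1 <= s.+1)%N -> la * hop th ka yI k = (if k == 0%N then N1 else 0)) ->
  (forall j, (s < e * j)%N || ~~ (g %| s - e * j)%N -> yR j = 0 /\ yI j = 0) ->
  ((g %| s)%N -> yI 0%N = 0) ->
  ((g %| s.+1)%N -> N0 = mu * yI 1%N) ->
  (N1 != 0 -> ~~ (e %| s)%N) -> (N0 != 0 -> g = 1%N \/ ~~ (e %| s)%N) ->
  [/\ (e <= s.+1)%N -> N1 = 0, (g %| s.+1)%N -> N0 = 0, forall j, yI j = 0,
      ~~ (e %| s)%N -> forall j, yR j = 0 &
      yR (s %/ e)%N = 0 -> forall j, yR j = 0].
Proof.
move=> ER EI Z I0 E0 A1 A0; pose M := (s %/ e)%N.
have big j : (M < j)%N -> (s < e * j)%N.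
  by move=> h; rewrite mulnC -ltn_divLR ?eg // -eg.
(* A frequency k <= M without an equation: this forces g = 2 and s - e k = 1, so that k has the
   wrong parity. *)
have out k : ~~ (e %| s)%N -> (k < M.+1)%N -> (s.+1 < e * k.+1)%N ->
    forall j, (k <= j)%N -> yR j = 0 /\ yI j = 0.
  move=> nd kM lt j; rewrite leq_eqVlt => /orP[/eqP <-|kj]; apply: Z.
    have := coefM1 nd kM; move: lt; rewrite mulnS eg.
    by case/orP: hg => /eqP ->; move: (_ * k)%N => A; clear; lia.
  have : (e * k.+1 <= e * j)%N by apply: leq_mul.
  by move=> h; rewrite (leq_trans (ltnW lt) h).
have Z0 y k : (forall j, (k <= j)%N -> y j = 0) -> hop th ka y k = 0.
  by move=> h; rewrite /hop !h ?mulr0 ?subr0 //; lia.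
have EI' k : (0 < k)%N -> (e * k.+1 <= s.+1)%N -> hop th ka yI k = 0.
  move=> k0 /EI /eqP; rewrite gtn_eqF // mulf_eq0 (negPf la0) /= => /eqP //.
have [df|nd] := orP (orbN (e %| s)%N); last first.
  have aR k : (0 <= k < M.+1)%N -> hop th ka yR k = 0.
    move=> kM; have [/ER //|lt] := leqP (e * k.+1) s.+1.
    by apply: Z0 => j kj; case: (out k nd kM lt j kj).
  have aI k : (1 <= k < M.+1)%N -> hop th ka yI k = 0.
    move=> /andP[k0 kM]; have [/EI' ->//|lt] := leqP (e * k.+1) s.+1.
    by apply: Z0 => j kj; case: (out k nd kM lt j kj).
  have bz j : (M.+1 <= j)%N -> yR j = 0 /\ yI j = 0 by move=> h; apply: Z; rewrite big.
  have R0 j : yR j = 0.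
    apply: (hop_zero (fun k => @coefM1 k nd) _ aR) => // i /bz [] //.
  have I1 j : (1 <= j)%N -> yI j = 0.
    by apply: (hop_zero (fun k => @coefM1 k nd) _ aI) => i /bz [].
  have I00 j : yI j = 0.
    case: j => [|j]; last exact: I1.
    have [/I0 //|ng] := boolP (g %| s)%N.
    by case: (Z 0%N) => //; rewrite muln0 subn0 ng orbT.
  split=> //.
  - by move=> h; have := EI 0%N; rewrite muln1 Z0 // mulr0 => /(_ h) /= <-.
  - by move=> h; rewrite E0 // I00 mulr0.
have N10 : N1 = 0 by apply/eqP; apply: contraT => /A1; rewrite df.
have aR k : (0 <= k < M)%N -> hop th ka yR k = 0.
  by move=> kM; apply: ER; apply: rangeF'.
have aI k : (0 <= k < M)%N -> hop th ka yI k = 0.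
  move=> kM; have /eqP := EI k (rangeF' df kM).
  by rewrite N10 if_same mulf_eq0 (negPf la0) /= => /eqP.
have bz j : (M < j)%N -> yR j = 0 /\ yI j = 0 by move=> h; apply: Z; rewrite big.
have aux y : (forall k, (0 <= k < M)%N -> hop th ka y k = 0) ->
    (forall j, (M < j)%N -> y j = 0) -> y M = 0 -> forall j, y j = 0.
  move=> h yz y0 j; apply: (hop_zero coefM _ h) => // i.
  by rewrite leq_eqVlt => /orP[/eqP <- //|/yz].
have IM : yI M = 0.
  apply/eqP; apply: contraT => nz; case/orP: hg => /eqP g1.
    have := hop_neq0 (h1 g1) ka0 coefM nz (fun j h => (bz j h).2) aI.
    by rewrite I0 ?eqxx // g1.
  have [th0 kap mu0] := h2 g1; have e3 : e = 3%N by rewrite eg g1.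
  have sM : s = (3 * M)%N by rewrite -e3 mulnC divnK.
  have aI0 k : (k < M)%N -> hop 0 ka yI k = 0 by move=> /aI; rewrite th0.
  have := hop0_neq0 (i := M./2) kap coefM nz aI0.
  have [oM|oM] := boolP (odd M).
    rewrite sub_half oM.
    have N00 : N0 = 0 by apply/eqP; apply: contraT => /A0 [|]; rewrite ?g1 ?df.
    have m0 : mu != 0.
      apply: mu0; rewrite sM (leq_trans (_ : 1 < 3 * 1)%N) // leq_pmul2l //.
      exact: odd_gt0.
    have := E0; rewrite N00 g1 => /(_ _)/esym/eqP; rewrite mulf_eq0 (negPf m0) /=.
    by move=> -> ; [apply; apply: half_leq | rewrite sM dvdn2 /= oddM oM].
  rewrite sub_half (negPf oM).
  by rewrite I0 ?eqxx; [apply; apply: half_leq | rewrite g1 sM dvdn2 oddM (negPf oM)].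
have I00 := aux _ aI (fun j h => (bz j h).2) IM.
split=> // [h|nd|]; [by rewrite E0 // I00 mulr0|by rewrite df in nd|].
exact: (aux _ aR (fun j h => (bz j h).1)).
Qed.
End Homological.
End Recurrence.

Lemma pb_neq0 (K : comNzRingType) (f h : ser K) P Q m : pb f h P Q m != 0 ->
  exists p1 q1 m1 p2 q2 m2, [/\ (p1 + p2 = P.+1)%N, (q1 + q2 = Q.+1)%N,
    (m1 + m2 = m)%N, f p1 q1 m1 != 0 & h p2 q2 m2 != 0].
Proof.
have key (a b c : nat) (x : K) l : x *+ l != 0 -> x != 0.
  by apply: contraNneq => ->; rewrite mul0rn.
rewrite /pb serB => nz.
have [z|nz1] := eqVneq ((dx f * dy h) P Q m) 0; last first.
  have [a [b [c [a' [b' [c' [-> -> -> n1 n2]]]]]]] := serM_neq0 nz1.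
  exists a.+1, b, c, a', b'.+1, c'; rewrite addSn addnS; split=> //.
    exact: (key 0 0 0 _ _ n1)%N.
  exact: (key 0 0 0 _ _ n2)%N.
rewrite z sub0r oppr_eq0 in nz.
have [a [b [c [a' [b' [c' [-> -> -> n1 n2]]]]]]] := serM_neq0 nz.
exists a, b.+1, c, a'.+1, b', c'; rewrite addSn addnS; split=> //.
  exact: (key 0 0 0 _ _ n1)%N.
exact: (key 0 0 0 _ _ n2)%N.
Qed.

Lemma monM_coef (K : comNzRingType) a b c (f : ser K) i j k : (mon a b c * f) i j k =
  if (a <= i)%N && (b <= j)%N && (c <= k)%N then f (i - a)%N (j - b)%N (k - c)%N else 0.
Proof.
rewrite /mon -!mulrA sXnM; case: (a <= i)%N => //=; rewrite sYnM.
by case: (b <= j)%N => //=; rewrite sEnM.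
Qed.

Lemma dx_mon (K : comNzRingType) a b c : dx (mon a b c) = mon a.-1 b c *+ a :> ser K.
Proof.
apply: ser_ext => i j k; rewrite /dx serMn !monE.
by case: a => [|a]; rewrite ?mulr0n ?mul0rn //= eqSS; case: (eqVneq i a) => [->//|_];
  rewrite !mul0rn.
Qed.
Lemma dy_mon (K : comNzRingType) a b c : dy (mon a b c) = mon a b.-1 c *+ b :> ser K.
Proof.
apply: ser_ext => i j k; rewrite /dy serMn !monE.
case: b => [|b]; first by rewrite andbF mul0rn.
by rewrite eqSS; case: (eqVneq j b) => [->//|_]; rewrite andbF !mul0rn.
Qed.

Lemma pb_mon (K : comNzRingType) a b (h : ser K) P Q m :
  pb (mon a b 0%N) h P Q m =
  (if (a.-1 <= P)%N && (b <= Q)%N then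
     h (P - a.-1)%N (Q - b).+1 m *+ ((Q - b).+1 * a) else 0) -
  (if (a <= P)%N && (b.-1 <= Q)%N then
     h (P - a).+1 (Q - b.-1)%N m *+ ((P - a).+1 * b) else 0).
Proof.
rewrite /pb dx_mon dy_mon !mulrnAl serB !serMn !monM_coef !leq0n !andbT !subn0.
by rewrite /dx /dy; do 2!case: ifP => _; rewrite -?mulrnA ?mul0rn.
Qed.

(** * The weight filtration *)

Section Weights.
Variables (n g : nat).
Hypothesis hng : ((g == 1%N) && (4 <= n)%N) || ((g == 2%N) && (n == 3%N)).
Local Notation e := g.+1.

Lemma n_ge3 : (3 <= n)%N. Proof. by case/orP: hng => /andP[_]; [lia | move/eqP->]. Qed.
Lemma g_cases : (g == 1)%N || (g == 2)%N.
Proof. by case/orP: hng => /andP[-> _]; rewrite ?orbT. Qed.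
Lemma gn_ge : (2 * e <= g * n)%N.
Proof. by case/orP: hng => /andP[/eqP-> h]; [lia | rewrite (eqP h)]. Qed.

(* Weight of z^p zb^q eps^m.  With k = min(p, q) and p - q = +- n j, the
   monomial is (z zb)^k times (z or zb)^(n j), and weight = g k + (g + 1) j + 2 m;
   the terms of lowest weight are then (z zb)^2 (if n >= 4), z^n and zb^n. *)
Definition weight p q m : nat :=
  (g * minn p q + e * ((maxn p q - minn p q) %/ n) + 2 * m)%N.

Definition same_residue p q : bool := (p == q %[mod n]).

Lemma wtC p q m : weight p q m = weight q p m.
Proof. by rewrite /weight minnC maxnC. Qed.
Lemma resC p q : same_residue p q = same_residue q p. Proof. by rewrite /same_residue eq_sym. Qed.

Lemma wtE r j m : weight (r + j * n) r m = (g * r + e * j + 2 * m)%N.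
Proof.
rewrite /weight (minn_idPr (leq_addr _ _)) (maxn_idPl (leq_addr _ _)) addKn mulnK //.
by apply: leq_trans n_ge3.
Qed.

Lemma resE r j : same_residue (r + j * n) r. Proof. by rewrite /same_residue addnC modnMDl. Qed.

Lemma resP p q : same_residue p q -> exists r j, (p = r + j * n /\ q = r)%N \/ (p = r /\ q = r + j * n)%N.
Proof.
rewrite /same_residue => h; have [le|/ltnW le] := leqP q p.
  exists q, ((p - q) %/ n)%N; left; rewrite divnK ?subnKC //.
  by rewrite -eqn_mod_dvd // eq_sym eq_sym.
exists p, ((q - p) %/ n)%N; right; rewrite divnK ?subnKC //.
by rewrite -eqn_mod_dvd // eq_sym.
Qed.

(** Here d counts the pairs z zb removed: 1 for a bracket, 0 for a product. If the two frequencies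
    have opposite signs, factors z^n zb^n merge into (z zb)^n, whose weight g n is at least 2 e, so
    the weight can only grow. *)
Lemma wt_add d p1 q1 m1 p2 q2 m2 P Q : same_residue p1 q1 -> same_residue p2 q2 ->
  (p1 + p2 = P + d)%N -> (q1 + q2 = Q + d)%N ->
  same_residue P Q /\ (weight p1 q1 m1 + weight p2 q2 m2 <= weight P Q (m1 + m2) + g * d)%N.
Proof.
move=> h1 h2; wlog le : p1 q1 p2 q2 P Q h1 h2 / (Q <= P)%N.
  move=> H eP eQ; have [le|/ltnW le] := leqP Q P; first exact: H.
  rewrite resC (wtC p1) (wtC p2) (wtC P); apply: H => //; by rewrite resC.
move=> eP eQ; have [r1 [j1 c1]] := resP h1; have [r2 [j2 c2]] := resP h2.
have gn := gn_ge; have n3 := n_ge3.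
have aux r (j a b : nat) : (g * (r + a) = g * r + g * a)%N by rewrite mulnDr.
case: c1 => -[ep1 eq1]; case: c2 => -[ep2 eq2]; subst p1 q1 p2 q2.
- have -> : P = (Q + (j1 + j2) * n)%N by rewrite mulnDl; lia.
  split; first exact: resE.
  rewrite !wtE; have : (g * (r1 + r2) = g * (Q + d))%N by rewrite eQ.
  by rewrite !mulnDr; lia.
- have le2 : (j2 <= j1)%N.
    by rewrite -(leq_pmul2r (leq_trans _ n3)) //; lia.
  have -> : P = (Q + (j1 - j2) * n)%N by rewrite mulnBl; lia.
  split; first exact: resE.
  rewrite (wtC r2) !wtE; have : (g * (r1 + r2 + j2 * n) = g * (Q + d))%N by rewrite -eQ addnA.
  have : (2 * e * j2 <= g * n * j2)%N by rewrite leq_mul2r gn orbT.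
  have : (e * j2 <= e * j1)%N by rewrite leq_mul2l le2 orbT.
  have -> : (2 * e * j2 = 2 * (e * j2))%N by rewrite mulnA.
  have e3 : (g * (j2 * n) = g * n * j2)%N by rewrite (mulnC j2) mulnA.
  rewrite mulnBr; move: (e * j2)%N (e * j1)%N => A B; rewrite !(mulnDr g) e3.
  by move: (g * n * j2)%N => D; clear; lia.
- have le2 : (j1 <= j2)%N.
    by rewrite -(leq_pmul2r (leq_trans _ n3)) //; lia.
  have -> : P = (Q + (j2 - j1) * n)%N by rewrite mulnBl; lia.
  split; first exact: resE.
  rewrite (wtC r1) !wtE; have : (g * (r1 + r2 + j1 * n) = g * (Q + d))%N by rewrite -eQ; congr (_ * _)%N; lia.
  have : (2 * e * j1 <= g * n * j1)%N by rewrite leq_mul2r gn orbT.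
  have : (e * j1 <= e * j2)%N by rewrite leq_mul2l le2 orbT.
  have -> : (2 * e * j1 = 2 * (e * j1))%N by rewrite mulnA.
  have e3 : (g * (j1 * n) = g * n * j1)%N by rewrite (mulnC j1) mulnA.
  rewrite mulnBr; move: (e * j2)%N (e * j1)%N => A B; rewrite !(mulnDr g) e3.
  by move: (g * n * j1)%N => D; clear; lia.
- have le3 : (j1 + j2 = 0)%N.
    have : ((j1 + j2) * n <= 0)%N by rewrite mulnDl; lia.
    by rewrite leqn0 muln_eq0 => /orP[/eqP //|/eqP n0]; rewrite n0 in n3.
  have [-> ->] : j1 = 0%N /\ j2 = 0%N by lia.
  have -> : P = (Q + 0 * n)%N by lia.
  split; first exact: resE.
  rewrite (wtC r1) (wtC r2) !wtE; have : (g * (r1 + r2) = g * (Q + d))%N by congr (_ * _)%N; lia.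
  by rewrite !mulnDr; lia.
Qed.

Lemma wt_le p q m : (weight p q m <= 2 * (p + q + m))%N.
Proof.
rewrite /weight; have h := leq_divM (maxn p q - minn p q) n.
have : (3 * ((maxn p q - minn p q) %/ n) <= maxn p q - minn p q)%N.
  by apply: leq_trans h; rewrite mulnC leq_mul2l n_ge3 orbT.
clear h; move: (_ %/ n)%N => j; case/orP: g_cases => /eqP ->; lia.
Qed.

Lemma wt_fham p q m : same_residue p q -> (2 <= p + q)%N -> (3 <= p + q + m)%N -> (e <= weight p q m)%N.
Proof.
case/resP => r [j c] h2 h3; suff H : (e <= g * r + e * j + 2 * m)%N.
  by case: c => -[-> ->]; rewrite ?[weight r _ _]wtC wtE.
case: j c => [|j] c; last by rewrite mulnS; lia.
have [r2 m2] : (2 <= r + r)%N /\ (3 <= r + r + m)%N by case: c h2 h3 => -[-> ->]; lia.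
by have [/eqP ->|/eqP ->] := orP g_cases; nia.
Qed.

Lemma wt_lead p q m : same_residue p q -> (2 <= p + q)%N -> weight p q m = e ->
  m = 0%N /\ [\/ p = n /\ q = 0%N, p = 0%N /\ q = n | [/\ g = 1%N, p = 2%N & q = 2%N]].
Proof.
case/resP => r [j c] h2 h; have {}h : (g * r + e * j + 2 * m = e)%N.
  by case: c h => -[-> ->]; rewrite ?[weight r _ _]wtC wtE.
have [j1|j1] := posnP j.
  subst j; rewrite mul0n addn0 in c; have r1 : (1 <= r)%N by case: c h2 => -[-> ->]; lia.
  have [g1|g1] := orP g_cases; move/eqP: g1 => g1; rewrite g1 in h; last by lia.
  have [-> r2] : m = 0%N /\ r = 2%N by lia.
  by split=> //; apply: Or33; case: c => -[-> ->].
have [/eqP g1|/eqP g1] := orP g_cases; rewrite g1 in h;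
  have [m0 [r0 j0]] : m = 0%N /\ r = 0%N /\ j = 1%N by (lia || nia).
  subst; split=> //; rewrite mul1n add0n in c.
  by case: c => -[-> ->]; [apply: Or31|apply: Or32].
subst; split=> //; rewrite mul1n add0n in c.
by case: c => -[-> ->]; [apply: Or31|apply: Or32].
Qed.
End Weights.

Section Filtration.
Variable R : rcfType.
Variables (n g : nat).
Hypothesis hng : ((g == 1%N) && (4 <= n)%N) || ((g == 2%N) && (n == 3%N)).
Local Notation e := g.+1.
Local Notation C := R[i].
Local Notation iota := (@zcoords R).
Local Notation wt := (weight n g).
Local Notation res := (same_residue n).

Definition cfilt v (h : ser C) :=
  forall p q m, h p q m != 0 -> res p q /\ (v <= wt p q m)%N.

(* H is invariant under the rotations of order n and has weight at least v. *)
Definition Filt v (H : ser R) := cfilt v (iota H).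

Lemma filcP v h : (forall p q m, (~~ res p q) || (wt p q m < v)%N -> h p q m = 0) -> cfilt v h.
Proof.
move=> H p q m nz; apply/andP; apply: contraT => nb.
by case/eqP: nz; apply: H; rewrite ltnNge -negb_and.
Qed.
Lemma filc_0 v h p q m : cfilt v h -> (~~ res p q) || (wt p q m < v)%N -> h p q m = 0.
Proof.
move=> H; have [-> //|/H [-> le]] := eqVneq (h p q m) 0.
by rewrite ltnNge le.
Qed.

Lemma filcD v f h : cfilt v f -> cfilt v h -> cfilt v (f + h).
Proof.
by move=> F G; apply: filcP => p q m c; rewrite serD (filc_0 F c) (filc_0 G c) addr0.
Qed.
Lemma filcN v f : cfilt v f -> cfilt v (- f).
Proof. by move=> F; apply: filcP => p q m c; rewrite serN (filc_0 F c) oppr0. Qed.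
Lemma filcC v c f : cfilt v f -> cfilt v (sC c * f).
Proof. by move=> F; apply: filcP => p q m k; rewrite sCM (filc_0 F k) mulr0. Qed.
Lemma filcW u v f : (u <= v)%N -> cfilt v f -> cfilt u f.
Proof. by move=> uv F p q m /F [-> le]; split=> //; apply: leq_trans le. Qed.
Lemma filc0 v : cfilt v 0.
Proof. by move=> p q m; rewrite ser0 eqxx. Qed.
Lemma filc_pb u v w f h : cfilt u f -> cfilt v h -> (w + g <= u + v)%N -> cfilt w (pb f h).
Proof.
move=> F G uv P Q m /pb_neq0 [p1 [q1 [m1 [p2 [q2 [m2 [eP eQ <- /F [r1 w1] /G [r2 w2]]]]]]]].
have [] := wt_add hng (d := 1) m1 m2 r1 r2 (P := P) (Q := Q).
- by rewrite addn1.
- by rewrite addn1.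
by move=> -> hw; split=> //; rewrite muln1 in hw; lia.
Qed.
Lemma filcM u v f h : cfilt u f -> cfilt v h -> cfilt (u + v) (f * h).
Proof.
move=> F G P Q m /serM_neq0 [p1 [q1 [m1 [p2 [q2 [m2 [-> -> -> /F [r1 w1] /G [r2 w2]]]]]]]].
have [] := wt_add hng (d := 0) m1 m2 r1 r2 (P := (p1 + p2)%N) (Q := (q1 + q2)%N).
- by rewrite addn0.
- by rewrite addn0.
by move=> -> hw; split=> //; rewrite muln0 addn0 in hw; lia.
Qed.

Lemma FilD v f h : Filt v f -> Filt v h -> Filt v (f + h).
Proof. by rewrite /Filt (ghD (iota_gh R)); apply: filcD. Qed.
Lemma FilN v f : Filt v f -> Filt v (- f).
Proof. by rewrite /Filt (ghN (iota_gh R)); apply: filcN. Qed.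
Lemma FilB v f h : Filt v f -> Filt v h -> Filt v (f - h).
Proof. by move=> F G; apply: FilD => //; apply: FilN. Qed.
Lemma FilC v c f : Filt v f -> Filt v (sC c * f).
Proof. by rewrite /Filt (ghM (iota_gh R)) iota_C; apply: filcC. Qed.
Lemma FilW u v f : (u <= v)%N -> Filt v f -> Filt u f.
Proof. exact: filcW. Qed.
Lemma Fil0 v : Filt v 0.
Proof. by rewrite /Filt (gh0 (iota_gh R)); apply: filc0. Qed.
Lemma Fil_sum v (I : Type) (r : seq I) (P : pred I) (F : I -> ser R) :
  (forall l, P l -> Filt v (F l)) -> Filt v (\sum_(l <- r | P l) F l).
Proof.
by move=> H; apply: big_ind => //; [exact: Fil0 | move=> f h; apply: FilD].
Qed.
Lemma FilM u v f h : Filt u f -> Filt v h -> Filt (u + v) (f * h).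
Proof. by rewrite /Filt (ghM (iota_gh R)); apply: filcM. Qed.
Lemma Fil1 : Filt 0 1.
Proof.
rewrite /Filt (gh1 (iota_gh R)) => p q m; rewrite ser1E; have [->|] := eqVneq p 0%N.
  have [->|_] := eqVneq q 0%N; last by rewrite /= eqxx.
  by move=> _; split=> //; rewrite /same_residue eqxx.
by rewrite /= eqxx.
Qed.
Lemma FilX u f k : Filt u f -> Filt (k * u) (f ^+ k).
Proof.
move=> F; elim: k => [|k IH]; first exact: Fil1.
by rewrite exprS mulSn; apply: FilM.
Qed.
Lemma Fil_E k : Filt (2 * k) (sE ^+ k).
Proof.
rewrite mulnC; apply: FilX; rewrite /Filt iota_E => p q m; rewrite sEE.
case: p => [|p]; rewrite /= ?eqxx //; case: q => [|q]; rewrite /= ?eqxx //.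
have [-> _|_] := eqVneq m 1%N; last by rewrite eqxx.
by split; [rewrite /same_residue eqxx | rewrite /weight leq_addl].
Qed.

Lemma iota_tsum_coef (F : nat -> ser R) p q m : iota (tsum F) p q m =
  \sum_(l < (p + q + m).+1) iota (F l) p q m.
Proof.
have -> : \sum_(l < (p + q + m).+1) iota (F l) p q m =
    iota (\sum_(l < (p + q + m).+1) F l) p q m by rewrite (gh_sum (iota_gh R)) ser_sum.
apply/eqP; rewrite -subr_eq0 -serB -(ghB (iota_gh R)).
apply: contraT => /(gsub_linear_neq0 (rhom_cR R) (@linear_iX R) (@linear_iY R)).
move=> [i [j [ij]]]; rewrite serB /tsum ser_sum.
by rewrite (_ : (i + j + m).+1 = (p + q + m).+1) ?ij // subrr eqxx.
Qed.

Lemma Fil_tsum v F : (forall l, Filt v (F l)) -> Filt v (tsum F).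
Proof.
move=> H; apply: filcP => p q m c; rewrite iota_tsum_coef big1 // => l _.
exact: filc_0 (H l) c.
Qed.

Lemma Fil_lie u v w H f : Filt u H -> Filt v f -> (w + g <= u + v)%N -> Filt w (ham_lie H f).
Proof.
move=> FH Ff uv; rewrite /Filt iota_lie; apply: filcC.
by apply: filc_pb uv.
Qed.

Lemma iota_fham H p q m : fham H -> iota H p q m != 0 -> (2 <= p + q)%N /\ (3 <= p + q + m)%N.
Proof.
move=> [xH oH] /(gsub_linear_neq0 (rhom_cR R) (@linear_iX R) (@linear_iY R)) [i [j [<-]]] nz.
by split; [apply: xyge_neq0 xH nz | apply: ordge_neq0 oH nz].
Qed.

Lemma fham_iota H : (forall p q m, iota H p q m != 0 -> (2 <= p + q)%N /\ (3 <= p + q + m)%N) ->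
  fham H.
Proof.
move=> h.
have key i j k : H i j k != 0 -> exists p q, (p + q = i + j)%N /\ iota H p q k != 0.
  move=> nz; have : kappa (iota H) i j k != 0.
    rewrite kappa_iota /map_ser; apply: contraNneq nz => /(congr1 (@complex.Re R)) /= ->.
    by [].
  by move=> /(gsub_linear_neq0 (@rhom_id C) (@linear_kX R) (@linear_kY R)).
split; [apply: xygeP|apply: ordgeP] => i j k /key [p [q [<- /h []]]] //.
Qed.

Lemma fham_Fil H : fham H -> Filt 0 H -> Filt e H.
Proof.
move=> fH F p q m nz; have [r _] := F _ _ _ nz; split=> //.
by have [? ?] := iota_fham fH nz; apply: wt_fham.
Qed.

(** The weight is at most twice the degree, so large weight forces large order; constructions weight
    by weight therefore converge as formal series. *)
Lemma Fil_ord v N H : Filt v H -> (2 * N <= v.+1)%N -> ordge N H.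
Proof.
move=> F h; apply/ordgeP => i j k nz.
have : kappa (iota H) i j k != 0.
  by rewrite kappa_iota /map_ser; apply: contraNneq nz => /(congr1 (@complex.Re R)) /= ->.
move=> /(gsub_linear_neq0 (@rhom_id C) (@linear_kX R) (@linear_kY R)) [p [q [<- nz']]].
by have [_] := F _ _ _ nz'; have := wt_le hng p q k; lia.
Qed.

Lemma Fil_eq f h : (forall v, Filt v (f - h)) -> f = h.
Proof.
move=> H; apply: ordge_eq => N; apply: (@Fil_ord (2 * N)) => //.
Qed.

(** A bracket with H or H' gains weight 1, and one with their difference gains r; the abstract
    perturbation estimate applies. *)
Lemma Exp_perturb_Fil H H' r v f : fham H -> fham H' -> Filt e H -> Filt e H' ->
  Filt (g + r) (H' - H) -> Filt v f ->
  Filt (v + r.+1) (Exp H' f - Exp H f - ham_lie (H' - H) f).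
Proof.
move=> [_ oH] [_ oH'] FH FH' Fd; apply: (@Exp_perturb R Filt) => //.
- by move=> u f1 f2; apply: FilD.
- by move=> u c f1; apply: FilC.
- by move=> u F; apply: Fil_tsum.
- by move=> u w f1; apply: FilW.
- by move=> w; apply: Fil0.
- by move=> w f1 Ff; apply: (Fil_lie FH Ff); lia.
- by move=> w f1 Ff; apply: (Fil_lie FH' Ff); lia.
- by move=> w f1 Ff; apply: (Fil_lie Fd Ff); lia.
Qed.

Lemma Exp_cong_Fil H H' r v f : fham H -> fham H' -> Filt e H -> Filt e H' ->
  Filt (g + r) (H' - H) -> Filt v f -> Filt (v + r) (Exp H' f - Exp H f).
Proof.
move=> fH fH' FH FH' Fd Ff; have E := Exp_perturb_Fil fH fH' FH FH' Fd Ff.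
have L : Filt (v + r) (ham_lie (H' - H) f) by apply: (Fil_lie Fd Ff); lia.
rewrite -[Exp H' f - _](subrK (ham_lie (H' - H) f)); apply: FilD => //.
by apply: FilW E; rewrite leq_add2l.
Qed.

Lemma fham0 : fham (0 : ser R).
Proof. by split=> i j k _; rewrite ser0. Qed.

Lemma Exp_Fil H v f : fham H -> Filt e H -> Filt v f -> Filt v.+1 (Exp H f - f).
Proof.
move=> fH FH Ff; rewrite -{2}(Exp0 f) -addn1.
apply: Exp_cong_Fil => //; [exact: fham0|exact: Fil0|by rewrite subr0 addn1].
Qed.
End Filtration.

(** * The bracket with the leading part *)

Section Homological.
Variable R : rcfType.
Variables (n g : nat).
Hypothesis hng : ((g == 1%N) && (4 <= n)%N) || ((g == 2%N) && (n == 3%N)).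
Local Notation e := g.+1.
Local Notation C := R[i].
Local Notation cR := (real_complex R).
Local Notation iota := (@zcoords R).
Local Notation wt := (weight n g).
Local Notation Fil := (Filt n g).
Local Notation filc := (cfilt n g).

Lemma cRM (x y : R) : cR (x * y) = cR x * cR y.
Proof. exact: (rmorphM (real_complex R)). Qed.
Lemma cRB (x y : R) : cR (x - y) = cR x - cR y.
Proof. exact: (rmorphB (real_complex R)). Qed.
Lemma cR_nat m : cR (m%:R : R) = m%:R.
Proof. exact: (rmorph_nat (real_complex R)). Qed.

Record leading (H : ser R) (a b : R) : Prop := Lead {
  ld_fham : fham H;
  ld_Fil : Fil e H;
  ld_a : g = 1%N -> iota H 2%N 2%N 0%N = cR a /\ a != 0;
  ld_b : iota H n 0%N 0%N = cR b;
  ld_b0 : b != 0 }.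

Definition lead_part (a b : R) : ser C :=
  (if g == 1%N then sC (cR a) * mon 2%N 2%N 0%N else 0) +
  (sC (cR b) * mon n 0%N 0%N + sC (cR b) * mon 0%N n 0%N).

Lemma lead_partE a b p q m : lead_part a b p q m =
  (if (g == 1%N) && ((p == 2%N) && (q == 2%N) && (m == 0%N)) then cR a else 0) +
  ((if (p == n) && (q == 0%N) && (m == 0%N) then cR b else 0) +
   (if (p == 0%N) && (q == n) && (m == 0%N) then cR b else 0)).
Proof.
rewrite /lead_part !serD !sCM !monE; congr (_ + (_ + _)).
- by case: (g == 1%N); rewrite ?ser0 // sCM monE /=; case: (_ && _);
    rewrite ?mulr1 ?mulr0.
- by case: (_ && _); rewrite /= ?mulr1 ?mulr0.
- by case: (_ && _); rewrite /= ?mulr1 ?mulr0.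
Qed.

Lemma lead_diff H a b : leading H a b -> filc e.+1 (iota H - lead_part a b).
Proof.
move=> [fH FH Ha Hb b0]; have n3 := n_ge3 hng.
have n0 : (n == 0%N) = false by case: (n) n3.
have n0' : (0%N == n) = false by rewrite eq_sym.
have n2 : (n == 2%N) = false by case: (n) n3 => [|[|[|]]].
have n2' : (2%N == n) = false by rewrite eq_sym.
have Hb' : iota H 0%N n 0%N = cR b by rewrite iota_conj Hb conjc_real.
apply: filcP => p q m c; rewrite serB; apply/eqP; rewrite subr_eq0 lead_partE; apply/eqP.
have [/andP[/eqP g1 /andP[/andP[/eqP -> /eqP ->] /eqP ->]]|nA] :=
    boolP ((g == 1%N) && ((p == 2%N) && (q == 2%N) && (m == 0%N))).
  by rewrite n2' /= !addr0; case: (Ha g1).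
have [/andP[/andP[/eqP -> /eqP ->] /eqP ->]|nB] :=
    boolP ((p == n) && (q == 0%N) && (m == 0%N)).
  by rewrite n0 /= add0r addr0.
have [/andP[/andP[/eqP -> /eqP ->] /eqP ->]|nB'] :=
    boolP ((p == 0%N) && (q == n) && (m == 0%N)).
  by rewrite /= !add0r.
rewrite !addr0; apply/eqP; apply: contraT => nz.
have [r le] := FH _ _ _ nz; rewrite r /= ltnS in c.
have w : wt p q m = e by apply/eqP; rewrite eqn_leq c le.
have [h2 _] := iota_fham fH nz.
have [m0 [[p0 q0]|[p0 q0]|[g1 p0 q0]]] := wt_lead hng r h2 w.
- by rewrite p0 q0 m0 !eqxx in nB.
- by rewrite p0 q0 m0 !eqxx in nB'.
- by rewrite p0 q0 m0 g1 in nA.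
Qed.

Lemma pb_lead H a b v h P Q m : leading H a b -> filc v h -> (wt P Q m <= v.+1)%N ->
  pb (iota H) h P Q m = pb (lead_part a b) h P Q m.
Proof.
move=> L F w; rewrite -{1}(subrK (lead_part a b) (iota H)) pbDl serD.
rewrite (_ : pb (iota H - _) h P Q m = 0) ?add0r //.
have D : filc v.+2 (pb (iota H - lead_part a b) h).
  by apply: (filc_pb hng (lead_diff L) F); lia.
by apply: (filc_0 D); rewrite ltnS w orbT.
Qed.

Lemma pb_lead_part a b h P Q m : pb (lead_part a b) h P Q m =
  (if (g == 1%N) then cR a * pb (mon 2%N 2%N 0%N) h P Q m else 0) +
  cR b * ((if (n.-1 <= P)%N then h (P - n.-1)%N Q.+1 m *+ (Q.+1 * n) else 0) -
          (if (n.-1 <= Q)%N then h P.+1 (Q - n.-1)%N m *+ (P.+1 * n) else 0)).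
Proof.
rewrite /lead_part !pbDl !pb_CMl !serD !sCM (pb_mon n 0) (pb_mon 0 n).
have -> : pb (if g == 1%N then sC (cR a) * mon 2%N 2%N 0%N else 0) h P Q m =
   if g == 1%N then cR a * pb (mon 2%N 2%N 0%N) h P Q m else 0.
  case: (g == 1%N); first by rewrite pb_CMl sCM.
  by rewrite -[0 in LHS](sC0 C) pb_Cl ser0.
congr (_ + _); rewrite !leq0n !subn0 !andbT /= !muln0 !mulr0n !if_same.
by rewrite subr0 sub0r mulrN mulrBr.
Qed.

(* Coefficient of frequency j among the terms of weight s + 2m. *)
Definition freq_coef (h : ser C) s m j : C :=
  if (e * j <= s)%N && (g %| s - e * j)%N
  then h ((s - e * j) %/ g + j * n)%N ((s - e * j) %/ g)%N m else 0.

Lemma cfE h s m j r : (g * r + e * j = s)%N -> freq_coef h s m j = h (r + j * n)%N r m.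
Proof.
have g1 : (0 < g)%N by case/orP: (g_cases hng) => /eqP ->.
by move=> <-; rewrite /freq_coef leq_addl addnK dvdn_mulr // mulKn.
Qed.
Lemma cf_big h s m j : (s < e * j)%N || ~~ (g %| s - e * j)%N -> freq_coef h s m j = 0.
Proof.
by move=> /orP[lt|/negPf nd]; rewrite /freq_coef ?nd ?andbF // leqNgt lt.
Qed.

Definition th (a b : R) : R := if g == 1%N then 2 * a / b else 0.
(** The coupling of the frequencies k and k + 2 through zb^n has leading weight only when g n = 2 e,
    that is for n = 3 and n = 4. *)
Definition resonant : R := (g * n == 2 * e)%N%:R.

(** To frequency k + 1 the factor z^n contributes from k, (z zb)^2 from k + 1 and zb^n from k + 2.
    Multiplication by g turns the exponent Q.+1 into (s - e k), without a division. *)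
Lemma lead_eq H a b h s m k Q : leading H a b -> filc (s + 2 * m) h ->
  (g * Q + e * k.+1 = s.+1)%N ->
  pb (iota H) h (Q + k.+1 * n)%N Q m *+ g =
  cR (b * n%:R) * (cR (s%:R - (e * k)%:R) * freq_coef h s m k - cR (th a b * k.+1%:R) * freq_coef h s m k.+1
    - cR (resonant * (s + e * k.+2)%:R) * freq_coef h s m k.+2).
Proof.
move=> L F eQ; have n3 := n_ge3 hng; have b0 := ld_b0 L.
rewrite (pb_lead L F); last by rewrite (wtE hng); lia.
have n1 : (n.-1.+1 = n)%N by case: (n) n3.
rewrite pb_lead_part.
have -> : (n.-1 <= Q + k.+1 * n)%N by rewrite mulSn; lia.
have -> : (Q + k.+1 * n - n.-1 = Q.+1 + k * n)%N by rewrite mulSn; lia.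
rewrite -(@cfE h s m k Q.+1); last by rewrite mulnS in eQ; rewrite mulnS; lia.
have cRn x (z : C) : z *+ x = cR x%:R * z by rewrite -[LHS]mulr_natl rmorph_nat.
have gg : (0 < g)%N by case/orP: (g_cases hng) => /eqP ->.
have E2 : (if (n.-1 <= Q)%N then h (Q + k.+1 * n).+1 (Q - n.-1)%N m *+ ((Q + k.+1 * n).+1 * n) else 0) *+ g
   = cR (n%:R * (resonant * (s + e * k.+2)%:R)) * freq_coef h s m k.+2.
  rewrite /resonant; have gn := gn_ge hng.
  have [le|lt] := leqP n.-1 Q; last first.
    have [gn2|gn2] := eqVneq (g * n)%N (2 * e)%N; last by rewrite mul0rn mul0r mulr0 mul0r.
    rewrite cf_big ?mul0rn ?mulr0 //; apply/orP; left.
    have : (g * Q.+1 < g * n)%N by rewrite ltn_pmul2l //; lia.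
    by rewrite gn2; move: eQ; rewrite !mulnS; move: (e * k)%N (g * Q)%N => A B; lia.
  have eP : ((Q + k.+1 * n).+1 = Q - n.-1 + k.+2 * n)%N by rewrite !mulSn; lia.
  have eg : (g * (Q - n.-1) + g * n = g * Q + g)%N.
    by rewrite -mulnDr (_ : (Q - n.-1 + n)%N = Q.+1) ?mulnS 1?addnC //; lia.
  have [gn2|gn2] := eqVneq (g * n)%N (2 * e)%N.
    rewrite (@cfE h s m k.+2 (Q - n.-1)); last first.
      move: eQ eg; rewrite gn2 !mulnS; move: (e * k)%N (g * Q)%N (g * (Q - n.-1))%N.
      by clear; move=> A B D; lia.
    rewrite -eP -mulrnA cRn mul1r -natrM; congr (cR _%:R * _).
    have e1 : (g * (k.+1 * n) = 2 * (e * k) + 2 * e)%N.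
      by rewrite mulnCA gn2 mulnCA mulnS; lia.
    have eA : (g * (Q + k.+1 * n).+1 = s + e * k.+2)%N.
      rewrite mulnS mulnDr e1; move: eQ; rewrite !mulnS.
      by move: (e * k)%N (g * Q)%N; clear; lia.
    by rewrite -eA; ring.
  (* The coefficient on which zb^n acts now has weight below s + 2 m, hence is zero. *)
  have gt : (2 * e < g * n)%N by rewrite ltn_neqAle eq_sym gn2.
  rewrite !mul0r mulr0 mul0r (filc_0 F) ?mul0rn //; apply/orP; right.
  rewrite eP (wtE hng); move: eQ eg gt; rewrite !mulnS.
  move: (e * k)%N (g * Q)%N (g * (Q - n.-1))%N (g * n)%N; clear; move=> A B D E; lia.
have E1 : (if g == 1%N then cR a * pb (mon 2%N 2%N 0%N) h (Q + k.+1 * n)%N Q m else 0) *+ g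
   = - (cR (b * n%:R * (th a b * k.+1%:R)) * freq_coef h s m k.+1).
  rewrite /th; case: eqP => g1; last by rewrite mul0rn mul0r mulr0 mul0r oppr0.
  rewrite g1 mulr1n pb_mon /=.
  have -> : (0 < Q + k.+1 * n)%N by rewrite mulSn; lia.
  have -> : (1 < Q + k.+1 * n)%N by rewrite mulSn; lia.
  case: (posnP Q) => Q0.
    rewrite Q0 /= subr0 mulr0 cf_big ?mulr0 ?oppr0 //; apply/orP; left.
    by move: eQ; rewrite Q0 g1 muln0 add0n => ->.
  rewrite /= (@cfE h s m k.+1 Q.-1); last by move: eQ; rewrite g1; lia.
  have -> : (Q + k.+1 * n - 1 = Q.-1 + k.+1 * n)%N by lia.
  have -> : ((Q + k.+1 * n - 2).+1 = Q.-1 + k.+1 * n)%N by rewrite mulSn; lia.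
  have -> : (Q - 1 = Q.-1)%N by lia.
  have -> : (if (1 < Q)%N then h (Q.-1 + k.+1 * n)%N (Q - 2).+1 m *+ ((Q - 2).+1 * 2) else 0) =
    h (Q.-1 + k.+1 * n)%N Q.-1 m *+ (Q.-1 * 2).
    case: ltnP => q1; first by have -> : ((Q - 2).+1 = Q.-1)%N by lia.
    by have -> : (Q.-1 = 0)%N by lia.
  rewrite mulnDl mulrnDr opprD addrA subrr sub0r mulrN cRn [in LHS]mulrA -(rmorphM (real_complex R)) /=.
  congr (- (cR _ * _)).
  have -> : b * n%:R * (2 * a / b * k.+1%:R) = 2 * a * (k.+1%:R * n%:R) by field.
  by rewrite !natrM; ring.
rewrite mulrnDl E1 -[(_ * (_ - _)) *+ g]mulrnAr mulrnBl E2 -mulrnA cRn.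
have -> : (Q.+1 * n * g = n * (s - e * k))%N.
  have -> : (s - e * k = g * Q.+1)%N by move: eQ; rewrite !mulnS; lia.
  by ring.
rewrite natrM natrB; last by move: eQ; rewrite !mulnS; lia.
by rewrite !cRM !cRB; ring.
Qed.

(** On the diagonal z^n and zb^n act on conjugate coefficients, so only an imaginary part survives;
    the bracket with (z zb)^2 has no diagonal part. *)
Lemma lead_eq0 H a b h s m Q : leading H a b -> filc (s + 2 * m) h ->
  csym h -> (g * Q = s.+1)%N ->
  pb (iota H) h Q Q m = - cR (2 * resonant * b * (n * Q.+1)%:R) * ic R * cR (complex.Im (freq_coef h s m 1)).
Proof.
move=> L F sh eQ; have n3 := n_ge3 hng.
have cRn x (z : C) : z *+ x = cR x%:R * z by rewrite -[LHS]mulr_natl rmorph_nat.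
rewrite (pb_lead L F); last first.
  by have := wtE hng Q 0 m; rewrite mul0n addn0 muln0 => ->; lia.
have Z : pb (mon 2%N 2%N 0%N) h Q Q m = 0.
  rewrite pb_mon /= [X in _ - (if X then _ else _)]andbC.
  case: ifP => [/andP[_ q2]|_]; last by rewrite subrr.
  by have -> : ((Q - 2).+1 = Q - 1)%N; [lia | rewrite subrr].
rewrite pb_lead_part Z mulr0 if_same add0r /resonant.
have gg : (0 < g)%N by case/orP: (g_cases hng) => /eqP ->.
have gn := gn_ge hng.
have [le|lt] := leqP n.-1 Q; last first.
  rewrite subr0 mulr0; have [gn2|gn2] := eqVneq (g * n)%N (2 * e)%N; last first.
    by rewrite !(mulr0, mul0r) oppr0 !mul0r.
  rewrite cf_big ?mulr0 //; apply/orP; left; rewrite muln1.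
  have : (g * Q.+1 < g * n)%N by rewrite ltn_pmul2l //; lia.
  by rewrite gn2 mulnS; lia.
have eP : (Q.+1 = Q - n.-1 + 1 * n)%N by lia.
have eg : (g * (Q - n.-1) + g * n = g * Q + g)%N.
  by rewrite -mulnDr (_ : (Q - n.-1 + n)%N = Q.+1) ?mulnS 1?addnC //; lia.
rewrite -mulrnBl (sh Q.+1).
have [gn2|gn2] := eqVneq (g * n)%N (2 * e)%N; last first.
  have gt : (2 * e < g * n)%N by rewrite ltn_neqAle eq_sym gn2.
  rewrite (filc_0 F) ?conjc0 ?subrr ?mul0rn ?mulr0 ?mul0r ?oppr0 ?mul0r //; apply/orP; right.
  by rewrite eP (wtE hng); lia.
rewrite (@cfE h s m 1 (Q - n.-1)); last by lia.
rewrite -eP cRn mulr1.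
have E z : conjc z - z = - ((ic R + ic R) * cR (complex.Im z)) :> C.
  case: z => x y; apply/eqP; rewrite eq_complex /=.
  by apply/andP; split; apply/eqP; ring.
by rewrite E mulnC /= !cRM !cR_nat; ring.
Qed.
End Homological.

(** * Solution of the homological equation in a given weight *)

Section Step.
Variable R : rcfType.
Variables (n g : nat).
Hypothesis hng : ((g == 1%N) && (4 <= n)%N) || ((g == 2%N) && (n == 3%N)).
Local Notation e := g.+1.
Local Notation C := R[i].
Local Notation cR := (real_complex R).
Local Notation iota := (@zcoords R).
Local Notation wt := (weight n g).
Local Notation res := (same_residue n).
Local Notation Fil := (Filt n g).
Local Notation filc := (cfilt n g).
Local Notation lead := (leading n g).
Local Notation cf := (freq_coef n g).
Local Notation ka := (resonant R n g).
Local Notation Re := (@complex.Re R).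
Local Notation Im := (@complex.Im R).

(* Exponents p of (z zb)^p and q of (z zb)^q (z^n + zb^n) that occur in the
   normal form. *)
Definition okA p : bool := (g == 1%N) || ~~ (e %| (g * p).-1)%N.
Definition okB q : bool := ~~ (e %| g * q.+1)%N.

Definition normal_form (h : ser C) := (forall p q m, h p q m = h q p m) /\
  forall p q m, h p q m != 0 -> [\/ [/\ p = q, (0 < p)%N & okA p],
     p = (q + n)%N /\ okB q | q = (p + n)%N /\ okB p].

Lemma complexE (z : C) : z = cR (Re z) + ic R * cR (Im z).
Proof.
case: z => x y; apply/eqP; rewrite eq_complex /=.
by apply/andP; split; apply/eqP; ring.
Qed.

Lemma ReB (z w : C) : Re (z - w) = Re z - Re w. Proof. by case: z w => ? ? [? ?]. Qed.

Lemma conj_fix (z : C) : conjc z = z -> z = cR (Re z).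
Proof.
case: z => x y [] /eqP; rewrite eq_sym -addr_eq0 -mulr2n mulrn_eq0 /= => /eqP ->.
by [].
Qed.

Section Params.
Variables (H : ser R) (a b : R).
Hypothesis L : lead H a b.
Variable s : nat.

(** The constants [mu] and [la] are those that appear when the bracket is multiplied by 2 i, in the
    diagonal equation and in the recurrence. *)
Definition mu : R := 4 * ka * b * (n * (s.+1 %/ g).+1)%:R.
Definition la : R := 2 * b * n%:R / g%:R.

Lemma g_gt0 : (0 < g)%N. Proof. by case/orP: (g_cases hng) => /eqP ->. Qed.
Lemma ka_ge0 : 0 <= ka. Proof. by rewrite /resonant ler0n. Qed.
Lemma n_neq0 : n%:R != 0 :> R.
Proof. by rewrite pnatr_eq0; case: (n) (n_ge3 hng). Qed.
Lemma g_neq0 : g%:R != 0 :> R. Proof. by rewrite pnatr_eq0 -lt0n g_gt0. Qed.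
Lemma la_neq0 : la != 0.
Proof.
by rewrite /la !mulf_neq0 ?invr_eq0 ?g_neq0 ?n_neq0 ?(ld_b0 L) ?pnatr_eq0.
Qed.
Lemma th_neq0 : g = 1%N -> th g a b != 0.
Proof.
move=> g1; have [_ a0] := ld_a L g1; rewrite /th g1 eqxx.
by rewrite !mulf_neq0 ?invr_eq0 ?(ld_b0 L) // pnatr_eq0.
Qed.
Lemma params2 : g = 2%N -> [/\ th g a b = 0, 0 < ka & (1 < s)%N -> mu != 0].
Proof.
move=> g2; have ka1 : ka = 1.
  by move: hng; rewrite /resonant g2 /= => /eqP ->.
split; [by rewrite /th g2 | by rewrite ka1 ltr01 | move=> _].
rewrite /mu ka1 mulr1 natrM !mulf_neq0 ?n_neq0 ?(ld_b0 L) ?pnatr_eq0 //.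
Qed.

(** This concerns n = 3, where all frequencies in weight s have the parity of s: an equation of the
    wrong parity is void. *)
Lemma cf_parity (h : ser C) m k : (e * k.+1 <= s.+1)%N -> ~~ (g %| s.+1 - e * k.+1)%N ->
  [/\ cf h s m k = 0, cf h s m k.+2 = 0 & th g a b = 0].
Proof.
move=> le nd; have g2 : g = 2%N.
  by case/orP: (g_cases hng) => /eqP // g1; rewrite g1 dvd1n in nd.
have [t0 _ _] := params2 g2.
split=> //; apply: cf_big; rewrite g2 in nd le *.
  by apply/orP; right; apply: contra nd => /dvdnP [c h1]; apply/dvdnP; exists c.-1; lia.
have [lt|le2] := ltnP s (3 * k.+2)%N; first by [].
by apply/orP; right; apply: contra nd => /dvdnP [c h1]; apply/dvdnP; exists c.+2; lia.
Qed.

(** The recurrence has real coefficients, so real and imaginary parts decouple; the factor i of the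
    bracket exchanges their roles. *)
Lemma lead_eqRI (h : ser C) m k Q : filc (s + 2 * m) h -> (g * Q + e * k.+1 = s.+1)%N ->
  (2 * ic R) * pb (iota H) h (Q + k.+1 * n)%N Q m =
  cR la * (ic R * cR (hop s e (th g a b) ka (fun j => Re (cf h s m j)) k)
     - cR (hop s e (th g a b) ka (fun j => Im (cf h s m j)) k)).
Proof.
move=> F eQ; have := lead_eq hng L F eQ.
set X := pb _ _ _ _ _; set c0 := cf h s m k; set c1 := cf h s m k.+1.
set c2' := cf h s m k.+2 => E.
have gC : g%:R != 0 :> C by rewrite pnatr_eq0 -lt0n g_gt0.
have -> : X = cR (b * n%:R) / g%:R * (cR (s%:R - (e * k)%:R) * c0 -
    cR (th g a b * k.+1%:R) * c1 - cR (ka * (s + e * k.+2)%:R) * c2').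
  by apply: (mulIf gC); rewrite [LHS]mulr_natr E; field.
have -> : cR la = 2 * (cR (b * n%:R) / g%:R).
  have eg : cR (g%:R^-1) = g%:R^-1.
    by apply: (mulIf gC); rewrite mulVf // -(cR_nat R g) -cRM mulVf ?g_neq0.
  by rewrite /la !cRM !cR_nat eg; ring.
have e0 := complexE c0; have e1 := complexE c1; have e2 := complexE c2'.
rewrite /hop -/c0 -/c1 -/c2' !cRB !cRM {1}e0 {1}e1 {1}e2.
have i2 := ic2 R.
set u := cR (b * n%:R) / g%:R.
apply/eqP; rewrite -subr_eq0; apply/eqP.
(* The two sides agree as polynomials only modulo i^2 + 1; the required multiple of it is subtracted
   before calling [ring]. *)
have key (x : C) : (ic R * ic R + 1) * x = 0 by rewrite i2 addNr mul0r.
pose y := Im c0 * (s%:R - (e * k)%:R) - th g a b * k.+1%:R * Im c1 - ka * (s + e * k.+2)%:R * Im c2'.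
rewrite -(key (2 * u * cR y)) /y /u !(cRB, cRM); ring.
Qed.

Lemma lead_eq0RI (h : ser C) m Q : filc (s + 2 * m) h -> csym h -> (g * Q = s.+1)%N ->
  (2 * ic R) * pb (iota H) h Q Q m = cR (mu * Im (cf h s m 1)).
Proof.
move=> F sh eQ; rewrite (lead_eq0 hng L F sh eQ) /mu -eQ mulKn ?g_gt0 //.
rewrite !cRM !cR_nat -[4]/(2 * 2)%:R natrM.
have i2 := ic2 R; have key (x : C) : (ic R * ic R + 1) * x = 0 by rewrite i2 addNr mul0r.
apply/eqP; rewrite -subr_eq0; apply/eqP.
rewrite -(key (- 2 * (2 * cR ka * cR b * (n * Q.+1)%:R) * cR (Im (cf h s m 1)))); ring.
Qed.
End Params.

Lemma csym_iota f : csym (iota f).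
Proof. by move=> p q m; apply: iota_conj. Qed.

Lemma filc_half v (h : ser C) : csym h ->
  (forall p q m, h p q m != 0 -> res p q) ->
  (forall r j m, (g * r + e * j + 2 * m < v)%N -> h (r + j * n)%N r m = 0) -> filc v h.
Proof.
move=> sh hr H p q m nz; have r := hr _ _ _ nz; split=> //.
rewrite leqNgt; apply/negP => lt; move/eqP: nz; apply.
have [x [j [[ep eq]|[ep eq]]]] := resP r; subst p q.
  by apply: H; rewrite wtE in lt.
by rewrite sh H ?conjc0 //; rewrite wtC wtE in lt.
Qed.

Lemma lie_fham (H H' : ser R) : fham H -> fham H' -> fham (ham_lie H H').
Proof.
move=> [x o] [x' o']; split; first exact: lie_xy.
by apply: ordgeW (lie_ord o o').
Qed.

(** The leading part is free of eps, so each power eps^m yields a separate recurrence, with s = w -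
    1 - 2 m; psi assembles the solutions and N the absorbed terms. *)
Lemma hom_step H a b w t : lead H a b -> (e < w)%N -> fham t -> Fil w t ->
  exists psi N, [/\ fham psi, Fil w.-1 psi, Fil w N, normal_form (iota N) &
    Fil w.+1 (t - N + ham_lie H psi)].
Proof.
move=> L ew ft Ft; have gg := g_gt0; have n3 := n_ge3 hng.
pose s m := (w.-1 - 2 * m)%N.
pose T := iota t.
pose tc m k : C := if (e * k <= (s m).+1)%N && (g %| (s m).+1 - e * k)%N then
  T (((s m).+1 - e * k) %/ g + k * n)%N (((s m).+1 - e * k) %/ g)%N m else 0.
have tcE m k Q : (g * Q + e * k = (s m).+1)%N -> tc m k = T (Q + k * n)%N Q m.
  by move=> h; rewrite /tc -h leq_addl addnK dvdn_mulr // mulKn.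
have sol m : exists y : (nat -> R) * (nat -> R) * R * R,
  [/\ forall k, (e * k.+1 <= (s m).+1)%N -> hop (s m) e (th g a b) ka y.1.1.1 k = - (Im (tc m k.+1) / la b),
      forall k, (e * k.+1 <= (s m).+1)%N -> hop (s m) e (th g a b) ka y.1.1.2 k =
         (Re (tc m k.+1) - (if k == 0%N then y.2 else 0)) / la b,
      ((g %| s m)%N -> y.1.1.2 0%N = 0) /\ (forall j, (s m < e * j)%N -> y.1.1.1 j = 0 /\ y.1.1.2 j = 0),
      ((g %| (s m).+1)%N -> Re (tc m 0) - y.1.2 + mu b (s m) * y.1.1.2 1%N = 0) &
      (y.2 != 0 -> ~~ (e %| s m)%N) /\ (y.1.2 != 0 -> g = 1%N \/ ~~ (e %| s m)%N)].
  have [yR [yI [N0 [N1 S]]]] := homological_solve erefl (g_cases hng) ka_ge0 (la_neq0 L)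
    (th_neq0 L) (@params2 _ _ _ L (s m)) (fun k => Re (tc m k.+1)) (fun k => Im (tc m k.+1)) (Re (tc m 0%N)).
  by exists (yR, yI, N0, N1).
have [y Hy] := choice sol.
pose J p q := ((maxn p q - minn p q) %/ n)%N.
(* Coefficients with p < q are the conjugates of those with p > q; on the diagonal this is
   consistent because [yI 0] vanishes. *)
pose ph : ser C := fun p q m => if res p q && (wt p q m == w.-1) && (2 <= p + q)%N then
  Complex ((y m).1.1.1 (J p q)) (if (q <= p)%N then (y m).1.1.2 (J p q) else - (y m).1.1.2 (J p q)) else 0.
have JC p q : J p q = J q p by rewrite /J minnC maxnC.
have JE r j : J (r + j * n)%N r = j.
  rewrite /J (minn_idPr (leq_addr _ _)) (maxn_idPl (leq_addr _ _)) addKn mulnK //.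
  by apply: leq_trans n3.
have sph : csym ph.
  move=> p q m; rewrite /ph [res q p]resC [wt q p m]wtC (addnC q p) [J q p]JC.
  case: ifP => [/andP[/andP[r /eqP wp] _]|_]; last by rewrite conjc0.
  have [lt|lt|epq] := ltngtP q p; rewrite ?leqNgt ?lt /=; rewrite ?opprK //.
  rewrite epq /=; have -> : (y m).1.1.2 (J p p) = 0; last by rewrite oppr0.
  rewrite /J maxnn minnn subnn div0n; have [_ _ [i0 _] _ _] := Hy m; apply: i0.
  move: wp; rewrite epq -{1}[p]addn0 -(mul0n n) (wtE hng) muln0 addn0 => wp.
  by rewrite /s -wp addnK dvdn_mulr.
have [psi Epsi] := iota_surj sph.
pose Nh : ser C := fun p q m => if (wt p q m == w) && (0 < p + q)%N then
   (if p == q then cR (y m).1.2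
    else if (p == q + n)%N || (q == p + n)%N then cR (y m).2 else 0) else 0.
have NhC p q m : Nh p q m = Nh q p m.
  rewrite /Nh [wt q p m]wtC (addnC q p) [q == p]eq_sym.
  by rewrite [(q == (p + n)%N) || _]orbC.
have sNh : csym Nh.
  move=> p q m; rewrite -NhC /Nh; case: ifP => _; last by rewrite conjc0.
  by do 2?[case: ifP => _]; rewrite ?conjc_real ?conjc0.
have [N EN] := iota_surj sNh.
have w0 : (0 < w)%N by lia.
have wE r j m : (g * r + e * j + 2 * m = w)%N -> (0 < r + j)%N -> (g * r + e * j = (s m).+1)%N.
  move=> h rj; rewrite /s; suff : (2 * m < w)%N by lia.
  by rewrite -h; nia.
have fpsi : fham psi.
  apply: fham_iota => p q m; rewrite Epsi /ph; case: ifP => [/andP[/andP[r /eqP wp] pq] _|]; last by rewrite eqxx.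
  split=> //; rewrite ltnNge; apply/negP => h.
  have [pq2 m0] : (p + q = 2)%N /\ m = 0%N by lia.
  subst m; have [x [j [[ep eq]|[ep eq]]]] := resP r; subst p q.
    have j0 : j = 0%N by case: (j) pq2 => // j'; rewrite mulSn; lia.
    move: wp; rewrite j0 (wtE hng) !muln0 !addn0; have -> : x = 1%N by lia.
    by lia.
  have j0 : j = 0%N by case: (j) pq2 => // j'; rewrite mulSn; lia.
  move: wp; rewrite j0 wtC (wtE hng) !muln0 !addn0; have -> : x = 1%N by lia.
  by lia.
have Fpsi : Fil w.-1 psi.
  move=> p q m; rewrite Epsi /ph; case: ifP => [/andP[/andP[r /eqP <-] _]|]; last by rewrite eqxx.
  by [].
have FN : Fil w N.
  move=> p q m; rewrite EN /Nh; case: ifP => [/andP[/eqP wp _]|]; last by rewrite eqxx.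
  rewrite wp leqnn; have [->|_] := eqVneq p q; first by rewrite /same_residue eqxx.
  case: ifP; last by rewrite eqxx.
  by move=> /orP[/eqP ->|/eqP ->] _; rewrite 1?[res p _]resC /same_residue modnDr.
exists psi, N; split=> //.
- rewrite EN; split; first exact: NhC.
  move=> p q m; rewrite /Nh; case: ifP => [/andP[/eqP wp p0]|]; last by rewrite eqxx.
  have [_ _ _ _ [h1 h0]] := Hy m.
  have cnz (x : R) : cR x != 0 -> x != 0 by apply: contraNneq => ->.
  have [epq|npq] := eqVneq p q.
    subst q => /cnz /h0 ok; apply: Or31; split=> //; first by lia.
    have wp' : (g * p + e * 0 + 2 * m = w)%N by rewrite -(wtE hng) mul0n addn0.
    have := wE _ _ _ wp' ltac:(lia); rewrite muln0 addn0 /okA => ->.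
    by case: ok => [->|->]; rewrite ?eqxx ?orbT.
  case: ifP => [/orP[/eqP ep|/eqP eq]|]; last by rewrite eqxx.
    move=> /cnz /h1 ok; apply: Or32; split=> //; rewrite /okB.
    have wp' : (g * q + e * 1 + 2 * m = w)%N by rewrite -(wtE hng) mul1n -ep.
    have := wE _ _ _ wp' ltac:(lia); rewrite muln1 mulnS => h.
    by have -> : (g + g * q = s m)%N by lia.
  move=> /cnz /h1 ok; apply: Or33; split=> //; rewrite /okB.
  have wp' : (g * p + e * 1 + 2 * m = w)%N by rewrite -(wtE hng) wtC mul1n -eq.
  have := wE _ _ _ wp' ltac:(lia); rewrite muln1 mulnS => h.
  by have -> : (g + g * p = s m)%N by lia.
have ED : iota (t - N + ham_lie H psi) = T - Nh + sC (2 * ic R) * pb (iota H) ph.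
  by rewrite (ghD (iota_gh R)) (ghB (iota_gh R)) iota_lie EN Epsi.
have FD : Fil w (t - N + ham_lie H psi).
  apply: FilD; first exact: FilB.
  by apply: (Fil_lie hng (ld_Fil L) Fpsi); lia.
apply: filc_half; first exact: csym_iota.
  by move=> p q m /FD [].
move=> r j m; rewrite ltnS leq_eqVlt => /orP[/eqP wj|lt]; last first.
  by apply: filc_0 FD _; rewrite (wtE hng) lt orbT.
have Fph : filc w.-1 ph by rewrite -Epsi.
have FphS : (2 * m < w)%N -> filc (s m + 2 * m) ph.
  by move=> h; rewrite /s subnK //; lia.
rewrite ED serD serB sCM.
have cph j' : (2 * m < w)%N -> (0 < s m)%N -> (g %| s m - e * j')%N ->
    cf ph (s m) m j' = Complex ((y m).1.1.1 j') ((y m).1.1.2 j').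
  move=> mw s0 d; have [lt|le] := ltnP (s m) (e * j').
    have [_ _ [_ bg] _ _] := Hy m; have [-> ->] := bg _ lt.
    by rewrite cf_big ?lt.
  have [x ex] : exists x, (g * x + e * j' = s m)%N.
    by exists ((s m - e * j') %/ g)%N; rewrite mulnC divnK // subnK.
  rewrite (cfE hng _ _ ex) /ph resE (wtE hng) ex JE leq_addr.
  have -> : (s m + 2 * m == w.-1)%N by apply/eqP; rewrite /s; move: mw; clear; lia.
  have -> : (2 <= x + j' * n + x)%N; last by [].
  case: (j') ex => [|j1]; last by rewrite mulSn; move: n3; clear; lia.
  by rewrite muln0 addn0 => ex; case: (x) ex s0 => [|x']; [rewrite muln0; lia|lia].
have [Hs1 Hs2 [Hs3 Hs4] Hs5 [Hs6 Hs7]] := Hy m.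
case: j wj => [|k] wj.
  rewrite mul0n addn0; rewrite muln0 addn0 in wj.
  case: r wj => [|r] wj.
    have -> : T 0%N 0%N m = 0.
      by apply/eqP; apply: contraT => /(iota_fham ft) [].
    have -> : Nh 0%N 0%N m = 0 by rewrite /Nh ltnn andbF.
    have -> : 2 * ic R * pb (iota H) ph 0%N 0%N m = iota (ham_lie H psi) 0%N 0%N m.
      by rewrite iota_lie sCM Epsi.
    rewrite subrr add0r; apply/eqP; apply: contraT => /(iota_fham (lie_fham (ld_fham L) fpsi)) [].
    by [].
  have sE1 : (g * r.+1 = (s m).+1)%N.
    by rewrite /s -wj; case: (g) gg => // g'; rewrite mulSn; clear; lia.
  have mw : (2 * m < w)%N by rewrite -wj; move: gg; case: (g) => // g' _; rewrite mulSn; clear; lia.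
  rewrite (lead_eq0RI L (FphS mw) sph sE1).
  have d1 : (g %| s m - e * 1)%N.
    have -> : (s m - e * 1 = g * r.+1 - 1 - e * 1)%N by rewrite sE1 subn1.
    by case/orP: (g_cases hng) => /eqP ->; [rewrite dvd1n | apply/dvdnP; exists (r - 1)%N; clear; lia].
  have -> : Im (cf ph (s m) m 1) = (y m).1.1.2 1%N.
    have [s0|s0] := posnP (s m); last by rewrite cph.
    rewrite cf_big; last by rewrite s0 muln1.
    by have [_ ->] := Hs4 1%N ltac:(by rewrite s0 muln1).
  have -> : Nh r.+1 r.+1 m = cR (y m).1.2.
    by rewrite /Nh eqxx -{1}[X in wt X _ _]addn0 -(mul0n n) (wtE hng) muln0 addn0 wj eqxx.
  have TR : T r.+1 r.+1 m = cR (Re (tc m 0)).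
    rewrite (tcE m 0 r.+1); last by rewrite muln0 addn0.
    by rewrite mul0n addn0; apply: conj_fix; rewrite /T -iota_conj.
  have := Hs5 ltac:(by rewrite -sE1 dvdn_mulr).
  rewrite TR => h; rewrite -cRB -(rmorphD (real_complex R)) /= h.
  by [].
have wk : (g * r + e * k.+1 = (s m).+1)%N.
  by apply: wE wj _; rewrite addnS.
have mw : (2 * m < w)%N by rewrite -wj; move: n3 gg; clear; lia.
rewrite (lead_eqRI L (FphS mw) wk).
have s0 : (0 < s m)%N by move: wk gg; clear; lia.
have le : (e * k.+1 <= (s m).+1)%N by rewrite -wk leq_addl.
have hopE u v : (forall j', (g %| s m - e * j')%N -> u j' = v j') ->
    hop (s m) e (th g a b) ka u k = hop (s m) e (th g a b) ka v k.
  move=> uv; rewrite /hop.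
  have d0 : (g %| s m - e * k)%N.
    have -> : (s m - e * k = g * r.+1)%N by move: wk; rewrite mulnS mulnS; move: (e * k)%N (g * r)%N; clear; lia.
    by rewrite dvdn_mulr.
  have d2 : (g %| s m - e * k.+2)%N.
    have -> : (s m - e * k.+2 = g * r - e.+1)%N by move: wk; rewrite !mulnS; move: (e * k)%N (g * r)%N; clear; lia.
    case/orP: (g_cases hng) => /eqP ->; first by rewrite dvd1n.
    by apply/dvdnP; exists (r - 2)%N; clear; lia.
  rewrite (uv _ d0) (uv _ d2); congr (_ - _ - _).
  case/orP: (g_cases hng) => /eqP g1; first by rewrite uv // g1 dvd1n.
  by have [-> _ _] := params2 L (s m) g1; rewrite !mul0r.
rewrite (hopE (fun j => Re (cf ph (s m) m j)) (y m).1.1.1); last by move=> j' d; rewrite cph.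
rewrite (hopE (fun j => Im (cf ph (s m) m j)) (y m).1.1.2); last by move=> j' d; rewrite cph.
rewrite Hs1 // Hs2 //.
have -> : Nh (r + k.+1 * n)%N r m = cR (if k == 0%N then (y m).2 else 0).
  rewrite /Nh (wtE hng) wj eqxx /=.
  have n0 : (0 < n)%N by move: n3; clear; lia.
  have -> : (0 < r + k.+1 * n + r)%N by rewrite mulSn; move: n3; clear; lia.
  have -> : (r + k.+1 * n == r)%N = false by rewrite -{2}[r]addn0 eqn_add2l muln_eq0 (gtn_eqF n0).
  have -> : (r + k.+1 * n == r + n)%N = (k == 0)%N.
    by rewrite eqn_add2l -{2}[n]mul1n eqn_pmul2r.
  have -> : (r == r + k.+1 * n + n)%N = false.
    by rewrite -{1}[r]addn0 -addnA eqn_add2l eq_sym addn_eq0 (gtn_eqF n0) andbF.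
  by rewrite orbF; case: (k == 0)%N.
rewrite -(tcE m k.+1 r wk) /=.
have l0 := la_neq0 L; have cl0 : cR (la b) != 0.
  by apply: contraNneq l0 => /(congr1 Re) /= ->.
set q := (if _ then _ else _); set tt := tc m k.+1.
rewrite {1}(complexE tt).
have E x : cR (la b) * cR (x / la b) = cR x.
  by rewrite -cRM mulrC divfK.
rewrite mulrBr mulrCA E -mulNr E -[cR (- _)]/(cR (- Im tt)).
by rewrite cRB (rmorphN (real_complex R)) /=; ring.
Qed.
End Step.

(** * Uniqueness in the homological equation *)

Section Uniq.
Variable R : rcfType.
Variables (n g : nat).
Hypothesis hng : ((g == 1%N) && (4 <= n)%N) || ((g == 2%N) && (n == 3%N)).
Local Notation e := g.+1.
Local Notation cR := (real_complex R).
Local Notation iota := (@zcoords R).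
Local Notation Fil := (Filt n g).
Local Notation filc := (cfilt n g).
Local Notation lead := (leading n g).
Local Notation cf := (freq_coef n g).
Local Notation ka := (resonant R n g).
Local Notation NF := (@normal_form R n g).
Local Notation Re := (@complex.Re R).
Local Notation Im := (@complex.Im R).

Lemma NF_real D p q m : NF (iota D) -> iota D p q m = cR (Re (iota D p q m)).
Proof. by move=> [sym _]; apply: conj_fix; rewrite -iota_conj. Qed.

Lemma split_eq (x l u w : R) : cR x = cR l * (ic R * cR u - cR w) ->
  x = - (l * w) /\ l * u = 0.
Proof. by move=> E; split; [have := congr1 Re E|have := congr1 Im E] => /= ->; ring. Qed.

(** In weight v + 1 the hypothesis on D says that the coefficients of chi solve the recurrences with
    a right-hand side in normal form. Then D vanishes in this weight, and only real homogeneous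
    solutions remain in chi. *)
Lemma hom_uniq H a b v chi D : lead H a b -> (e <= v)%N -> fham chi -> Fil v chi ->
  Fil v.+1 D -> NF (iota D) -> Fil v.+2 (D - ham_lie H chi) ->
  Fil v.+2 D /\ forall s m, (s + 2 * m = v)%N ->
    [/\ forall j, Im (cf (iota chi) s m j) = 0,
        ~~ (e %| s)%N -> forall j, Re (cf (iota chi) s m j) = 0 &
        Re (cf (iota chi) s m (s %/ e)) = 0 -> forall j, Re (cf (iota chi) s m j) = 0].
Proof.
move=> L ev fchi Fchi FD [sym nf] F2; have n3 := n_ge3 hng; have gg := g_gt0 hng.
have n0 : (0 < n)%N by move: n3; clear; lia.
have Dr p q m : iota D p q m = cR (Re (iota D p q m)).
  by apply: NF_real; split.
have DE r j m : (g * r + e * j + 2 * m = v.+1)%N ->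
    iota D (r + j * n)%N r m = (2 * ic R) * pb (iota H) (iota chi) (r + j * n)%N r m.
  move=> w; have : iota (D - ham_lie H chi) (r + j * n)%N r m = 0.
    by apply: filc_0 F2 _; rewrite (wtE hng) w ltnS leqnn orbT.
  by rewrite (ghB (iota_gh R)) iota_lie serB sCM => /eqP; rewrite subr_eq0 => /eqP.
have NF2 r k m : iota D (r + k.+2 * n)%N r m = 0.
  apply/eqP; apply: contraT => /nf [[h _ _]|[h _]|[h _]]; move: h; clear -n0; rewrite !mulSn; lia.
have NF0 m : iota D 0%N 0%N m = 0.
  by apply/eqP; apply: contraT => /nf [[_ h _]|[h _]|[h _]]; move: h; clear -n0; lia.
have core s m : (s + 2 * m = v)%N ->
    [/\ [/\ forall j, Im (cf (iota chi) s m j) = 0,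
        ~~ (e %| s)%N -> forall j, Re (cf (iota chi) s m j) = 0 &
        Re (cf (iota chi) s m (s %/ e)) = 0 -> forall j, Re (cf (iota chi) s m j) = 0],
      forall Q, (g * Q = s.+1)%N -> iota D Q Q m = 0 &
      forall Q, (g * Q + e = s.+1)%N -> iota D (Q + n)%N Q m = 0].
  move=> sv.
  (* The minus sign is the one in front of the imaginary recurrence in [lead_eqRI]. *)
  pose N1 := if (e <= s.+1)%N && (g %| s.+1 - e)%N then
     - Re (iota D ((s.+1 - e) %/ g + n)%N ((s.+1 - e) %/ g)%N m) else 0.
  pose N0 := if (g %| s.+1)%N then Re (iota D (s.+1 %/ g)%N (s.+1 %/ g)%N m) else 0.
  have Fs : filc (s + 2 * m) (iota chi) by rewrite sv.
  have eqk k r : (g * r + e * k.+1 = s.+1)%N ->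
      cR (Re (iota D (r + k.+1 * n)%N r m)) = cR (la n g b) * (ic R * cR (hop s e (th g a b) ka (fun j => Re (cf (iota chi) s m j)) k)
     - cR (hop s e (th g a b) ka (fun j => Im (cf (iota chi) s m j)) k)).
    move=> w; rewrite -Dr DE ?(lead_eqRI hng L Fs w) //.
    by rewrite w -sv.
  have par k : (e * k.+1 <= s.+1)%N ->
      (exists r, (g * r + e * k.+1 = s.+1)%N) \/
      ~~ (g %| s.+1 - e * k.+1)%N.
    move=> le; have [d|] := orP (orbN (g %| s.+1 - e * k.+1)%N); last by right.
    by left; exists ((s.+1 - e * k.+1) %/ g)%N; rewrite mulnC divnK ?subnK.
  have l0 := la_neq0 hng L.
  have hopN u k : (forall j, cf (iota chi) s m j = 0 -> u j = 0) -> (e * k.+1 <= s.+1)%N ->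
      ~~ (g %| s.+1 - e * k.+1)%N -> hop s e (th g a b) ka u k = 0.
    move=> uz le nd; have [c0 c2 t0] := cf_parity hng L (iota chi) m le nd.
    by rewrite /hop t0 (uz k c0) (uz _ c2) !(mul0r, mulr0, subrr, subr0).
  have sol := homological_unique (s := s) (e := e) (g := g) (th := th g a b) (ka := ka)
    (mu := mu n g b s) (la := la n g b) erefl (g_cases hng) (ka_ge0 R n g) l0
    (th_neq0 L) (params2 hng L s)
    (yR := fun j => Re (cf (iota chi) s m j)) (yI := fun j => Im (cf (iota chi) s m j)) (N0 := N0) (N1 := N1).
  have [] := sol.
  - move=> k le; have [[r w]|nd] := par k le; last by apply: hopN => // j ->.
    have [_ h] := split_eq (eqk k r w); move/eqP: h; rewrite mulf_eq0 (negPf l0) /=.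
    by move=> /eqP.
  - move=> k le; have [[r w]|nd] := par k le; last first.
      rewrite (hopN _ _ _ le nd) ?mulr0; last by move=> j ->.
      case: eqP => // k0; rewrite /N1; subst k; rewrite muln1 in nd.
      by rewrite (negPf nd) andbF.
    have [h _] := split_eq (eqk k r w).
    case: k le w h => [|k] le w h /=; last first.
      by move: h; rewrite NF2 /= => /esym /eqP; rewrite oppr_eq0 => /eqP.
    rewrite muln1 in le w; rewrite /N1 le -w addnK dvdn_mulr //= mulKn //.
    by rewrite mul1n in h; rewrite h opprK.
  - by move=> j c; rewrite cf_big.
  - move=> gs; have es : (g * (s %/ g) + e * 0 = s)%N by rewrite muln0 addn0 mulnC divnK.
    rewrite (cfE hng _ _ es) mul0n addn0.
    by rewrite (@conj_fix R (iota chi _ _ _)) // -iota_conj.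
  - move=> gs; rewrite /N0 gs; have es : (g * (s.+1 %/ g) = s.+1)%N by rewrite mulnC divnK.
    have := DE (s.+1 %/ g)%N 0%N m; rewrite mul0n muln0 !addn0 es => h.
    rewrite h; last by rewrite -sv.
    by rewrite (lead_eq0RI hng L Fs (csym_iota chi) es).
  - rewrite /N1; case: ifP => [/andP[le d]|_]; last by rewrite eqxx.
    rewrite oppr_eq0 => nz.
    have /nf : iota D ((s.+1 - e) %/ g + n)%N ((s.+1 - e) %/ g)%N m != 0.
      by apply: contraNneq nz => ->.
    set Q := ((s.+1 - e) %/ g)%N.
    have eQ : (g * Q + e = s.+1)%N by rewrite /Q mulnC divnK // subnK.
    case=> [[h _ _]|[_]|[h _]]; [move: h; clear -n0; lia| |move: h; clear -n0; lia].
    by rewrite /okB mulnS; have -> : (g + g * Q = s)%N by move: eQ; clear; lia.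
  - rewrite /N0; case: ifP => [d|_]; last by rewrite eqxx.
    move=> nz.
    have /nf : iota D (s.+1 %/ g)%N (s.+1 %/ g)%N m != 0.
      by apply: contraNneq nz => ->.
    case=> [[_ _]|[h _]|[h _]]; [|move: h; clear -n0; lia|move: h; clear -n0; lia].
    rewrite /okA [(g * _)%N]mulnC divnK //= => /orP[/eqP|]; first by left.
    by right.
  move=> r1 r0 rI rR rM; split; first by split.
  - move=> Q eQ; have d : (g %| s.+1)%N by rewrite -eQ dvdn_mulr.
    have := r0 d; rewrite /N0 d -eQ mulKn // => h.
    by rewrite Dr h.
  move=> Q eQ; have le : (e <= s.+1)%N by rewrite -eQ leq_addl.
  have := r1 le; rewrite /N1 le -eQ addnK dvdn_mulr //= mulKn // => /eqP.
  by rewrite oppr_eq0 => /eqP h; rewrite Dr h.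
split; last by move=> s m /core [].
apply: (filc_half hng (h := iota D)); [exact: (csym_iota D)|by move=> p q m /FD []|move=> r j m].
rewrite ltnS leq_eqVlt => /orP[/eqP wj|lt]; last first.
  by apply: filc_0 FD _; rewrite (wtE hng) lt orbT.
case: j wj => [|[|k]] wj; last exact: NF2.
  rewrite muln0 addn0 in wj; rewrite mul0n addn0.
  case: r wj => [|r] wj; first exact: NF0.
  have sv : ((v - 2 * m) + 2 * m = v)%N by rewrite subnK //; move: wj gg; case: (g) => // g'; rewrite mulSn; clear; lia.
  by have [_ h _] := core _ _ sv; apply: h; move: sv wj; clear; lia.
have sv : ((v - 2 * m) + 2 * m = v)%N by rewrite subnK //; move: wj gg; clear; lia.
have [_ _ h] := core _ _ sv; rewrite mul1n; apply: h.
by move: sv wj; clear; lia.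
Qed.
End Uniq.

(** * Series commuting with the Hamiltonian *)

Section Kernel.
Variable R : rcfType.
Variables (n g : nat).
Hypothesis hng : ((g == 1%N) && (4 <= n)%N) || ((g == 2%N) && (n == 3%N)).
Local Notation e := g.+1.
Local Notation cR := (real_complex R).
Local Notation iota := (@zcoords R).
Local Notation wt := (weight n g).
Local Notation res := (same_residue n).
Local Notation Fil := (Filt n g).
Local Notation lead := (leading n g).
Local Notation cf := (freq_coef n g).
Local Notation NF := (@normal_form R n g).
Local Notation Re := (@complex.Re R).

Lemma fham_M (f H : ser R) : fham H -> fham (f * H).
Proof.
move=> [x o]; split.
  exact: (@xygeM _ 0 2 f H (fun i j k => _) x).
exact: ordgeMl o.
Qed.

Lemma lie_E (H : ser R) k : ham_lie H (sE ^+ k) = 0.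
Proof.
elim: k => [|k IH]; first by rewrite expr0 /ham_lie -sC1 pb_Cl.
by rewrite exprS lieM IH mulr0 /ham_lie pb_El mul0r addr0.
Qed.

Lemma lie_X (H : ser R) k : ham_lie H (H ^+ k) = 0.
Proof.
elim: k => [|k IH]; first by rewrite expr0 /ham_lie -sC1 pb_Cl.
by rewrite exprS lieM IH /ham_lie pbff mul0r mulr0 addr0.
Qed.

Lemma iota_powE H k : iota (H ^+ k) = iota H ^+ k.
Proof. exact: (gh_exp (iota_gh R)). Qed.

(** The part of lowest weight of H^M is a product of monomials of weight e of H, and these are free
    of eps. *)
Lemma lead_pow_m H a b M p q m : lead H a b -> iota (H ^+ M) p q m != 0 ->
  (wt p q m <= e * M)%N -> m = 0%N.
Proof.
move=> L; elim: M p q m => [|M IH] p q m.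
  by rewrite iota_powE expr0 ser1E; case: m => // m; rewrite andbF eqxx.
rewrite exprS (ghM (iota_gh R)).
move=> /serM_neq0 [p1 [q1 [m1 [p2 [q2 [m2 [-> -> -> h1 h2]]]]]]] w.
have [r1 w1] := ld_Fil L h1.
have FM : Fil (M * e) (H ^+ M) by apply: FilX (ld_Fil L).
have [r2 w2] := FM _ _ _ h2.
have [] := wt_add hng (d := 0) m1 m2 r1 r2 (P := (p1 + p2)%N) (Q := (q1 + q2)%N);
  rewrite ?addn0 // => _; rewrite muln0 addn0 => w3.
have [w1' w2'] : wt p1 q1 m1 = e /\ (wt p2 q2 m2 <= e * M)%N.
  by move: w w1 w2 w3; rewrite mulnS mulnC; move: (e * M)%N; clear; lia.
have [h _] := iota_fham (ld_fham L) h1.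
have [-> _] := wt_lead hng r1 h w1'.
by rewrite add0n; apply: IH h2 w2'.
Qed.

(** The monomial z^(M n) has the lowest weight e M of H^M, and z^n is the only monomial of weight e
    without zb; so each factor contributes b z^n. *)
Lemma lead_pow_b H a b M : lead H a b -> iota (H ^+ M) (M * n)%N 0%N 0%N = cR (b ^+ M).
Proof.
move=> L; elim: M => [|M IH].
  by rewrite iota_powE !expr0 mul0n ser1E.
rewrite exprS (ghM (iota_gh R)) -[iota H](subrK (sC (cR b) * mon n 0%N 0%N)) mulrDl serD.
rewrite -mulrA sCM monM_coef mulSn leq_addr /= addKn subn0 IH -cRM -exprS.
set G := iota (H ^+ M); suff -> : ((iota H - sC (cR b) * mon n 0%N 0%N) * G) (n + M * n)%N 0%N 0%N = 0.
  by rewrite add0r.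
apply/eqP; apply: contraT.
move=> /serM_neq0 [p1 [q1 [m1 [p2 [q2 [m2 [ep eq em h1 h2]]]]]]].
have [[q10 q20] [m10 m20]] : (q1 = 0 /\ q2 = 0)%N /\ (m1 = 0 /\ m2 = 0)%N.
  by move: eq em; clear; lia.
subst q1 q2 m1 m2.
have n3 := n_ge3 hng.
have FM : Fil (M * e) (H ^+ M) by apply: FilX (ld_Fil L).
have [r2] := FM _ _ _ h2.
have pform p : res p 0%N -> exists j, p = (0 + j * n)%N.
  by rewrite /same_residue mod0n => /dvdnP [j ->]; exists j.
have [j2 e2] := pform _ r2; rewrite e2 (wtE hng) muln0 add0n addn0 mulnC leq_pmul2l // => j2M.
have [e1|n1] := eqVneq p1 n.
  by move: h1; rewrite e1 serB sCM monE !eqxx mulr1 (ld_b L) subrr eqxx.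
have h1' : iota H p1 0%N 0%N != 0.
  by move: h1; rewrite serB sCM monE (negPf n1) /= mulr0 subr0.
have [r1] := ld_Fil L h1'; have [j1 e1] := pform _ r1.
rewrite e1 (wtE hng) muln0 add0n addn0 -[X in (X <= _)%N]muln1 leq_pmul2l // => j10.
have : (n + M * n = (j1 + j2) * n)%N by rewrite ep e1 e2 !add0n mulnDl.
rewrite -mulSn => /eqP; rewrite eqn_pmul2r; last by move: n3; clear; lia.
move=> /eqP h; have j1E : j1 = 1%N by move: h j2M j10; clear; lia.
by move: n1; rewrite e1 j1E mul1n eqxx.
Qed.

(* zeta is a combination of the eps^m H^M that matches the free real coefficient
   of each solution of the homogeneous recurrence. *)
Lemma kernel_split H a b v chi D : lead H a b -> (e <= v)%N -> fham chi -> Fil v chi ->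
  Fil v.+1 D -> NF (iota D) -> Fil v.+2 (D - ham_lie H chi) ->
  Fil v.+2 D /\ exists2 zeta, fham zeta /\ ham_lie H zeta = 0 & Fil v zeta /\ Fil v.+1 (chi - zeta).
Proof.
move=> L ev fchi Fchi FD nfD F2.
split; first by have [] := hom_uniq hng L ev fchi Fchi FD nfD F2.
have n3 := n_ge3 hng; have gg := g_gt0 hng; have b0 := ld_b0 L.
pose M m := ((v - 2 * m) %/ e)%N.
pose ok (m : nat) := (2 * m < v)%N && (e %| v - 2 * m)%N.
pose lam m := Re (iota chi (M m * n)%N 0%N m) / b ^+ M m.
pose zeta := \sum_(m < v | ok m) sC (lam m) * (sE ^+ m * H ^+ M m) : ser R.
have okM m : ok m -> (e * M m + 2 * m = v)%N.
  by move=> /andP[lt d]; rewrite /M mulnC divnK // subnK // ltnW.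
have M0 m : ok m -> (0 < M m)%N.
  by move=> o; have := okM m o; move: (o) => /andP[lt _]; case: (M m) => //; rewrite muln0; move: lt; clear; lia.
have fz : fham zeta.
  rewrite /zeta; apply: (big_ind (@fham R)); [exact: fham0|exact: fhamD|].
  move=> m /M0; case: (M m) => // k _; apply: fham_CM; rewrite exprSr mulrA.
  exact: fham_M (ld_fham L).
have lz : ham_lie H zeta = 0.
  rewrite /zeta; apply: (big_ind (fun f : ser R => ham_lie H f = 0)) => [|f h ef eh|m _].
  - by rewrite -[X in ham_lie H X](subrr (0 : ser R)) lieB subrr.
  - by rewrite lieD ef eh addr0.
  - by rewrite lie_CM lieM lie_X lie_E !(mulr0, mul0r, addr0).
have Fz : Fil v zeta.
  apply: (@Fil_sum R n g) => m /okM vE; apply: FilC.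
  have FH : Fil (M m * e) (H ^+ M m) by exact: (FilX hng (ld_Fil L)).
  by have := FilM hng (@Fil_E R n g hng m) FH; rewrite addnC (mulnC _ e) vE.
exists zeta => //; split=> //.
have fx : fham (chi - zeta) by apply: fhamD => //; apply: fhamN.
have Fx : Fil v (chi - zeta) by apply: FilB.
have F2x : Fil v.+2 (D - ham_lie H (chi - zeta)) by rewrite lieB lz subr0.
have [_ U] := hom_uniq hng L ev fx Fx FD nfD F2x.
have zc s m : (s + 2 * m = v)%N -> (0 < s)%N -> (e %| s)%N ->
   iota zeta (s %/ e * n)%N 0%N m = cR (Re (iota chi (s %/ e * n)%N 0%N m)).
  move=> sv s0 d; have om : ok m.
    by rewrite /ok -sv addnK d andbT; move: s0; clear; lia.
  have mv : (m < v)%N by move: om => /andP[]; clear; lia.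
  have MmE : (s %/ e)%N = M m by rewrite /M -sv addnK.
  rewrite MmE (gh_sum (iota_gh R)) ser_sum (bigD1 (Ordinal mv)) //= big1 => [|m' /andP[ok' nm]].
    rewrite addr0 !(ghM (iota_gh R)) iota_C (gh_exp (iota_gh R)) iota_E sCM sEnM leqnn subnn.
    rewrite (lead_pow_b _ L) -cRM divfK // expf_neq0 //.
  rewrite !(ghM (iota_gh R)) iota_C (gh_exp (iota_gh R)) iota_E sCM sEnM.
  case: leqP => [le|_]; last by rewrite mulr0.
  rewrite [iota _ _ _ _](_ : _ = 0) ?mulr0 //; apply/eqP; apply: contraT => nz.
  (* This monomial would lie in the lowest weight of the power of H that belongs to m', which is
     free of eps; hence m' = m. *)
  have := lead_pow_m L nz; rewrite -[X in wt X _ _]add0n (wtE hng) muln0 add0n.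
  move=> h; have em : (m - m' = 0)%N.
    apply: h; have := okM _ om; have := okM _ ok'; move: le; clear.
    by move: (e * M m)%N (e * M m')%N => x y; lia.
  move/eqP: nm; case; apply: val_inj => /=; move: em le; clear; lia.
have cf0 s m j : (s + 2 * m = v)%N -> cf (iota (chi - zeta)) s m j = 0.
  move=> sv; have [UI UR UM] := U _ _ sv; rewrite [LHS]complexE UI.
  rewrite (_ : Re _ = 0) ?mulr0 ?addr0 //.
  have [d|nd] := orP (orbN (e %| s)%N); last exact: UR.
  apply: UM; rewrite (@cfE R n g hng _ s m (s %/ e) 0); last by rewrite muln0 add0n mulnC divnK.
  rewrite add0n.
  have [s0|s0] := posnP s.
    rewrite s0 div0n mul0n.
    have -> // : iota (chi - zeta) 0%N 0%N m = 0.
    by apply/eqP; apply: contraT => /(iota_fham fx) [].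
  by rewrite (ghB (iota_gh R)) serB ReB zc //= subrr.
apply: (filc_half hng (h := iota (chi - zeta))); [exact: (csym_iota (chi - zeta))|by move=> p q m /Fx []|move=> r j m].
rewrite ltnS leq_eqVlt => /orP[/eqP wj|lt]; last first.
  by apply: filc_0 Fx _; rewrite (wtE hng) lt orbT.
by rewrite -(@cfE R n g hng _ (g * r + e * j) m j r) // cf0.
Qed.
End Kernel.

(** * Canonical changes of variables *)

Section Canonical.
Variable R : realFieldType.

(** Substitution operators of area-preserving formal maps that fix the origin; invertibility is
    added in [iso]. *)
Record can (phi : ser R -> ser R) : Prop := Can {
  can_gh : ghom phi;
  can_C : forall c, phi (sC c) = sC c;
  can_E : phi sE = sE;
  can_X : xyge 1 (phi sX);
  can_Y : xyge 1 (phi sY);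
  can_jac : pb (phi sX) (phi sY) = 1 }.

Lemma can_pb phi f h : can phi -> phi (pb f h) = pb (phi f) (phi h).
Proof.
by move=> c; rewrite (pb_gh (can_gh c) (can_C c) (can_E c)) (can_jac c) mulr1.
Qed.

Lemma ghom_xy (phi : ser R -> ser R) N f : ghom phi -> (forall c, phi (sC c) = sC c) ->
  phi sE = sE -> xyge 1 (phi sX) -> xyge 1 (phi sY) -> xyge N f -> xyge N (phi f).
Proof.
move=> gh gC gE xX xY xf; apply: xygeP => i j k.
rewrite (ghom_gsub gh (@rhom_id R) gC) gE.
have oX := gh_ord gh (@ordge_sX R); have oY := gh_ord gh (@ordge_sY R).
move=> /(gsub_neq0 (@rhom_id R) oX oY (@ordge_sE R)) [a [b [d [nf nz]]]].
have h := xyge_neq0 xf nf; apply: leq_trans h _.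
have h0 : xyge 0 (sE ^+ d : ser R) by [].
have ha := xygeX (n := a) xX; have hb := xygeX (n := b) xY.
by have := xyge_neq0 (xygeM ha (xygeM hb h0)) nz; rewrite !muln1 addn0.
Qed.

Lemma can_xy phi N f : can phi -> xyge N f -> xyge N (phi f).
Proof. by case=> gh gC gE xX xY _; apply: ghom_xy. Qed.

Lemma can_fham phi H : can phi -> fham H -> fham (phi H).
Proof. by move=> c [x o]; split; [apply: can_xy|apply: (gh_ord (can_gh c))]. Qed.

Lemma can_comp phi psi : can phi -> can psi -> can (phi \o psi).
Proof.
move=> c d; split => [|x|||| /=].
- exact: ghom_comp (can_gh c) (can_gh d).
- by rewrite /= (can_C d) (can_C c).
- by rewrite /= (can_E d) (can_E c).
- exact: can_xy c (can_X d).
- exact: can_xy c (can_Y d).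
- by rewrite -(can_pb _ _ c) (can_jac d) (gh1 (can_gh c)).
Qed.

Lemma can_Exp H : fham H -> can (Exp H).
Proof.
move=> [x o]; split.
- exact: Exp_ghom o.
- by move=> c; rewrite Exp_C.
- exact: Exp_E.
- by apply: Exp_xy x _; exact: xyge_sX.
- by apply: Exp_xy x _; exact: xyge_sY.
- exact: Exp_jac o.
Qed.

Lemma can_nat phi H f : can phi -> fham H -> phi (Exp H f) = Exp (phi H) (phi f).
Proof.
move=> c [_ o]; apply: Exp_nat => //; [exact: can_gh c|exact: can_C c|].
by move=> u v; apply: can_pb.
Qed.

Lemma can_log phi : can phi -> ordge 2 (phi sX - sX) -> ordge 2 (phi sY - sY) ->
  exists2 chi, fham chi & phi =1 Exp chi.
Proof. by case=> *; apply: log_exists. Qed.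

Definition rotX (c s : R) : ser R := sC c * sX - sC s * sY.
Definition rotY (c s : R) : ser R := sC s * sX + sC c * sY.
Definition rot_ser c s : ser R -> ser R := gsub id (rotX c s) (rotY c s) sE.

Lemma linear_rotX c s : linear_ser (rotX c s).
Proof.
rewrite /rotX -mulNr -sC_N; apply: linear_serD; apply: linear_ser_C; [exact: linear_sX|exact: linear_sY].
Qed.
Lemma linear_rotY c s : linear_ser (rotY c s).
Proof.
by apply: linear_serD; apply: linear_ser_C; [exact: linear_sX|exact: linear_sY].
Qed.
Lemma rotP c s : [/\ ghom (rot_ser c s), forall x, rot_ser c s (sC x) = sC x,
  rot_ser c s sX = rotX c s, rot_ser c s sY = rotY c s & rot_ser c s sE = sE].
Proof.
have oX := linear_ord (@linear_rotX c s); have oY := linear_ord (@linear_rotY c s).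
exact: (gsubP (rhom_id R) oX oY (@ordge_sE R)).
Qed.

Lemma can_rot c s : c ^+ 2 + s ^+ 2 = 1 -> can (rot_ser c s).
Proof.
move=> cs; have [gh gC gX gY gE] := rotP c s; split; rewrite ?gX ?gY //.
- by apply: xygeP => i j k /linear_rotX [<-].
- by apply: xygeP => i j k /linear_rotY [<-].
rewrite /rotX /rotY pbDl pbNl !pbDr !pb_CMl !pb_CMr !pbff pb_XY (pbC sY) pb_XY.
transitivity (sC c * sC c + sC s * sC s : ser R); first ring.
by rewrite -!sC_M -sC_D -!expr2 cs sC1.
Qed.
End Canonical.

(** * Uniqueness of the normal form under invariant flows *)

Section Uniqueness.
Variable R : rcfType.
Variables (n g : nat).
Hypothesis hng : ((g == 1%N) && (4 <= n)%N) || ((g == 2%N) && (n == 3%N)).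
Local Notation e := g.+1.
Local Notation C := R[i].
Local Notation cR := (real_complex R).
Local Notation iota := (@zcoords R).
Local Notation wt := (weight n g).
Local Notation res := (same_residue n).
Local Notation Fil := (Filt n g).
Local Notation filc := (cfilt n g).
Local Notation lead := (leading n g).
Local Notation NF := (@normal_form R n g).

Lemma iota_rot c s f p q m :
  iota (rot_ser c s f) p q m = iota f p q m * (Complex c s ^+ p * Complex c (- s) ^+ q).
Proof.
have cN x : cR (- x) = - cR x by exact: (rmorphN (real_complex R)).
have [gh gC gX gY gE] := rotP c s.
rewrite -(coef_gsub_scale (rhom_id C)) /=.
have [kh kC kX kY kE] := gsubP (rhom_id C) (ordge_scale (Complex c s) (@ordge_sX C))
  (ordge_scale (Complex c (- s)) (@ordge_sY C)) (@ordge_sE C).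
set K := gsub _ _ _ _ in kh kC kX kY kE *.
suff E : iota (rot_ser c s f) = K (iota f) by rewrite E.
move: f; apply: (ghom_eq (ghom_comp (iota_gh R) gh) (ghom_comp kh (iota_gh R))) => [x|||] /=.
- by rewrite gC iota_C kC.
- rewrite gX /rotX (ghB (iota_gh R)) !(ghM (iota_gh R)) !iota_C iota_X iota_Y.
  rewrite /iX /iY (ghM kh) kC (ghD kh) kX kY (complexE (Complex c s)) (complexE (Complex c (- s))) /=.
  by rewrite !sC_D !sC_M cN !sC_N; ring.
- rewrite gY /rotY (ghD (iota_gh R)) !(ghM (iota_gh R)) !iota_C iota_X iota_Y.
  rewrite /iX /iY (ghM kh) kC (ghB kh) kX kY (complexE (Complex c s)) (complexE (Complex c (- s))) /=.
  have i2 : sC (ic R) * sC (ic R) = - 1 :> ser C by rewrite -sC_M ic2 sC_N sC1.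
  rewrite !sC_D !sC_M cN !sC_N.
  set I := sC (ic R) in i2 *; set x := sC (cR c); set y := sC (cR s); set z := sC (c2 R).
  transitivity (- (I * I) * (y * z * (sX + sY)) - I * (z * x * (sX - sY))); last ring.
  by rewrite i2 opprK mul1r; ring.
- by rewrite gE iota_E kE.
Qed.

Lemma rotK (c s : R) : c ^+ 2 + s ^+ 2 = 1 -> cancel (rot_ser c (- s)) (rot_ser c s).
Proof.
move=> cs f; apply: iota_inj; apply: ser_ext => p q m; rewrite !iota_rot opprK.
rewrite -mulrA mulrACA -!exprMn [Complex c (- s) * _]mulrC.
have -> : Complex c s * Complex c (- s) = 1; last by rewrite !expr1n !mulr1.
by apply/eqP; rewrite eq_complex /= -cs; apply/andP; split; apply/eqP; ring.
Qed.

Lemma rot_comm (c s c' s' : R) f : rot_ser c s (rot_ser c' s' f) = rot_ser c' s' (rot_ser c s f).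
Proof.
by apply: iota_inj; apply: ser_ext => p q m; rewrite !iota_rot mulrAC.
Qed.

(** Rotations are diagonal in z, zb: z^p zb^q is multiplied by the (p - q)-th power of a primitive
    n-th root of unity. *)
Lemma Fil0_rot (c s : R) f : c ^+ 2 + s ^+ 2 = 1 -> n.-primitive_root (Complex c s) ->
  Fil 0 f <-> rot_ser c s f = f.
Proof.
move=> cs pr; pose z := Complex c s; pose zb := Complex c (- s).
have zz : z * zb = 1.
  by apply/eqP; rewrite eq_complex /= -cs; apply/andP; split; apply/eqP; ring.
have E p q : z ^+ p * zb ^+ q = 1 <-> res p q.
  rewrite /same_residue -(eq_prim_root_expr pr); split=> [h|/eqP ->]; last by rewrite -exprMn zz expr1n.
  by rewrite -[z ^+ q]mul1r -h -mulrA -exprMn [zb * z]mulrC zz expr1n mulr1.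
split=> [F|h p q m nz].
  apply: iota_inj; apply: ser_ext => p q m; rewrite iota_rot.
  have [->|/F [/E -> _]] := eqVneq (iota f p q m) 0; first by rewrite mul0r.
  by rewrite mulr1.
split=> //; apply/E; have := iota_rot c s f p q m; rewrite h => e0.
by apply: (mulfI nz); rewrite mulr1 -e0.
Qed.

(* exp(chi') = exp(chi) exp(-zeta): the parts of weight at most v of chi' have a
   vanishing bracket with z zb and z^n + zb^n, hence vanish. *)
Lemma center_lemma v (chi chi' zeta : ser R) : (e <= v)%N ->
  fham chi -> fham zeta -> fham chi' -> Fil v chi -> Fil v zeta -> Fil v.+1 (chi - zeta) ->
  Fil 0 chi' -> (forall f, Exp chi' f = Exp chi (Exp (- zeta) f)) -> Fil v.+1 chi'.
Proof.
move=> ev fc fz fc' Fc Fz Fd F0 E; have n3 := n_ge3 hng; have gg := g_gt0 hng.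
have Fe : Fil e chi' by apply: (fham_Fil hng).
have Fec : Fil e chi by apply: FilW Fc.
have Fez : Fil e (- zeta) by apply: FilN; apply: FilW Fz.
have f0 := fham0 R; have F0' : Fil e (0 : ser R) by exact: Fil0.
have step u : (e <= u)%N -> (u <= v)%N -> Fil u chi' -> Fil u.+1 chi'.
  move=> eu uv Fu.
  (* A bracket with a series of weight u gains u - g in general. Here it gains one more: to first
     order chi' is chi - zeta, of weight v + 1, and the second-order terms are of higher weight as
     well. *)
  have L w (f : ser R) : Fil w f -> Fil (w + (u - g).+1) (ham_lie chi' f).
    move=> Ff.
    have A (h : ser R) k (r := (k - g)%N) : (g <= k)%N -> fham h -> Fil e h -> Fil k h ->
        Fil (w + r.+1) (Exp h f - f - ham_lie h f).
      move=> gk fh Fh Fk; rewrite -{2}(Exp0 f) -{2}(subr0 h).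
      by apply: (Exp_perturb_Fil hng f0 fh F0' Fh _ Ff); rewrite subr0 /r subnKC.
    have B1 := A chi' u (ltnW eu) fc' Fe Fu.
    have B2 := A chi v (ltnW ev) fc Fec Fc.
    have B3 := A (- zeta) v (ltnW ev) (fhamN fz) Fez (FilN Fz).
    have B4 : Fil (w + (v - g).+1) (ham_lie (chi - zeta) f).
      by apply: (Fil_lie hng Fd Ff); move: ev; clear; lia.
    pose l := ham_lie (- zeta) f; pose r3 := Exp (- zeta) f - f - l.
    have Fl : Fil (w + (v - g)) l.
      by apply: (Fil_lie hng (FilN Fz) Ff); move: ev; clear; lia.
    have B5 : Fil (w + (v - g).+1) (Exp chi l - l).
      by rewrite addnS; apply: (Exp_Fil hng fc Fec Fl).
    have B6 : Fil (w + (v - g).+1) (Exp chi r3).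
      rewrite -[Exp chi r3](subrK r3); apply: (FilD _ B3).
      by apply: FilW (leqnSn _) _; apply: (Exp_Fil hng fc Fec B3).
    have B : Fil (w + (u - g).+1) (Exp chi' f - f).
      have -> : Exp chi' f - f = ham_lie (chi - zeta) f + (Exp chi f - f - ham_lie chi f)
          + (Exp chi l - l) + Exp chi r3.
        have gE := can_gh (can_Exp fc).
        rewrite E (_ : Exp (- zeta) f = f + l + r3); last by rewrite /r3; ring.
        rewrite !(ghD gE).
        have -> : ham_lie (chi - zeta) f = ham_lie chi f + l by rewrite /l /ham_lie pbDr.
        by ring.
      apply: (FilW (v := (w + (v - g).+1)%N)); first by move: uv; clear; lia.
      by apply: FilD B6; apply: FilD B5; apply: FilD B2.
    have -> : ham_lie chi' f = (Exp chi' f - f) - (Exp chi' f - f - ham_lie chi' f) by ring.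
    exact: FilB B B1.
  have nzi : 2 * ic R != 0.
    by rewrite mulf_neq0 ?ic_neq0 // pnatr_eq0.
  have T w h P Q m : csym h -> filc w h -> (wt P Q m < w + (u - g).+1)%N ->
      pb h (iota chi') P Q m = 0.
    move=> sh Fh lt; have [f Ef] := iota_surj sh.
    have Ff : Fil w f by rewrite /Filt Ef.
    have := filc_0 (L w f Ff) (p := P) (q := Q) (m := m); rewrite lt orbT => /(_ isT).
    rewrite iota_lie sCM Ef pbC serN mulrN => /eqP.
    by rewrite oppr_eq0 mulf_eq0 (negPf nzi) /= => /eqP.
  have off P Q m : P != Q -> (wt P Q m <= u)%N -> iota chi' P Q m = 0.
    move=> nPQ le; have := T g (mon 1%N 1%N 0%N) P Q m.
    have -> : pb (mon 1 1 0) (iota chi') P Q m = iota chi' P Q m * (Q%:R - P%:R).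
      rewrite pb_mon /= mulrBr !mulr_natr !subn0 !muln1; congr (_ - _).
        by case: Q {nPQ le} => [|Q] /=; rewrite ?mulr0n // subn1.
      by case: P {nPQ le} => [|P] /=; rewrite ?mulr0n // subn1.
    move=> h; have /eqP : iota chi' P Q m * (Q%:R - P%:R) = 0.
      apply: h.
      - move=> p q k; rewrite !monE [RHS](_ : _ = ((p == 1%N) && (q == 1%N) && (k == 0%N))%:R).
          by rewrite [(q == 1%N) && _]andbC.
        by case: (_ && _); rewrite ?conjc1 ?conjc0 //; apply: conjc1.
      - move=> p q k; rewrite monE; have [->|] := eqVneq p 1%N; last by rewrite eqxx.
        have [->|] := eqVneq q 1%N; last by rewrite eqxx.
        move=> _; split; first by rewrite /same_residue eqxx.
        have := wtE hng 1 0 k; rewrite mul0n addn0 muln1 muln0 addn0 => ->.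
        by rewrite leq_addr.
      - by move: le eu; clear; lia.
    rewrite mulf_eq0 subr_eq0 eqr_nat [Q == P]eq_sym (negPf nPQ) orbF.
    by move/eqP.
  apply: filcP => P Q m /orP[nr|le].
    by apply: (filc_0 F0); rewrite nr.
  rewrite ltnS in le.
  have [ePQ|] := eqVneq P Q; last by move=> h; apply: off.
  subst Q; case: P le => [|r] le.
    by apply/eqP; apply: contraT => /(iota_fham fc') [].
  have wr : wt r.+1 r.+1 m = (g * r.+1 + 2 * m)%N.
    by rewrite -[X in wt X _ _]addn0 -(mul0n n) (wtE hng) muln0 addn0.
  rewrite wr in le.
  have := T e (mon n 0%N 0%N + mon 0%N n 0%N) (r + n)%N r m.
  rewrite pbDl serD !pb_mon !muln0 !mulr0n !leq0n !subn0 /= !andbT !if_same subr0 sub0r.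
  have -> : (n.-1 <= r + n)%N by lia.
  have -> : (r + n - n.-1 = r.+1)%N by lia.
  have -> : (if (n.-1 <= r)%N then iota chi' (r + n).+1 (r - n.-1)%N m *+ ((r + n).+1 * n) else 0) = 0.
    case: leqP => // nr; rewrite off ?mul0rn //; first by apply/eqP; lia.
    have -> : ((r + n).+1 = r - n.-1 + 2 * n)%N by move: n3 nr; clear; lia.
    rewrite (wtE hng); apply: leq_trans le.
    have : (g * r.+1 = g * (r - n.-1) + g * n)%N by rewrite -mulnDr; congr (_ * _)%N; move: n3 nr; clear; lia.
    move: (gn_ge hng); rewrite mulnC; move: (g * n)%N (g * r.+1)%N (g * (r - n.-1))%N.
    by clear; lia.
  rewrite subr0 => h; have /eqP : iota chi' r.+1 r.+1 m *+ (r.+1 * n) = 0.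
    apply: h.
    - move=> p q k; rewrite !serD !monE addrC.
      rewrite [(p == 0%N) && _]andbC [(p == n) && _]andbC.
      have cb (x y : bool) : conjc (x%:R + y%:R : C) = x%:R + y%:R.
        by rewrite -natrD conjc_nat.
      by rewrite cb.
    - apply: filcD; move=> p q k; rewrite monE.
        have [->|] := eqVneq p n; last by rewrite eqxx.
        have [->|] := eqVneq q 0%N; last by rewrite eqxx.
        move=> _; split; first by rewrite /same_residue modnn mod0n.
        have := wtE hng 0 1 k; rewrite mul1n add0n muln0 muln1 add0n => ->.
        by rewrite leq_addr.
      have [->|] := eqVneq p 0%N; last by rewrite eqxx.
      have [->|] := eqVneq q n; last by rewrite eqxx.
      move=> _; split; first by rewrite /same_residue modnn mod0n.
      have := wtE hng 0 1 k; rewrite mul1n add0n muln0 muln1 add0n wtC => ->.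
      by rewrite leq_addr.
    - have := wtE hng r 1 m; rewrite mul1n muln1 => ->; move: le eu; rewrite mulnS.
      by move: (g * r)%N; clear; lia.
  rewrite mulrn_eq0 muln_eq0 /= => /orP[/eqP h0|/eqP //].
  by move: n3; rewrite h0.
suff H u : (e <= u)%N -> (u <= v.+1)%N -> Fil u chi' by apply: H => //; apply: ltnW.
elim: u => // u IH; rewrite leq_eqVlt => /orP[/eqP <- _ //|eu uv].
by apply: step => //; apply: IH => //; apply: ltnW.
Qed.

Lemma Exp_rot (c s : R) chi f : c ^+ 2 + s ^+ 2 = 1 -> fham chi -> rot_ser c s chi = chi ->
  rot_ser c s (Exp chi f) = Exp chi (rot_ser c s f).
Proof. by move=> cs fc h; rewrite (can_nat _ (can_rot cs) fc) h. Qed.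

(** Conjugating a flow by a rotation gives the flow of the rotated Hamiltonian, and a flow
    determines its Hamiltonian. *)
Lemma fham_inv (c s : R) chi : c ^+ 2 + s ^+ 2 = 1 -> fham chi ->
  (forall f, rot_ser c s (Exp chi f) = Exp chi (rot_ser c s f)) -> rot_ser c s chi = chi.
Proof.
move=> cs fc h; have cr := can_rot cs; have fr := can_fham cr fc.
have E : Exp (rot_ser c s chi) =1 Exp chi.
  move=> f; have rK := rotK cs f.
  by rewrite -{1}rK -(can_nat _ cr fc) h rK.
exact: (Exp_inj fr fc (E _) (E _)).
Qed.

(** The composition is canonical and tangent to the identity, hence has a logarithm; this replaces
    the Campbell-Hausdorff formula. *)
Lemma log_comp (c s : R) chi zeta : c ^+ 2 + s ^+ 2 = 1 ->
  fham chi -> fham zeta -> rot_ser c s chi = chi -> rot_ser c s zeta = zeta ->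
  exists2 chi', fham chi' & rot_ser c s chi' = chi' /\ forall f, Exp chi' f = Exp chi (Exp zeta f).
Proof.
move=> cs fc fz rc rz; have cc := can_comp (can_Exp fc) (can_Exp fz).
have near u : ordge 1 u -> ordge 2 (Exp chi (Exp zeta u) - u).
  move=> o1; have [_ oc] := fc; have [_ oz] := fz.
  have o1' : ordge 1 (Exp zeta u) by exact: (gh_ord (can_gh (can_Exp fz)) o1).
  have -> : Exp chi (Exp zeta u) - u = (Exp chi (Exp zeta u) - Exp zeta u) + (Exp zeta u - u) by ring.
  by apply: ordgeD; apply: Exp_near.
have [chi' fc' E] := can_log cc (near _ (@ordge_sX R)) (near _ (@ordge_sY R)).
have E' f : Exp chi' f = Exp chi (Exp zeta f) by rewrite -E.
exists chi' => //; split=> //; apply: fham_inv => // f.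
by rewrite !E' !Exp_rot.
Qed.

Lemma NFB (h k : ser C) : NF h -> NF k -> NF (h - k).
Proof.
move=> [h1 h2] [k1 k2]; split=> p q m; first by rewrite !serB h1 k1.
rewrite serB; have [->|/h2 //] := eqVneq (h p q m) 0.
by rewrite sub0r oppr_eq0 => /k2.
Qed.

Lemma Exp_diff_Fil v (chi H : ser R) : (e <= v)%N -> fham chi -> Fil v chi -> Fil e H ->
  Fil v.+2 (Exp chi H - H - ham_lie chi H).
Proof.
move=> ev fc Fc FH; have F0' : Fil e (0 : ser R) by exact: Fil0.
rewrite -{2}(Exp0 H) -{2}(subr0 chi).
have -> : v.+2 = (e + (v - g).+1)%N by move: ev; clear; lia.
apply: (Exp_perturb_Fil hng (fham0 R) fc F0' _ _ FH); first by apply: FilW Fc.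
by rewrite subr0 subnKC // ltnW.
Qed.

(** The induction keeps the exact identity H = exp(chi) H', with chi of growing weight. At each
    stage H - H' is then the first-order bracket up to two weights further on, which is the input of
    [kernel_split]. *)
Lemma uniq_ham (c s a b : R) chi H H' : c ^+ 2 + s ^+ 2 = 1 -> n.-primitive_root (Complex c s) ->
  lead H' a b -> NF (iota H) -> NF (iota H') -> fham chi -> Fil 0 chi -> H = Exp chi H' ->
  H = H'.
Proof.
move=> cs pr L nf nf' fc0 F0 E0; apply: (Fil_eq hng) => v.
suff : exists2 chi, fham chi /\ Fil (v + e) chi & H = Exp chi H'.
  case=> x [fx Fx] ->; apply: (FilW (v := v.+1)); first by [].
  have Fe : Fil e x by apply: FilW Fx; rewrite leq_addl.
  have A := Exp_diff_Fil (leq_addl _ _) fx Fx (ld_Fil L).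
  rewrite -[Exp x H' - H'](subrK (ham_lie x H')); apply: FilD; first by apply: FilW A; lia.
  by apply: (Fil_lie hng Fx (ld_Fil L)); lia.
elim: v => [|v [x [fx Fx] E]].
  by exists chi => //; split=> //; rewrite add0n; apply: (fham_Fil hng).
have ev : (e <= v + e)%N by rewrite leq_addl.
have A := Exp_diff_Fil ev fx Fx (ld_Fil L); rewrite -E in A.
have lC : ham_lie H' x = - ham_lie x H' by rewrite /ham_lie pbC.
have FD : Fil (v + e).+1 (H' - H).
  rewrite -opprB; apply: FilN; rewrite -[H - H'](subrK (ham_lie x H')); apply: FilD.
    by apply: FilW A.
  by apply: (Fil_lie hng Fx (ld_Fil L)); lia.
have nD : NF (iota (H' - H)) by rewrite (ghB (iota_gh R)); apply: NFB.
have F2 : Fil (v + e).+2 (H' - H - ham_lie H' x).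
  have -> : H' - H - ham_lie H' x = - (H - H' - ham_lie x H') by rewrite lC; ring.
  exact: FilN.
have [_ [zeta [fz lz] [Fz Fd]]] := kernel_split hng L ev fx Fx FD nD F2.
have Fx0 := (FilW (leq0n _) Fx); have Fz0 := (FilW (leq0n _) Fz).
have rx : rot_ser c s x = x by apply/(Fil0_rot _ cs pr).
have rz : rot_ser c s (- zeta) = - zeta.
  apply/(Fil0_rot _ cs pr); exact: FilN.
have [x' fx' [rx' Ex']] := log_comp cs fx (fhamN fz) rx rz.
exists x'; last first.
  rewrite Ex' [Exp (- zeta) H']Exp_const // /ham_lie pbNr.
  by move: lz; rewrite /ham_lie pbC => /eqP; rewrite oppr_eq0 => /eqP ->; rewrite oppr0.
split=> //; rewrite addSn; apply: (center_lemma ev fx fz fx' Fx Fz Fd _ Ex').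
by apply/(Fil0_rot _ cs pr).
Qed.
End Uniqueness.

(** * Existence of the normal form *)

Section Existence.
Variable R : rcfType.
Variables (n g : nat).
Hypothesis hng : ((g == 1%N) && (4 <= n)%N) || ((g == 2%N) && (n == 3%N)).
Local Notation e := g.+1.
Local Notation C := R[i].
Local Notation iota := (@zcoords R).
Local Notation wt := (weight n g).
Local Notation Fil := (Filt n g).
Local Notation lead := (leading n g).
Local Notation NF := (@normal_form R n g).

Lemma NF_fham (N : ser R) : NF (iota N) -> Fil e N -> fham N.
Proof.
move=> [_ nf] F; have n3 := n_ge3 hng; apply: fham_iota => p q m nz.
have [_ w] := F _ _ _ nz.
have [[epq p0 _]|[ep _]|[eq _]] := nf _ _ _ nz; [subst q|by split; lia..].
split; first by lia.
case: m w {nz} => [|m] w; last by lia.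
case: p p0 w => // -[|p] _ w; last by lia.
by have := wtE hng 1 0 0; rewrite mul0n addn0 => h; rewrite h in w; lia.
Qed.

Lemma lead_NF (H : ser R) a b : lead H a b -> exists2 N, NF (iota N) & Fil e N /\ Fil e.+1 (H - N).
Proof.
move=> L; have n3 := n_ge3 hng; have gg := g_gt0 hng.
have sym p q m : lead_part n g a b p q m = lead_part n g a b q p m.
  rewrite !lead_partE [RHS]addrC [in RHS]addrC; congr (_ + _).
    by rewrite [(q == 2%N) && _]andbC.
  by rewrite addrC [(q == n) && _]andbC [(q == 0%N) && _]andbC.
have cs : csym (lead_part n g a b).
  move=> p q m; rewrite -sym lead_partE.
  by do 3?[case: ifP => _]; rewrite ?addr0 ?add0r -?(rmorphD (real_complex R)) ?conjc_real ?conjc0.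
have [N EN] := iota_surj cs; exists N.
  rewrite EN; split=> // p q m; rewrite lead_partE.
  have [/andP[/eqP g1 /andP[/andP[/eqP -> /eqP ->] _]]|_] := boolP (_ && (_ && (m == 0%N))).
    by move=> _; apply: Or31; split=> //; rewrite /okA g1 eqxx.
  have okB0 : okB g 0 by rewrite /okB muln1 gtnNdvd.
  have [/andP[/andP[/eqP -> /eqP ->] _]|_] := boolP ((p == n) && _ && _).
    by move=> _; apply: Or32.
  have [/andP[/andP[/eqP -> /eqP ->] _]|_] := boolP (_ && _ && _).
    by move=> _; apply: Or33.
  by rewrite !addr0 eqxx.
have F2 : Fil e.+1 (H - N).
  by rewrite /Filt (ghB (iota_gh R)) EN; apply: lead_diff.
split=> //; have -> : N = H - (H - N) by ring.
by apply: FilB; [exact: ld_Fil L|apply: FilW F2].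
Qed.

Lemma NFD (h k : ser C) : NF h -> NF k -> NF (h + k).
Proof.
move=> [h1 h2] [k1 k2]; split=> p q m; first by rewrite !serD h1 k1.
rewrite serD; have [->|/h2 //] := eqVneq (h p q m) 0.
by rewrite add0r => /k2.
Qed.

Lemma iota_near (f h : ser R) N p q m : ordge N (f - h) -> (p + q + m < N)%N ->
  iota f p q m = iota h p q m.
Proof.
move=> o lt; apply/eqP; rewrite -subr_eq0 -serB -(ghB (iota_gh R)).
by rewrite (gh_ord (iota_gh R) o).
Qed.

Lemma Fil_lim v (f : ser R) : (forall N, exists2 h, Fil v h & ordge N (f - h)) -> Fil v f.
Proof.
move=> H p q m; have [h Fh o] := H (p + q + m).+1.
by rewrite (iota_near o (ltnSn _)) => /Fh.
Qed.

Lemma NF_lim (f : ser R) : (forall N, exists2 h, NF (iota h) & ordge N (f - h)) -> NF (iota f).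
Proof.
move=> H; split=> p q m; have [h [h1 h2] o] := H (p + q + m).+1.
  have lt : (q + p + m < (p + q + m).+1)%N by rewrite (addnC q).
  by rewrite (iota_near o (ltnSn _)) (iota_near o lt); apply: h1.
by rewrite (iota_near o (ltnSn _)) => /h2.
Qed.

Lemma exist_ham (H : ser R) a b : lead H a b ->
  exists chi, [/\ fham chi, Fil e chi, NF (iota (Exp chi H)) & lead (Exp chi H) a b].
Proof.
move=> L; have gg := g_gt0 hng; have fH := ld_fham L.
pose P w chi := exists N, [/\ fham chi, Fil e chi, NF (iota N), Fil e N & Fil w.+1 (Exp chi H - N)].
have step (x : nat * ser R) : exists chi', (e <= x.1)%N -> P x.1 x.2 ->
    P x.1.+1 chi' /\ Fil x.1 (chi' - x.2).
  case: x => w chi /=; have [[ew [N [fc Fc nfN FN Ft]]]|h] := pselect ((e <= w)%N /\ P w chi); last first.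
    by exists chi => ew Pw; case: h.
  have fN := NF_fham nfN FN.
  have ft : fham (Exp chi H - N).
    by apply: fhamD; [exact: (can_fham (can_Exp fc) fH)|exact: fhamN].
  have [psi [N' [fp Fp FN' nfN' F2]]] := hom_step hng L (ew : (e < w.+1)%N) ft Ft.
  (* Subtracting psi from the generator changes the transformed H by [ham_lie H psi] up to higher
     weight, the correction provided by [hom_step]. *)
  exists (chi - psi) => _ _; split; last first.
    have -> : chi - psi - chi = - psi by ring.
    exact: FilN Fp.
  have fc' : fham (chi - psi) by apply: fhamD => //; apply: fhamN.
  have Fc' : Fil e (chi - psi) by apply: FilB => //; apply: FilW Fp.
  exists (N + N'); split=> //.
  - by rewrite (ghD (iota_gh R)); apply: NFD.
  - by apply: FilD => //; apply: FilW FN'; lia.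
  have A : Fil (e + (w - g).+1) (Exp (chi - psi) H - Exp chi H - ham_lie (chi - psi - chi) H).
    apply: (Exp_perturb_Fil hng fc fc' Fc Fc' _ (ld_Fil L)).
    have -> : chi - psi - chi = - psi by ring.
    by rewrite subnKC; [apply: FilN|apply: ltnW].
  have -> : Exp (chi - psi) H - (N + N') = (Exp (chi - psi) H - Exp chi H - ham_lie (chi - psi - chi) H)
     + (Exp chi H - N - N' + ham_lie H psi).
    have -> : chi - psi - chi = - psi by ring.
    by rewrite /ham_lie pbNr -pbC; ring.
  by apply: FilD => //; apply: FilW A; move: ew; clear; lia.
have [F HF] := choice step.
pose u := fix u k := if k is k'.+1 then F ((e + k')%N, u k') else 0 : ser R.
have Pu k : P (e + k)%N (u k) /\ forall k', k = k'.+1 -> Fil (e + k')%N (u k - u k').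
  elim: k => [|k [IH _]]; last first.
    have := HF ((e + k)%N, u k) (leq_addr _ _) IH; rewrite -addnS => -[h1 h2].
    by split=> // k' [<-].
  split=> //; have [N nf [FN Fd]] := lead_NF L; exists N; split=> //.
  - exact: fham0.
  - exact: Fil0.
  - by rewrite Exp0 addn0.
(* Two weights are needed per degree: [c k] is final in the degrees up to k. *)
pose c k := u (2 * k)%N.
have dc k : ordge k.+1 (c k.+1 - c k).
  have [_ /(_ _ erefl) h1] := Pu (2 * k).+2; have [_ /(_ _ erefl) h2] := Pu (2 * k).+1.
  have -> : c k.+1 - c k = (u (2 * k).+2 - u (2 * k).+1) + (u (2 * k).+1 - u (2 * k)%N).
    by rewrite /c mulnS; ring.
  apply: (Fil_ord hng (v := (e + 2 * k)%N)); last by lia.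
  by apply: FilD => //; apply: FilW h1; lia.
pose chi : ser R := fun i j k => c (i + j + k)%N i j k.
have near N : ordge N.+1 (chi - c N).
  move=> i j k l; rewrite serB /chi -serB -opprB serN.
  rewrite (@seq_diff_ord R c (i + j + k) N) ?oppr0 // => m mN.
  by apply: ordgeW (dc m).
have fchi : fham chi.
  split=> i j k h; have [[N [[xc oc] _ _ _ _]] _] := Pu (2 * (i + j + k))%N.
    exact: (xc _ _ _ h).
  exact: (oc _ _ _ h).
have Fchi : Fil e chi.
  apply: Fil_lim => N; exists (c N); last by apply: ordgeW (near N).
  by have [[? []]] := Pu (2 * N)%N.
have nf : NF (iota (Exp chi H)).
  apply: NF_lim => N; have [[N' [fc Fc nfN FN Ft]] _] := Pu (2 * N.+2)%N.
  exists N' => //; have -> : Exp chi H - N' = (Exp chi H - Exp (c N.+2) H) + (Exp (c N.+2) H - N') by ring.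
  apply: ordgeD; last by apply: (Fil_ord hng Ft); lia.
  apply: Exp_cong; [by case: fc|by case: fchi|].
  by apply: ordgeW (near N.+2).
exists chi; split=> //.
have Fd := Exp_Fil hng fchi Fchi (ld_Fil L).
have eqc p q m : (wt p q m < e.+1)%N -> iota (Exp chi H) p q m = iota H p q m.
  move=> lt; apply/eqP; rewrite -subr_eq0 -serB -(ghB (iota_gh R)).
  by rewrite (filc_0 Fd) // lt orbT.
have n3 := n_ge3 hng; case: (L) => _ FH Ha Hb b0; split=> //.
- exact: (can_fham (can_Exp fchi) fH).
- by rewrite -[Exp chi H](subrK H); apply: FilD => //; apply: FilW Fd.
- move=> g1; rewrite eqc; first exact: Ha.
  by have := wtE hng 2 0 0; rewrite mul0n addn0 => ->; rewrite g1.
- by rewrite eqc //; have := wtE hng 0 1 0; rewrite add0n mul1n => ->; lia.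
Qed.
End Existence.

(** * Conjugacies between time-one maps *)

Section Conjugacy.
Variable R : rcfType.
Local Notation C := R[i].
Local Notation cR := (real_complex R).
Local Notation iota := (@zcoords R).

Record iso (phi : ser R -> ser R) : Prop := Iso {
  iso_can : can phi;
  iso_inv : exists2 psi, can psi & cancel phi psi /\ cancel psi phi }.

Lemma iso_comp phi psi : iso phi -> iso psi -> iso (phi \o psi).
Proof.
move=> [c [c' cc' [k1 k2]]] [d [d' dd' [l1 l2]]]; split; first exact: can_comp.
exists (d' \o c'); first exact: can_comp.
by split=> u /=; [rewrite k1 l1 | rewrite l2 k2].
Qed.

Lemma iso_Exp H : fham H -> iso (Exp H).
Proof.
move=> fH; split; first exact: can_Exp.
exists (Exp (- H)); first by apply: can_Exp; apply: fhamN.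
by case: fH => _ o; split=> u; rewrite ?ExpK ?ExpNK.
Qed.

Lemma iso_rot (c s : R) : c ^+ 2 + s ^+ 2 = 1 -> iso (rot_ser c s).
Proof.
move=> cs; have cs' : c ^+ 2 + (- s) ^+ 2 = 1 by rewrite sqrrN.
split; first exact: can_rot.
exists (rot_ser c (- s)); first exact: can_rot.
by split=> u; [have := rotK cs' u; rewrite opprK | rewrite rotK].
Qed.

(** By naturality of flows, composing the conjugacy with exp(- chi) replaces H by exp(chi) H; the
    rotation is untouched since it commutes with exp(- chi). *)
Lemma Exp_rot_conj phi (rho f : ser R -> ser R) chi H : fham chi -> fham H ->
  (forall u, rho (Exp (- chi) u) = Exp (- chi) (rho u)) ->
  (forall u, f (phi u) = phi (Exp H (rho u))) ->
  forall u, f (phi (Exp (- chi) u)) = phi (Exp (- chi) (Exp (Exp chi H) (rho u))).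
Proof.
move=> fc fH rc E u; rewrite E rc; congr phi.
have fc' := can_Exp (fhamN fc); have [_ oc] := fc.
by rewrite (can_nat _ fc' (can_fham (can_Exp fc) fH)) ExpK.
Qed.

Section Rotation.
Variables (n : nat) (c s : R).
Hypotheses (cs : c ^+ 2 + s ^+ 2 = 1) (pr : n.-primitive_root (Complex c s)).
Local Notation rho := (rot_ser c s).

Lemma iter_rot u : iter n rho u = u.
Proof.
pose z := Complex c s; pose zb := Complex c (- s).
have zz : z * zb = 1.
  by apply/eqP; rewrite eq_complex /= -cs; apply/andP; split; apply/eqP; ring.
have E k p q m : iota (iter k rho u) p q m = iota u p q m * (z ^+ p * zb ^+ q) ^+ k.
  elim: k => [|k IH]; first by rewrite expr0 mulr1.
  by rewrite iterS iota_rot IH exprSr mulrA.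
apply: iota_inj; apply: ser_ext => p q m; rewrite E exprMn -!exprM mulnC (mulnC q) !exprM.
have zn := prim_expr_order pr; have zbn : zb ^+ n = 1.
  by rewrite -[LHS]mul1r -zn -exprMn zz expr1n.
by rewrite zn zbn !expr1n !mulr1.
Qed.

(* rho^n = 1 and rho commutes with exp(H), so the n-th power of exp(H) rho is
   exp(n H). *)
Lemma conj_same phi phi' f H H' : iso phi -> iso phi' -> fham H -> fham H' ->
  rho H = H -> rho H' = H' ->
  (forall u, f (phi u) = phi (Exp H (rho u))) ->
  (forall u, f (phi' u) = phi' (Exp H' (rho u))) ->
  exists2 psi, can psi & H = psi H' /\ forall u, rho (psi u) = psi (rho u).
Proof.
move=> [cp [p1 cp1 [pK Kp]]] [cp' [p1' cp1' [pK' Kp']]] fH fH' rH rH' E E'.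
have n0 := prim_order_gt0 pr.
pose psi := p1 \o phi'; have cpsi : can psi by apply: can_comp.
pose psi1 := p1' \o phi.
have K1 u : psi (psi1 u) = u by rewrite /psi /psi1 /= Kp' pK.
have c1 : can psi1 by apply: can_comp.
have K2 u : psi1 (psi u) = u by rewrite /psi /psi1 /= Kp pK'.
have com u : Exp H (rho (psi u)) = psi (Exp H' (rho u)).
  by rewrite /psi /= -E' -{2}[phi' u]Kp E pK.
have pow h k u : fham h -> rho h = h ->
    iter k (fun u => Exp h (rho u)) u = Exp (sC k%:R * h) (iter k rho u).
  move=> fh rh; have [_ oh] := fh; rewrite -iter_Exp //.
  have R1 j v : rho (iter j (Exp h) v) = iter j (Exp h) (rho v).
    by elim: j => // j IH; rewrite !iterS Exp_rot // IH.
  by elim: k => // k IH; rewrite iterS IH R1 -iterS.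
have comk k u : iter k (fun u => Exp H (rho u)) (psi u) =
    psi (iter k (fun u => Exp H' (rho u)) u).
  by elim: k => // k IH; rewrite !iterS IH com.
have En v : Exp (sC n%:R * H) v = Exp (psi (sC n%:R * H')) v.
  have fn' : fham (sC n%:R * H') by apply: fham_CM.
  rewrite -(K1 v) -(can_nat _ cpsi fn').
  by have := comk n (psi1 v); rewrite !pow // !iter_rot.
have EH : H = psi H'.
  have := Exp_inj (fham_CM _ fH) (can_fham cpsi (fham_CM n%:R fH')) (En _) (En _).
  rewrite (ghM (can_gh cpsi)) (can_C cpsi) => /(congr1 (fun u => sC (n%:R^-1) * u)).
  by rewrite /= !mulrA -!sC_M mulVf ?pnatr_eq0 -?lt0n // sC1 !mul1r.
exists psi => //; split=> // u; have := com u; rewrite (can_nat _ cpsi fH') -EH.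
by move=> e0; have [_ oH] := fH; rewrite -[LHS](ExpK _ oH) e0 ExpK.
Qed.

Lemma ord1 (h : ser R) : xyge 1 h ->
  ordge 2 (h - (sC (h 1%N 0%N 0%N) * sX + sC (h 0%N 1%N 0%N) * sY)).
Proof.
move=> x [|[|i]] [|[|j]] [|[|k]] //=; rewrite serB serD !sCM sXE sYE /=
  ?mulr1 ?mulr0 ?addr0 ?add0r ?subrr ?subr0 // => _; exact: x.
Qed.

(* Commuting with a rotation of angle other than 0 and pi forces the linear part
   at eps = 0 to be a rotation. *)
Lemma comm_linear psi : s != 0 -> can psi -> (forall u, rho (psi u) = psi (rho u)) ->
  exists c0 s0 chi, [/\ c0 ^+ 2 + s0 ^+ 2 = 1, fham chi, rho chi = chi &
    forall u, psi u = Exp chi (rot_ser c0 s0 u)].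
Proof.
move=> s0 cp com.
have [gh gC gX gY gE] := rotP c s.
pose p := psi sX 1%N 0%N 0%N; pose q := psi sX 0%N 1%N 0%N.
pose r := psi sY 1%N 0%N 0%N; pose t := psi sY 0%N 1%N 0%N.
have oX := ord1 (can_X cp); have oY := ord1 (can_Y cp).
have ro u : xyge 1 u -> rho u 1%N 0%N 0%N = c * u 1%N 0%N 0%N + s * u 0%N 1%N 0%N /\
    rho u 0%N 1%N 0%N = - s * u 1%N 0%N 0%N + c * u 0%N 1%N 0%N.
  move=> /ord1 o; have := gh_ord gh o; rewrite (ghB gh) (ghD gh) !(ghM gh) !gC gX gY.
  move=> o'; have h1 := o' 1%N 0%N 0%N isT; have h2 := o' 0%N 1%N 0%N isT.
  move: h1 h2; rewrite !serB !serD !sCM /rotX /rotY !serB !serD !sCM !sXE !sYE /=.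
  by move=> /eqP h1 /eqP h2; move: h1 h2; rewrite !subr_eq0 => /eqP -> /eqP ->; split; ring.
have [x1 x2] := ro _ (can_X cp).
have := com sX; rewrite gX /rotX (ghB (can_gh cp)) !(ghM (can_gh cp)) !(can_C cp) => EX.
move: x1 x2; rewrite EX !serB !sCM -/p -/q -/r -/t => h1 h2.
have rq : r = - q.
  by apply: (mulfI s0); rewrite mulrN; apply/eqP; rewrite -subr_eq0; apply/eqP; lra.
have tp : t = p.
  by apply: (mulfI s0); apply/eqP; rewrite -subr_eq0; apply/eqP; lra.
have j1 : p ^+ 2 + q ^+ 2 = 1.
  have : pb (psi sX) (psi sY) 0%N 0%N 0%N = 1 by rewrite (can_jac cp) ser1E.
  rewrite /pb serB !serM !big_ord1 /dx /dy /= !mulr1n => <-.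
  by rewrite -/p -/q -/r -/t rq tp; ring.
have k1 : sC p * sC p + sC q * sC q = 1 :> ser R.
  by rewrite -!sC_M -sC_D -!expr2 j1 sC1.
have cs' : p ^+ 2 + (- q) ^+ 2 = 1 by rewrite sqrrN.
have csV : p ^+ 2 + q ^+ 2 = 1 by [].
have cf := can_comp cp (can_rot csV).
have [gh' gC' gX' gY' gE'] := rotP p q.
have [chi fc E] : exists2 chi, fham chi & psi \o rot_ser p q =1 Exp chi.
  apply: can_log => //=.
    rewrite gX' /rotX (ghB (can_gh cp)) !(ghM (can_gh cp)) !(can_C cp).
    rewrite [X in X - sX](_ : _ = sX + (sC p * (psi sX - (sC p * sX + sC q * sY)) -
      sC q * (psi sY - (sC r * sX + sC t * sY)))).
      by rewrite addrC addKr; apply: ordgeB; apply: ordge_CM.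
    rewrite rq tp sC_N; apply/esym.
    transitivity (sC p * psi sX - sC q * psi sY + (1 - (sC p * sC p + sC q * sC q)) * sX); first ring.
    by rewrite k1 subrr mul0r addr0.
  rewrite gY' /rotY (ghD (can_gh cp)) !(ghM (can_gh cp)) !(can_C cp).
  rewrite [X in X - sY](_ : _ = sY + (sC q * (psi sX - (sC p * sX + sC q * sY)) +
      sC p * (psi sY - (sC r * sX + sC t * sY)))).
    by rewrite addrC addKr; apply: ordgeD; apply: ordge_CM.
  rewrite rq tp sC_N; apply/esym.
  transitivity (sC q * psi sX + sC p * psi sY + (1 - (sC p * sC p + sC q * sC q)) * sY); first ring.
  by rewrite k1 subrr mul0r addr0.
exists p, (- q), chi; split=> //.
  apply: (fham_inv cs fc) => u; rewrite -!E /= com; congr psi; exact: rot_comm.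
by move=> u; rewrite -E /= rotK.
Qed.
End Rotation.
End Conjugacy.

(** * Existence and uniqueness up to canonical conjugacy *)

Section NormalForm.
Variable R : rcfType.
Variables (n g : nat) (c s : R).
Hypothesis hng : ((g == 1%N) && (4 <= n)%N) || ((g == 2%N) && (n == 3%N)).
Hypotheses (cs : c ^+ 2 + s ^+ 2 = 1) (pr : n.-primitive_root (Complex c s)) (s0 : s != 0).
Local Notation e := g.+1.
Local Notation C := R[i].
Local Notation cR := (real_complex R).
Local Notation iota := (@zcoords R).
Local Notation Fil := (Filt n g).
Local Notation lead := (leading n g).
Local Notation NF := (@normal_form R n g).
Local Notation rho := (rot_ser c s).

Lemma NF_Fil0 H : NF (iota H) -> Fil 0 H.
Proof.
move=> [_ nf] p q m /nf h; split=> //; rewrite /same_residue.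
by case: h => [[-> _ _]|[-> _]|[-> _]]; rewrite ?modnDr.
Qed.

Lemma cR_inj : injective cR.
Proof. by move=> x y []. Qed.

(** The change from H' to H is a rotation combined with an invariant flow. The flow does not alter
    the coefficient of z^n, so both coefficients being positive makes the rotation number an n-th
    root of unity; then the rotation preserves H' and only the flow remains. *)
Lemma uniq_conj phi phi' f H H' a b b1 : iso phi -> iso phi' -> fham H -> lead H' a b ->
  0 < b -> 0 < b1 -> iota H n 0%N 0%N = cR b1 -> NF (iota H) -> NF (iota H') ->
  (forall u, f (phi u) = phi (Exp H (rho u))) ->
  (forall u, f (phi' u) = phi' (Exp H' (rho u))) -> H = H'.
Proof.
move=> ip ip' fH L b0 b10 Hb nf nf' E E'.
have fH' := ld_fham L; have F0 := NF_Fil0 nf; have F0' := NF_Fil0 nf'.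
have rH : rho H = H by apply/(Fil0_rot g _ cs pr).
have rH' : rho H' = H' by apply/(Fil0_rot g _ cs pr).
have [psi cp [EH com]] := conj_same cs pr ip ip' fH fH' rH rH' E E'.
have [c0 [s1 [chi [cs1 fc rc Ep]]]] := comm_linear cs s0 cp com.
have F0c : Fil 0 chi by apply/(Fil0_rot g _ cs pr).
have Fc := fham_Fil hng fc F0c.
rewrite Ep in EH; set H1 := rot_ser c0 s1 H' in EH.
have FH1 : Fil e H1.
  move=> p q m; rewrite iota_rot mulf_eq0 negb_or => /andP[nz _].
  exact: (ld_Fil L).
have Fd := Exp_Fil hng fc Fc FH1; rewrite -EH in Fd.
pose z := Complex c0 s1; have zz : z * conjc z = 1.
  by apply/eqP; rewrite eq_complex /= -cs1; apply/andP; split; apply/eqP; ring.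
have bz : cR b1 = cR b * z ^+ n.
  rewrite -Hb -(ld_b L); apply/eqP; rewrite -subr_eq0; apply/eqP.
  have := filc_0 Fd (p := n) (q := 0%N) (m := 0%N).
  rewrite (ghB (iota_gh R)) serB iota_rot mulr1; apply.
  by have := wtE hng 0 1 0; rewrite add0n mul1n => ->; apply/orP; right; rewrite muln0 muln1 addn0.
have zn : z ^+ n = 1.
  have : cR b1 * conjc (cR b1) = cR b * conjc (cR b).
    rewrite bz (rmorphM (@conjc R)) mulrACA (rmorphXn (@conjc R)) -exprMn zz expr1n mulr1 //.
  rewrite !conjc_real -!cRM => /cR_inj /eqP; rewrite -!expr2 eqrXn2 // ?ltW // => /eqP eb.
  apply: (mulfI (x := cR b)); last by rewrite -bz eb mulr1.
  by apply: contraTneq b0 => /cR_inj ->; rewrite ltxx.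
have EH1 : H1 = H'.
  apply: iota_inj; apply: ser_ext => p q m; rewrite iota_rot.
  have [->|nz] := eqVneq (iota H' p q m) 0; first by rewrite mul0r.
  have [r _] := F0' _ _ _ nz.
  have -> : Complex c0 (- s1) = conjc z by [].
  have [x [j [[-> ->]|[-> ->]]]] := resP r; rewrite -/z exprD mulnC exprM.
    by rewrite zn expr1n mulr1 -exprMn zz expr1n mulr1.
  have zc : conjc z ^+ n = 1 by rewrite -(rmorphXn (@conjc R)) zn; exact: (rmorph1 (@conjc R)).
  by rewrite zc expr1n mulr1 -exprMn zz expr1n mulr1.
rewrite EH1 in EH; exact: (uniq_ham hng cs pr L nf nf' fc F0c EH).
Qed.

Lemma exist_conj phi f H a b : iso phi -> lead H a b ->
  (forall u, f (phi u) = phi (Exp H (rho u))) ->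
  exists phi' H' a' b', [/\ iso phi', lead H' a' b', 0 < b', NF (iota H') &
    forall u, f (phi' u) = phi' (Exp H' (rho u))].
Proof.
move=> ip L E; have n3 := n_ge3 hng.
have [phi1 [H1 [b1 [ip1 L1 b10 E1]]]] : exists phi1 H1 b1,
    [/\ iso phi1, lead H1 a b1, 0 < b1 & forall u, f (phi1 u) = phi1 (Exp H1 (rho u))].
  have [bp|bn|b0] := ltgtP b 0; last by have := ld_b0 L; rewrite b0 eqxx.
    (* A rotation by an n-th root of -1 reverses the sign of the coefficient of z^n, fixes that of
       (z zb)^2 and commutes with [rho]. *)
    have [c1 [s1 [cs1 zn]]] : exists c1 s1 : R, c1 ^+ 2 + s1 ^+ 2 = 1 /\ Complex c1 s1 ^+ n = - 1.
      have n0 : (0 < n)%N by apply: leq_trans n3.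
      pose z : C := n.-root (-1); have zn : z ^+ n = - 1 by apply: rootCK.
      have : (z * conjc z) ^+ n = 1.
        by rewrite exprMn -(rmorphXn (@conjc R)) zn (rmorphN (@conjc R)) (rmorph1 (@conjc R)) mulrNN mulr1.
      case Ez : z zn => [c1 s1] zn; have -> : Complex c1 s1 * conjc (Complex c1 s1) = cR (c1 ^+ 2 + s1 ^+ 2).
        by apply/eqP; rewrite eq_complex /=; apply/andP; split; apply/eqP; ring.
      rewrite -(rmorphXn (real_complex R)) => /cR_inj /eqP.
      rewrite pexpr_eq1 // ?addr_ge0 ?sqr_ge0 // => /eqP h.
      by exists c1, s1.
    have cs1' : c1 ^+ 2 + (- s1) ^+ 2 = 1 by rewrite sqrrN.
    exists (phi \o rot_ser c1 (- s1)), (rot_ser c1 s1 H), (- b); split.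
    - exact: iso_comp ip (iso_rot cs1').
    - case: (L) => fH FH Ha Hb b0; split.
      + exact: can_fham (can_rot cs1) fH.
      + by move=> p q m; rewrite iota_rot mulf_eq0 negb_or => /andP[/FH].
      + move=> g1; have [h1 h2] := Ha g1; rewrite iota_rot h1; split=> //.
        have zz : Complex c1 s1 * Complex c1 (- s1) = 1.
          by apply/eqP; rewrite eq_complex /= -cs1; apply/andP; split; apply/eqP; ring.
        by rewrite -exprMn zz expr1n mulr1.
      + by rewrite iota_rot Hb zn expr0 mulr1 mulrN1 -(rmorphN (real_complex R)).
      + by rewrite oppr_eq0.
    - by rewrite oppr_gt0.
    - move=> u /=; rewrite E; congr phi; rewrite (rot_comm c s).
      have rK v : rot_ser c1 (- s1) (rot_ser c1 s1 v) = v by have := rotK cs1' v; rewrite opprK.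
      by rewrite (can_nat _ (can_rot cs1') (can_fham (can_rot cs1) (ld_fham L))) rK.
  by exists phi, H, b.
have [chi [fc Fc nf LN]] := exist_ham hng L1.
exists (phi1 \o Exp (- chi)), (Exp chi H1), a, b1; split=> //.
  by apply: iso_comp ip1 _; apply: iso_Exp; apply: fhamN.
apply: Exp_rot_conj => //; first exact: ld_fham L1.
move=> u; apply: Exp_rot => //; first exact: fhamN.
by apply/(Fil0_rot g _ cs pr); apply: FilN; apply: FilW Fc.
Qed.
End NormalForm.

(** * Formal maps as substitution operators *)

Section Bridge.
Variable R : realType.
Implicit Types f h : ser R.
Implicit Types F G T : formal_map R.

Lemma faddE f h : fadd f h = f + h.
Proof. by apply: ser_ext => i j k; rewrite serD. Qed.
Lemma fsubE f h : fsub f h = f - h.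
Proof. by apply: ser_ext => i j k; rewrite serB. Qed.
Lemma fscaleE c f : fscale c f = sC c * f.
Proof. by apply: ser_ext => i j k; rewrite sCM. Qed.
Lemma fmulE f h : fmul f h = f * h.
Proof. by apply: ser_ext => i j k; rewrite serM. Qed.
Lemma foneE : fone R = (1 : ser R).
Proof. by apply: ser_ext => i j k; rewrite ser1E. Qed.
Lemma fzeroE : fzero R = (0 : ser R).
Proof. by apply: ser_ext => i j k; rewrite ser0. Qed.
Lemma fxE : fx R = (sX : ser R).
Proof. by apply: ser_ext => i j k; rewrite sXE. Qed.
Lemma fyE : fy R = (sY : ser R).
Proof. by apply: ser_ext => i j k; rewrite sYE. Qed.
Lemma fpowE f m : fpow f m = f ^+ m.
Proof.
rewrite /fpow; elim: m => [|m IH]; first by rewrite expr0 foneE.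
by rewrite iterS IH fmulE exprS.
Qed.
Lemma fdxE f : fdx f = dx f.
Proof. by apply: ser_ext => i j k; rewrite /dx /fdx mulr_natl. Qed.
Lemma fdyE f : fdy f = dy f.
Proof. by apply: ser_ext => i j k; rewrite /dy /fdy mulr_natl. Qed.
Lemma flieE H f : Defs.lie H f = ham_lie H f.
Proof. by rewrite /Defs.lie fsubE !fmulE !fdxE !fdyE. Qed.
Lemma fjacE G : fjac G = pb G.1 G.2.
Proof. by rewrite /fjac fsubE !fmulE !fdxE !fdyE. Qed.

Lemma fexp_lieE H f : fexp_lie H f = Exp H f.
Proof.
apply: ser_ext => i j k; rewrite /fexp_lie /Exp /tsum.
apply: eq_bigr => l _; rewrite /Fam sCM; congr (_ * _).
have -> : iter l (Defs.lie H) f = iter l (ham_lie H) f by elim: (nat_of_ord l) => // m IH; rewrite !iterS IH flieE.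
by [].
Qed.

Lemma formal_hamiltonianE (H : ser R) : formal_hamiltonian H <-> fham H.
Proof.
split=> [h|[x o] i j k /orP[]]; [split=> i j k l; apply: h; rewrite l ?orbT // |exact: x|exact: o].
Qed.

Lemma vanishesE G : vanishes_at_origin G <-> xyge 1 G.1 /\ xyge 1 G.2.
Proof.
split=> [h|[h1 h2] k]; last by split; [apply: h1|apply: h2].
by split=> -[|i] [|j] k // _; case: (h k).
Qed.

Definition subst_map (G : formal_map R) : ser R -> ser R := gsub id (G.1 : ser R) (G.2 : ser R) sE.

Lemma subP G : xyge 1 G.1 -> xyge 1 G.2 -> [/\ ghom (subst_map G), forall x, subst_map G (sC x) = sC x,
  subst_map G sX = G.1, subst_map G sY = G.2 & subst_map G sE = sE].
Proof.
have ord f : xyge 1 f -> ordge 1 f.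
  by move=> x i j k l; apply: x; move: l; clear; lia.
move=> /ord o1 /ord o2.
exact: (gsubP (rhom_id R) o1 o2 (@ordge_sE R)).
Qed.

(** Since G vanishes at (x, y) = 0, powers whose exponents exceed i + j do not reach the coefficient
    (i, j), and the finite sums are complete. *)
Lemma fsubstE f G : xyge 1 G.1 -> xyge 1 G.2 -> fsubst f G = subst_map G f.
Proof.
move=> x1 x2; have [gh gC gX gY gE] := subP x1 x2.
apply: ser_ext => i j k.
pose N := (i + j + k).+1.
have z a b l : (i + j < a + b)%N -> ((G.1 : ser R) ^+ a * (G.2 : ser R) ^+ b) i j l = 0.
  move=> lt; apply: (xygeM (xygeX (n := a) x1) (xygeX (n := b) x2)).
  by rewrite !muln1.
have -> : subst_map G f i j k = subst_map G
  (\sum_(a < N) \sum_(c < N) \sum_(d < N) sC (f a c d) * mon a c d) i j k.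
  apply: (ordge_eq_coef (N := N)); last by [].
  by rewrite -(ghB gh); apply: (gh_ord gh); apply: ser_expansion.
have tr (F : nat -> R) M : (M <= N)%N -> (forall a, (M <= a)%N -> F a = 0) ->
    \sum_(a < N) F a = \sum_(a < M) F a.
  move=> le F0; rewrite [RHS](big_ord_widen _ F le) [RHS]big_mkcond /=; apply: eq_bigr => a _.
  by case: ltnP => // /F0.
have cf a c d : subst_map G (sC (f a c d) * mon a c d) i j k =
   if (d <= k)%N then f a c d * ((G.1 : ser R) ^+ a * (G.2 : ser R) ^+ c) i j (k - d)%N else 0.
  rewrite (ghM gh) gC sCM /mon !(ghM gh) !(gh_exp gh) gX gY gE mulrA [_ * sE ^+ d]mulrC sEnM.
  by case: ifP => // _; rewrite mulr0.
rewrite (gh_sum gh) ser_sum /fsubst -(tr (fun a => \sum_(b < (i + j).+1) \sum_(c < k.+1)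
  f a b c * fmul (fpow G.1 a) (fpow G.2 b) i j (k - c)%N) (i + j).+1); last 2 first.
- by rewrite /N ltnS leq_addr.
- move=> a la; rewrite big1 // => b _; rewrite big1 // => c _.
  by rewrite fmulE !fpowE z ?mulr0 // (leq_trans la) ?leq_addr.
apply: eq_bigr => a _; rewrite (gh_sum gh) ser_sum.
rewrite -(tr (fun b => \sum_(c < k.+1)
  f a b c * fmul (fpow G.1 a) (fpow G.2 b) i j (k - c)%N) (i + j).+1); last 2 first.
- by rewrite /N ltnS leq_addr.
- move=> b lb; rewrite big1 // => c _.
  by rewrite fmulE !fpowE z ?mulr0 // (leq_trans lb) ?leq_addl.
apply: eq_bigr => b _; rewrite (gh_sum gh) ser_sum.
rewrite (eq_bigr (fun d : 'I_N => if (d <= k)%N then f a b d *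
  ((G.1 : ser R) ^+ a * (G.2 : ser R) ^+ b) i j (k - d)%N else 0)); last by move=> d _; rewrite cf.
rewrite (tr (fun d => if (d <= k)%N then f a b d *
  ((G.1 : ser R) ^+ a * (G.2 : ser R) ^+ b) i j (k - d)%N else 0) k.+1); last 2 first.
- by rewrite /N ltnS leq_addl.
- by move=> d; rewrite ltnNge => /negPf ->.
by apply: eq_bigr => d _; rewrite -ltnS ltn_ord fmulE !fpowE.
Qed.
End Bridge.

Section Maps.
Variable R : realType.
Implicit Types f h : ser R.
Implicit Types F G T : formal_map R.

Lemma xyge_fcomp F G : xyge 1 F.1 -> xyge 1 F.2 -> xyge 1 G.1 -> xyge 1 G.2 ->
  [/\ fcomp F G = (subst_map G F.1, subst_map G F.2), xyge 1 (fcomp F G).1 & xyge 1 (fcomp F G).2].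
Proof.
move=> f1 f2 g1 g2; have -> : fcomp F G = (subst_map G F.1, subst_map G F.2) by rewrite /fcomp !fsubstE.
have [gh gC gX gY gE] := subP g1 g2.
by split=> //=; apply: (ghom_xy gh gC gE); rewrite ?gX ?gY.
Qed.

Lemma sub_id u : subst_map (fid R) u = u.
Proof.
have [||gh gC gX gY gE] := @subP R (fid R); rewrite /= ?fxE ?fyE; [exact: xyge_sX|exact: xyge_sY|].
rewrite /= in gX gY; apply: (ghom_eq gh (ghom_id R)) => //.
- by rewrite gX fxE.
- by rewrite gY fyE.
Qed.

Lemma sub_can (phi : ser R -> ser R) : can phi -> subst_map (phi sX, phi sY) =1 phi.
Proof.
move=> cp; have [gh gC gX gY gE] := @subP R (phi sX, phi sY) (can_X cp) (can_Y cp).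
apply: (ghom_eq gh (can_gh cp)) => // [x|].
- by rewrite gC (can_C cp).
- by rewrite gE (can_E cp).
Qed.

(** Substitution is contravariant, so a conjugacy of maps turns into an identity of operators in the
    reverse order. *)
Lemma sub_comp F G : xyge 1 F.1 -> xyge 1 F.2 -> xyge 1 G.1 -> xyge 1 G.2 ->
  subst_map (fcomp F G) =1 subst_map G \o subst_map F.
Proof.
move=> f1 f2 g1 g2; have [E e1 e2] := xyge_fcomp f1 f2 g1 g2.
have [gh gC gX gY gE] := subP g1 g2; have [fh fC fX fY fE] := subP f1 f2.
have [h hC hX hY hE] := subP e1 e2.
apply: (ghom_eq h (ghom_comp gh fh)) => [x|||] /=.
- by rewrite hC fC gC.
- by rewrite hX fX E.
- by rewrite hY fY E.
- by rewrite hE fE gE.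
Qed.

Lemma canonical_iso T : canonical_change T -> iso (subst_map T).
Proof.
move=> [/vanishesE [x1 x2] [S [/vanishesE [s1 s2] TS ST]] jac].
have [gh gC gX gY gE] := subP x1 x2; have [hh hC hX hY hE] := subP s1 s2.
have cT : can (subst_map T).
  by split=> //; rewrite ?gX ?gY //; rewrite -fjacE jac foneE.
have K1 : cancel (subst_map T) (subst_map S).
  by move=> u; have := sub_comp x1 x2 s1 s2 u; rewrite TS sub_id /= => <-.
have K2 : cancel (subst_map S) (subst_map T).
  by move=> u; have := sub_comp s1 s2 x1 x2 u; rewrite ST sub_id /= => <-.
split=> //; exists (subst_map S) => //.
split=> //; rewrite ?hX ?hY //.
(* The Jacobian of the inverse is computed from the bracket of x and y, seen as images under the
   inverse. *)
have := pb_gh hh hC hE (subst_map T sX) (subst_map T sY).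
rewrite !K1 pb_XY (can_jac cT) (gh1 hh) mul1r => /esym.
by rewrite hX hY.
Qed.

Lemma iso_canonical (phi : ser R -> ser R) : iso phi -> canonical_change (phi sX, phi sY).
Proof.
move=> [cp [psi cq [K1 K2]]]; split.
- by apply/vanishesE; split; [exact: can_X cp|exact: can_Y cp].
- exists (psi sX, psi sY); split.
  + by apply/vanishesE; split; [exact: can_X cq|exact: can_Y cq].
  + have [-> _ _] := @xyge_fcomp (phi sX, phi sY) (psi sX, psi sY) (can_X cp) (can_Y cp) (can_X cq) (can_Y cq).
    by rewrite /= !(sub_can cq) /fid fxE fyE !K1.
  have [-> _ _] := @xyge_fcomp (psi sX, psi sY) (phi sX, phi sY) (can_X cq) (can_Y cq) (can_X cp) (can_Y cp).
  by rewrite /= !(sub_can cp) /fid fxE fyE !K2.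
- by rewrite fjacE /= (can_jac cp) foneE.
Qed.

Lemma frotE (a : R) : frot a = (rotX (cos a) (sin a), rotY (cos a) (sin a)).
Proof. by rewrite /frot fsubE faddE !fscaleE fxE fyE. Qed.

Lemma sub_frot (a : R) u : subst_map (frot a) u = rot_ser (cos a) (sin a) u.
Proof. by rewrite frotE. Qed.

Lemma time_oneE (H : ser R) : time_one H = (Exp H sX, Exp H sY).
Proof. by rewrite /time_one !fexp_lieE fxE fyE. Qed.

(** Both sides are continuous homomorphisms in u that fix constants and eps, so equality at x and y,
    which is the conjugacy of maps, is enough. *)
Lemma conjugatesE T F (a : R) H : xyge 1 F.1 -> xyge 1 F.2 -> xyge 1 T.1 -> xyge 1 T.2 -> fham H ->
  conjugates T F a H <->
  forall u, subst_map F (subst_map T u) = subst_map T (Exp H (rot_ser (cos a) (sin a) u)).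
Proof.
move=> f1 f2 t1 t2 fH; have cE := can_Exp fH.
have [fh fC fX fY fE] := subP f1 f2; have [th tC tX tY tE] := subP t1 t2.
have [rh rC rX rY rE] := rotP (cos a) (sin a).
have r1 : xyge 1 (frot a).1 by rewrite frotE -rX; exact: can_X (can_rot (cos2Dsin2 a)).
have r2 : xyge 1 (frot a).2 by rewrite frotE -rY; exact: can_Y (can_rot (cos2Dsin2 a)).
have e1 : xyge 1 (time_one H).1 by rewrite time_oneE; exact: can_X cE.
have e2 : xyge 1 (time_one H).2 by rewrite time_oneE; exact: can_Y cE.
have [E1 x1 x2] := xyge_fcomp r1 r2 e1 e2.
have [E2 _ _] := xyge_fcomp x1 x2 t1 t2; have [E3 _ _] := xyge_fcomp t1 t2 f1 f2.
rewrite /conjugates E3 E2 E1 frotE time_oneE /= !(sub_can cE) -rX -rY -tX -tY.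
split=> [[hX hY]|h]; last by rewrite !h.
apply: (ghom_eq (ghom_comp fh th) (ghom_comp th (ghom_comp (can_gh cE) rh))) => [x|||] /=.
- by rewrite tC fC rC (can_C cE) tC.
- exact: hX.
- exact: hY.
- by rewrite tE fE rE (can_E cE) tE.
Qed.

Lemma formally_conjugateE F (a : R) H : xyge 1 F.1 -> xyge 1 F.2 ->
  formally_conjugate F a H <-> fham H /\ exists2 phi, iso phi &
    forall u, subst_map F (phi u) = phi (Exp H (rot_ser (cos a) (sin a) u)).
Proof.
move=> f1 f2; split=> [[/formal_hamiltonianE fH [T cT cj]]|[fH [phi ip h]]].
  split=> //; exists (subst_map T); first exact: canonical_iso.
  by case: cT => /vanishesE [t1 t2] _ _; apply/conjugatesE.
split; first exact/formal_hamiltonianE.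
exists (phi sX, phi sY); first exact: iso_canonical.
have cp := iso_can ip; apply/conjugatesE => //; [exact: can_X cp|exact: can_Y cp|].
by move=> u; rewrite !(sub_can cp).
Qed.

Lemma at_eps0E : [/\ ghom (@at_eps0 R), forall x : R, at_eps0 (sC x) = sC x,
  at_eps0 sX = (sX : ser R), at_eps0 sY = (sY : ser R) & at_eps0 sE = (0 : ser R)].
Proof.
split; [split|move=> x| | |].
- by move=> f h; apply: ser_ext => i j k; rewrite serD /at_eps0 serD; case: eqP => // _; rewrite addr0.
- move=> f h; apply: ser_ext => i j k; rewrite /at_eps0 !serM; case: eqP => [->|/eqP k0].
    by do 2![apply: eq_bigr => ? _]; rewrite !big_ord1.
  apply/esym; rewrite big1 // => a _; rewrite big1 // => b _; rewrite big1 // => d _.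
  case: eqP => [d0|_]; last by rewrite mul0r.
  by rewrite d0 subn0 (negPf k0) mulr0.
- by apply: ser_ext => i j k; rewrite /at_eps0 !ser1E; case: (k =P 0%N) => [_|_]; rewrite ?andbT ?andbF.
- by move=> N f o i j k l; rewrite /at_eps0; case: eqP => // k0; apply: o; rewrite -k0.
- by apply: ser_ext => i j k; rewrite /at_eps0 !sCE; case: (k =P 0%N) => [_|_]; rewrite ?andbT ?andbF.
- by apply: ser_ext => i j k; rewrite /at_eps0 !sXE; case: (k =P 0%N) => [_|_]; rewrite ?andbT ?andbF.
- by apply: ser_ext => i j k; rewrite /at_eps0 !sYE; case: (k =P 0%N) => [_|_]; rewrite ?andbT ?andbF.
- by apply: ser_ext => i j k; rewrite /at_eps0 !sEE ser0 andbF; case: ifP.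
Qed.

Lemma at_eps0_pb f h : at_eps0 (pb f h) = pb (at_eps0 f) (at_eps0 h).
Proof.
have [gh _ _ _ _] := at_eps0E.
have ex u : at_eps0 (dx u) = dx (at_eps0 u).
  by apply: ser_ext => i j k; rewrite /dx /at_eps0; case: ifP; rewrite ?mul0rn.
have ey u : at_eps0 (dy u) = dy (at_eps0 u).
  by apply: ser_ext => i j k; rewrite /dy /at_eps0; case: ifP; rewrite ?mul0rn.
by rewrite /pb (ghB gh) !(ghM gh) !ex !ey.
Qed.

Lemma at_eps0_Exp (H : ser R) f : ordge 3 H -> at_eps0 (Exp H f) = Exp (at_eps0 H) (at_eps0 f).
Proof.
have [gh gC _ _ _] := at_eps0E.
by apply: Exp_nat => //; apply: at_eps0_pb.
Qed.

Lemma xyge_eps0 N f : xyge N f -> xyge N (at_eps0 f).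
Proof. by move=> x i j k l; rewrite /at_eps0 x //; case: ifP. Qed.

Lemma at_eps0_sub G u : xyge 1 G.1 -> xyge 1 G.2 ->
  at_eps0 (subst_map G u) = subst_map (map_at_eps0 G) (at_eps0 u).
Proof.
move=> g1 g2; have [gh gC gX gY gE] := subP g1 g2.
have [ah aC aX aY aE] := at_eps0E.
have [kh kC kX kY kE] := @subP R (map_at_eps0 G) (xyge_eps0 g1) (xyge_eps0 g2).
move: u; apply: (ghom_eq (ghom_comp ah gh) (ghom_comp kh ah)) => [x|||] /=.
- by rewrite gC aC kC.
- by rewrite gX aX kX.
- by rewrite gY aY kY.
- by rewrite gE aE (gh0 kh).
Qed.

Lemma at_eps0K f : at_eps0 (at_eps0 f) = at_eps0 f.
Proof. by apply: ser_ext => i j k; rewrite /at_eps0; case: ifP. Qed.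

Lemma conj_at_eps0 T F (a : R) H : xyge 1 F.1 -> xyge 1 F.2 -> canonical_change T ->
  fham H -> conjugates T F a H ->
  [/\ canonical_change (map_at_eps0 T), eps_free (map_at_eps0 T) &
    conjugates (map_at_eps0 T) (map_at_eps0 F) a (at_eps0 H)].
Proof.
move=> f1 f2 cT fH; have [/vanishesE [t1 t2] [S [/vanishesE [s1 s2] TS ST]] jac] := cT.
have [ah aC aX aY aE] := at_eps0E.
move=> /(conjugatesE _ f1 f2 t1 t2 fH) h.
have t1' := xyge_eps0 t1; have t2' := xyge_eps0 t2.
have s1' := xyge_eps0 s1; have s2' := xyge_eps0 s2.
have f1' := xyge_eps0 f1; have f2' := xyge_eps0 f2.
split.
- split; first by apply/vanishesE.
    exists (map_at_eps0 S).
    have E G K : xyge 1 G.1 -> xyge 1 G.2 -> xyge 1 K.1 -> xyge 1 K.2 ->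
        fcomp (map_at_eps0 G) (map_at_eps0 K) = map_at_eps0 (fcomp G K).
      move=> g1 g2 k1 k2; have [-> _ _] := xyge_fcomp g1 g2 k1 k2.
      have [||||-> _ _] := @xyge_fcomp (map_at_eps0 G) (map_at_eps0 K); try exact: xyge_eps0.
      by rewrite /map_at_eps0 /= !at_eps0_sub.
    rewrite !E // TS ST /map_at_eps0 /fid /= fxE fyE aX aY; split=> //.
    by apply/vanishesE.
  by rewrite fjacE /= -at_eps0_pb -fjacE jac foneE (gh1 ah).
- by rewrite /eps_free /map_at_eps0 /= !at_eps0K.
have fH' : fham (at_eps0 H).
  by case: fH => x o; split; [apply: xyge_eps0|apply: (gh_ord ah)].
have [fh fC fX fY fE] := subP f1 f2; have [th tC tX tY tE] := subP t1 t2.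
have [fh' fC' fX' fY' fE'] := @subP R (map_at_eps0 F) f1' f2'.
have [th' tC' tX' tY' tE'] := @subP R (map_at_eps0 T) t1' t2'.
have cE := can_Exp fH'.
have [rh rC rX rY rE] := rotP (cos a) (sin a).
have aR u : at_eps0 (rot_ser (cos a) (sin a) u) = rot_ser (cos a) (sin a) (at_eps0 u).
  move: u; apply: (ghom_eq (ghom_comp ah rh) (ghom_comp rh ah)) => [x|||] /=.
  - by rewrite rC aC rC.
  - by rewrite rX aX rX /rotX (ghB ah) !(ghM ah) !aC aX aY.
  - by rewrite rY aY rY /rotY (ghD ah) !(ghM ah) !aC aX aY.
  - by rewrite rE aE (gh0 rh).
(* The identity is only obtained on series free of eps; this suffices because x and y are such
   series. *)
have h' u : subst_map (map_at_eps0 F) (subst_map (map_at_eps0 T) (at_eps0 u)) =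
    subst_map (map_at_eps0 T) (Exp (at_eps0 H) (rot_ser (cos a) (sin a) (at_eps0 u))).
  rewrite -at_eps0_sub // -at_eps0_sub // h at_eps0_sub // at_eps0_Exp ?aR //.
  by case: fH.
apply/conjugatesE => //.
apply: (ghom_eq (ghom_comp fh' th') (ghom_comp th' (ghom_comp (can_gh cE) rh))) => [x|||] /=.
- by rewrite tC' fC' rC (can_C cE) tC'.
- by rewrite -aX h'.
- by rewrite -aY h'.
- by rewrite tE' fE' rE (can_E cE) tE'.
Qed.
End Maps.

(** * Coefficients of the normal form in complex coordinates *)

Section HamCoefficients.
Variable R : realType.
Local Notation C := R[i].
Local Notation cR := (real_complex R).
Local Notation iota := (@zcoords R).
Local Notation fI' := (fI R : ser R).
Implicit Types A B : fps2 R.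

Lemma iXY : iX R + sC (ic R) * iY R = sX /\ iX R - sC (ic R) * iY R = sY.
Proof.
have i2 : sC (ic R) * sC (ic R) = - 1 :> ser C by rewrite -sC_M ic2 sC_N sC1.
have h := sC_c2E R.
rewrite /iX /iY sC_M sC_N; set I := sC (ic R) in i2 *; set z := sC (c2 R) in h *.
split.
  transitivity (z * (sX + sY) - (I * I) * (z * (sX - sY))); first ring.
  rewrite i2; transitivity ((z + z) * sX); first ring.
  by rewrite h mul1r.
transitivity (z * (sX + sY) + (I * I) * (z * (sX - sY))); first ring.
rewrite i2; transitivity ((z + z) * sY); first ring.
by rewrite h mul1r.
Qed.

Lemma iota_fI : iota fI' = sC (cR 2^-1) * mon 1%N 1%N 0%N.
Proof.
have [h1 h2] := iXY; have ih := iota_gh R.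
have i2 : sC (ic R) * sC (ic R) = - 1 :> ser C by rewrite -sC_M ic2 sC_N sC1.
rewrite /fI fscaleE faddE !fpowE fxE fyE (ghM ih) iota_C (ghD ih) !(gh_exp ih) iota_X iota_Y.
congr (_ * _); rewrite /mon !expr1 expr0 mulr1 -{1}h1 -h2.
transitivity (iX R * iX R - (sC (ic R) * sC (ic R)) * (iY R * iY R)); last ring.
by rewrite i2; ring.
Qed.

Lemma iota_fcpow n : iota (fcpow R n).1 = sC (c2 R) * (sX ^+ n + sY ^+ n).
Proof.
have [h1 h2] := iXY; have ih := iota_gh R.
have i2 : sC (ic R) * sC (ic R) = - 1 :> ser C by rewrite -sC_M ic2 sC_N sC1.
have K : iota (fcpow R n).1 + sC (ic R) * iota (fcpow R n).2 = sX ^+ n /\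
   iota (fcpow R n).1 - sC (ic R) * iota (fcpow R n).2 = sY ^+ n.
  elim: n => [|n [IH1 IH2]].
    by rewrite /= foneE fzeroE (gh1 ih) (gh0 ih) mulr0 addr0 subr0 !expr0.
  rewrite /= fsubE faddE !fmulE fxE fyE (ghB ih) (ghD ih) !(ghM ih) iota_X iota_Y.
  rewrite !exprS -IH1 -IH2 -h1 -h2.
  set x := iX R; set y := iY R; set u := iota _; set v := iota _; set I := sC (ic R) in i2 *.
  split.
    transitivity (x * u - y * v + I * (x * v + y * u)); first by [].
    transitivity (x * u + (I * I) * (y * v) + I * (x * v + y * u)); last ring.
    by rewrite i2; ring.
  transitivity (x * u + (I * I) * (y * v) - I * (x * v + y * u)); last ring.
  by rewrite i2; ring.
have [k1 k2] := K; rewrite -k1 -k2.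
set u := iota _; set v := iota _.
transitivity ((sC (c2 R) + sC (c2 R)) * u); last ring.
by rewrite sC_c2E mul1r.
Qed.

Lemma fI_neq0 k i j l : (fI' ^+ k : ser R) i j l != 0 -> (i + j = 2 * k)%N /\ l = 0%N.
Proof.
move=> nz; have := @kappa_iota R (fI' ^+ k) => /(congr1 (fun u : ser C => u i j l)) E.
have : kappa (iota (fI' ^+ k)) i j l != 0.
  by rewrite E /map_ser; apply: contraNneq nz => /(congr1 (@complex.Re R)) /= ->.
move=> /(gsub_linear_neq0 (@rhom_id C) (@linear_kX R) (@linear_kY R)) [p [q [<-]]].
rewrite (gh_exp (iota_gh R)) iota_fI.
have -> : (sC (cR 2^-1) * mon 1%N 1%N 0%N) ^+ k = sC (cR 2^-1 ^+ k) * mon k k 0%N.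
  by rewrite exprMn sC_exp /mon !expr1 expr0 !mulr1 exprMn.
rewrite sCM monE; have [->|_] := eqVneq p k; last by rewrite mulr0 eqxx.
have [->|_] := eqVneq q k; last by rewrite mulr0 eqxx.
by have [-> _|_] := eqVneq l 0%N; [lia|rewrite mulr0 eqxx].
Qed.

Lemma iota_of_I A p q m : iota (of_I A) p q m = if p == q then cR (A p m / 2 ^+ p) else 0.
Proof.
have ih := iota_gh R; pose N := (p + q + m).+1.
pose T := \sum_(k < N) \sum_(l < N) sC (A k l) * (fI' ^+ k * sE ^+ l) : ser R.
have o : ordge N ((of_I A : ser R) - T).
  move=> i j x lt; rewrite serB; apply/eqP; rewrite subr_eq0; apply/eqP.
  have xN : (x < N)%N by move: lt; clear; lia.
  have le : ((i + j).+1 <= N)%N by move: lt; clear; lia.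
  rewrite /of_I (big_ord_widen _ (fun k : nat => A k x * fpow (fI R) k i j 0%N) le) big_mkcond /= /T ser_sum.
  apply: eq_bigr => k _; rewrite ser_sum (bigD1 (Ordinal xN)) //= big1 => [|l nl].
    rewrite addr0 sCM mulrC [fI' ^+ k * _]mulrC sEnM leqnn subnn fpowE mulrC.
    case: ltnP => // h; apply/esym/eqP; apply: contraT; rewrite mulf_eq0 negb_or.
    by move=> /andP[_ /fI_neq0 [h2 _]]; move: h h2; clear; lia.
  rewrite sCM [fI' ^+ k * _]mulrC sEnM; case: leqP => // lx; last by rewrite mulr0.
  apply/eqP; rewrite mulf_eq0; apply/orP; right; apply: contraT => /fI_neq0 [_ h2].
  by case/eqP: nl; apply: val_inj => /=; move: lx h2; clear; lia.
rewrite (iota_near o (ltnSn _)) /T (gh_sum ih) ser_sum.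
have cf k l : iota (sC (A k l) * (fI' ^+ k * sE ^+ l)) p q m =
    cR (A k l / 2 ^+ k) * ((p == k) && (q == k) && (m == l))%:R.
  rewrite !(ghM ih) iota_C !(gh_exp ih) iota_E iota_fI.
  have -> : (sC (cR 2^-1) * mon 1%N 1%N 0%N) ^+ k * sE ^+ l = sC (cR (2^-1 ^+ k)) * mon k k l.
    rewrite exprMn sC_exp /mon !expr1 expr0 !mulr1 exprMn (rmorphXn (real_complex R)).
    by rewrite /=; ring.
  by rewrite mulrA -sC_M sCM monE cRM exprVn.
have pN : (p < N)%N by rewrite /N; clear; lia.
have mN : (m < N)%N by rewrite /N; clear; lia.
rewrite (bigD1 (Ordinal pN)) //= [X in _ + X]big1 => [|k nk]; last first.
  rewrite (gh_sum ih) ser_sum big1 // => l _; rewrite cf.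
  have [e|_] := eqVneq p k; last by rewrite mulr0.
  by case/eqP: nk; apply: val_inj.
rewrite addr0 (gh_sum ih) ser_sum (bigD1 (Ordinal mN)) //= [X in _ + X]big1 => [|l nl]; last first.
  rewrite cf; have [e|_] := eqVneq m l; last by rewrite andbF mulr0.
  by case/eqP: nl; apply: val_inj.
by rewrite addr0 cf !eqxx andbT /= eq_sym; case: eqP => _; rewrite ?mulr1 ?mulr0.
Qed.

(** The coefficient of z^n in I^(n/2) cos(n phi): 2^(-n/2) from the radius and 1/2 from the real
    part. *)
Definition cn n : R := Num.sqrt 2 ^- n / 2.

Lemma cn_gt0 n : 0 < cn n.
Proof. by rewrite /cn divr_gt0 // invr_gt0 exprn_gt0 // sqrtr_gt0. Qed.

Lemma iota_hamAB n A B P Q m : iota (hamAB n A B) P Q m =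
  (if (0 < P)%N && (P == Q) then cR (A P.-1 m / 2 ^+ P) else 0) +
  ((if P == (Q + n)%N then cR (cn n * (B Q m / 2 ^+ Q)) else 0) +
   (if Q == (P + n)%N then cR (cn n * (B P m / 2 ^+ P)) else 0)).
Proof.
have ih := iota_gh R.
rewrite /hamAB faddE !fmulE (ghD ih) !(ghM ih) iota_fI /fIcos fscaleE (ghM ih) iota_C iota_fcpow.
have -> : sC (cR (Num.sqrt 2 ^- n)) * (sC (c2 R) * (sX ^+ n + sY ^+ n)) =
    sC (cR (cn n)) * (mon n 0%N 0%N + mon 0%N n 0%N).
  rewrite mulrA -sC_M /mon !expr0 !mulr1 !mul1r; congr (sC _ * _).
  rewrite /cn cRM; congr (_ * _); rewrite /c2.
  by apply: (mulIf (x := 2)); rewrite ?pnatr_eq0 // mulVf ?pnatr_eq0 // -(cR_nat R 2) -cRM mulVf ?pnatr_eq0.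
rewrite serD -mulrA sCM monM_coef -mulrA sCM mulrDl serD !monM_coef !leq0n !subn0 !andbT.
congr (_ + _).
  case: P => [|P] /=; first by rewrite mulr0.
  case: Q => [|Q] /=; first by rewrite mulr0.
  rewrite !subSS !subn0 iota_of_I eqSS; case: eqP => [_|_]; last by rewrite mulr0.
  by rewrite -cRM exprS invfM; congr cR; ring.
have E (p q : nat) : (if (n <= p)%N then iota (of_I B) (p - n)%N q m else 0) =
    if p == (q + n)%N then cR (B q m / 2 ^+ q) else 0.
  case: leqP => [le|lt]; last by case: eqP => // h; move: lt; rewrite h ltnNge leq_addl.
  rewrite iota_of_I; have -> : (p - n == q)%N = (p == q + n)%N by apply/eqP/eqP; move: le; clear; lia.
  by case: eqP => // ->; rewrite addnK.
have E' (p q : nat) : (if (n <= p)%N then iota (of_I B) q (p - n)%N m else 0) =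
    if p == (q + n)%N then cR (B q m / 2 ^+ q) else 0.
  by rewrite -E; case: leqP => // _; rewrite !iota_of_I eq_sym; case: eqP => [->|].
rewrite E E' mulrDr; congr (_ + _); by case: eqP => _; rewrite ?mulr0 // -cRM.
Qed.
End HamCoefficients.

(** * Exponents allowed in the normal form *)

Section Shapes.
Variable R : realType.
Variable n : nat.
Hypothesis n3 : (3 <= n)%N.
Local Notation cR := (real_complex R).
Local Notation iota := (@zcoords R).
Local Notation Re := (@complex.Re R).
Implicit Types A B : fps2 R.

Definition gof := if n == 3%N then 2%N else 1%N.
Local Notation g := gof.
Local Notation e := g.+1.
Local Notation NF := (@normal_form R n g).

Lemma gofP : ((g == 1%N) && (4 <= n)%N) || ((g == 2%N) && (n == 3%N)).
Proof.
rewrite /gof; case: (eqVneq n 3%N) => [->|h] //=.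
by rewrite orbF ltn_neqAle eq_sym h.
Qed.

Let n0 : (0 < n)%N. Proof. by apply: leq_trans n3. Qed.
Let shift_neq q : (q == (q + n + n)%N) = false /\ (q == (q + n)%N) = false.
Proof. by split; apply/negbTE/eqP; move: n0; clear; lia. Qed.

Lemma ham_diag A B k m : iota (hamAB n A B) k.+1 k.+1 m = cR (A k m / 2 ^+ k.+1).
Proof.
by rewrite iota_hamAB eqxx /=; have [_ ->] := shift_neq k.+1; rewrite !addr0.
Qed.

Lemma ham_off A B q m : iota (hamAB n A B) (q + n)%N q m = cR (cn R n * (B q m / 2 ^+ q)).
Proof.
have [h1 h2] := shift_neq q.
by rewrite iota_hamAB eqxx h1 [(q + n == q)%N]eq_sym h2 andbF add0r addr0.
Qed.

Lemma ham_sym A B p q m : iota (hamAB n A B) p q m = iota (hamAB n A B) q p m.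
Proof.
rewrite !iota_hamAB [q == p]eq_sym; congr (_ + _); last by rewrite addrC.
by have [->|_] := eqVneq p q; rewrite ?andbF.
Qed.

Lemma ham_inj A B A' B' : hamAB n A B = hamAB n A' B' -> A = A' /\ B = B'.
Proof.
move=> E; split; apply/funext => k; apply/funext => m.
  have := ham_diag A' B' k m; rewrite -E ham_diag => /cR_inj /mulIf; apply.
  by rewrite invr_eq0 expf_neq0 // pnatr_eq0.
have := ham_off A' B' k m; rewrite -E ham_off => /cR_inj /mulfI h.
have /mulIf h2 := h (lt0r_neq0 (cn_gt0 R n)); apply: h2.
by rewrite invr_eq0 expf_neq0 // pnatr_eq0.
Qed.

(** The factor I in front of A shifts the exponent to k + 1; for n = 3, 3 divides 2 (k + 1) - 1
    exactly when k = 1 modulo 3. *)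
Lemma okA_vanish A B k m : family_shape n A B -> A k m != 0 -> okA g k.+1.
Proof.
move=> [h4 h3]; rewrite /okA /gof; case: (eqVneq n 3%N) => // e3 /=.
have [hA _ _ _] := h3 e3; apply: contraNN => d; apply/eqP; apply: hA.
by move: d; clear; lia.
Qed.
(** The excluded exponents are those with 2 dividing k + 1 for n >= 4, and with 3 dividing 2 (k + 1)
    for n = 3. *)
Lemma okB_vanish A B k m : family_shape n A B -> B k m != 0 -> okB g k.
Proof.
move=> [h4 h3]; rewrite /okB /gof; case: (eqVneq n 3%N) => e3 /=.
  have [_ _ _ hB] := h3 e3; apply: contraNN => d; apply/eqP; apply: hB.
  by move: d; clear; lia.
have [|_ hB] := h4; first by rewrite ltn_neqAle eq_sym e3.
by apply: contraNN => d; apply/eqP; apply: hB; move: d; clear; lia.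
Qed.

Lemma shape_NF A B : family_shape n A B -> NF (iota (hamAB n A B)).
Proof.
move=> sh; split=> [|p q m]; first exact: ham_sym.
rewrite iota_hamAB.
have [/andP[p0 /eqP epq]|_] := boolP ((0 < p)%N && (p == q)).
  subst q; have [_ ->] := shift_neq p; rewrite !addr0 => nz.
  apply: Or31; split=> //; rewrite -(prednK p0); apply: (okA_vanish sh (m := m)).
  by apply: contraNneq nz => ->; rewrite mul0r.
rewrite add0r; have [ep|_] := eqVneq p (q + n)%N.
  subst p; have [-> _] := shift_neq q; rewrite addr0 => nz.
  apply: Or32; split=> //; apply: (okB_vanish sh (m := m)).
  by apply: contraNneq nz => ->; rewrite mul0r mulr0.
rewrite add0r; have [eq|_] := eqVneq q (p + n)%N; last by rewrite eqxx.
move=> nz; apply: Or33; split=> //; apply: (okB_vanish sh (m := m)).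
by apply: contraNneq nz => ->; rewrite mul0r mulr0.
Qed.

(** The vanishing of [A 0 0] comes from the weight, as z zb alone only has weight g; for n = 3 that
    of [A 1 0] is an instance of the rule on exponents. *)
Lemma NF_shape H : NF (iota H) -> Filt n g e H -> exists A B, [/\ family_shape n A B,
  H = hamAB n A B & B 0%N 0%N = Re (iota H n 0%N 0%N) / cn R n].
Proof.
move=> nfH FH; have [sym nf] := nfH.
have real p q m : iota H p q m = cR (Re (iota H p q m)) by apply: NF_real nfH.
have c0 := cn_gt0 R n; have cn0 := lt0r_neq0 c0.
have t0 k : 2 ^+ k != 0 :> R by rewrite expf_neq0 // pnatr_eq0.
pose A : fps2 R := fun k m => Re (iota H k.+1 k.+1 m) * 2 ^+ k.+1.
pose B : fps2 R := fun q m => Re (iota H (q + n)%N q m) * 2 ^+ q / cn R n.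
have Az k m : ~~ okA g k.+1 -> A k m = 0.
  move=> nok; rewrite /A (_ : iota H k.+1 k.+1 m = 0) ?mul0r //.
  apply/eqP; apply: contraT => /nf [[_ _ ok]|[h _]|[h _]]; first by rewrite ok in nok.
    by move: h n0; clear; lia.
  by move: h n0; clear; lia.
have Bz k m : ~~ okB g k -> B k m = 0.
  move=> nok; rewrite /B (_ : iota H (k + n)%N k m = 0) ?mul0r //.
  apply/eqP; apply: contraT => /nf [[h _ _]|[_ ok]|[h _]]; last 2 first.
  - by rewrite ok in nok.
  - by move: h n0; clear; lia.
  by move: h n0; clear; lia.
have A00 : A 0%N 0%N = 0.
  rewrite /A (_ : iota H 1%N 1%N 0%N = 0) ?mul0r //; apply: (filc_0 FH).
  have := wtE gofP 1 0 0; rewrite mul0n addn0 => ->.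
  by rewrite /gof; case: ifP; rewrite orbT.
exists A, B; split.
- split=> [n4|e3].
    split=> // k m ok; apply: Bz; rewrite /okB /gof; case: (eqVneq n 3%N) => [e3|_].
      by move: n4; rewrite e3.
    by move: ok; clear; lia.
  split=> //.
  + move=> k m ok; apply: Az; rewrite /okA /gof e3 /=; move: ok; clear; lia.
  + by apply: Az; rewrite /okA /gof e3.
  + by move=> k m ok; apply: Bz; rewrite /okB /gof e3 /=; move: ok; clear; lia.
- apply: iota_inj; apply: ser_ext => p q m.
  have dg k : iota H k.+1 k.+1 m = iota (hamAB n A B) k.+1 k.+1 m.
    by rewrite ham_diag /A mulfK // -real.
  have of1 k : iota H (k + n)%N k m = iota (hamAB n A B) (k + n)%N k m.
    rewrite ham_off /B.
    have -> : cn R n * (Re (iota H (k + n)%N k m) * 2 ^+ k / cn R n / 2 ^+ k) = Re (iota H (k + n)%N k m).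
      by field; rewrite t0.
    by rewrite -real.
  have [epq|npq] := eqVneq p q.
    subst q; case: p => [|p]; last exact: dg.
    rewrite iota_hamAB /=; have [_ h] := shift_neq 0; rewrite h !addr0.
    apply/eqP; apply: contraT => /nf [[_ h' _]|[h' _]|[h' _]] //; move: h' n0; clear; lia.
  have [ep|np] := eqVneq p (q + n)%N; first by subst p; exact: of1.
  have [eq|nq] := eqVneq q (p + n)%N.
    by subst q; rewrite sym of1 ham_sym.
  rewrite iota_hamAB (negPf npq) (negPf np) (negPf nq) andbF !addr0.
  apply/eqP; apply: contraT => /nf [[h' _ _]|[h' _]|[h' _]].
  + by rewrite h' eqxx in npq.
  + by rewrite h' eqxx in np.
  + by rewrite h' eqxx in nq.
- by rewrite /B add0n expr0 mulr1.
Qed.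

(** The monomials (z zb)^2 and z^n have degree below n + 2, so the remainder does not touch them and
    nondegeneracy passes to their coefficients. *)
Lemma leading_lead H A B : fham H -> Filt n g 0 H ->
  (forall i j k, (i + j < n + 2)%N -> H i j k = hamAB n A B i j k) ->
  ((4 <= n)%N -> dI A 0%N 0%N * B 0%N 0%N != 0) -> (n = 3%N -> B 0%N 0%N != 0) ->
  exists a b, leading n g H a b.
Proof.
move=> fH F0 hl h4 h3.
have eqc p q m : (p + q < n + 2)%N -> iota H p q m = iota (hamAB n A B) p q m.
  move=> lt; apply/eqP; rewrite -subr_eq0 -serB -(ghB (iota_gh R)); apply: contraT.
  move=> /(gsub_linear_neq0 (rhom_cR R) (@linear_iX R) (@linear_iY R)) [i [j [eij]]].
  by rewrite serB hl ?subrr ?eqxx // eij.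
exists (A 1%N 0%N / 2 ^+ 2), (cn R n * B 0%N 0%N); split=> //.
- exact: (fham_Fil gofP).
- move=> g1; have n4 : (4 <= n)%N.
    by move: g1; rewrite /gof; case: (eqVneq n 3%N) => // h _; rewrite ltn_neqAle eq_sym h.
  rewrite eqc; last by move: n4; clear; lia.
  rewrite ham_diag; split=> //; have := h4 n4; rewrite mulf_eq0 negb_or => /andP[h _].
  apply: contraNneq h => /eqP; rewrite mulf_eq0 invr_eq0 expf_eq0 pnatr_eq0 andbF orbF.
  by move=> /eqP h; rewrite /dI h mulr0.
- rewrite eqc; last by clear; lia.
  by have := ham_off A B 0 0; rewrite add0n expr0 divr1.
apply: mulf_neq0; first exact: lt0r_neq0 (cn_gt0 R n).
have [e3|h] := eqVneq n 3%N; first exact: (h3 e3).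
have n4 : (4 <= n)%N by rewrite ltn_neqAle eq_sym h.
by have := h4 n4; rewrite mulf_eq0 negb_or => /andP[].
Qed.

(** The factor I^2 (I^3 for n = 3) of the individual map, against the factor I of the family, shifts
    the index by 1 (by 2). *)
Definition mapA (a : nat -> R) : fps2 R := fun k m => if m == 0%N then
  if n == 3%N then if (2 <= k)%N && (((k - 2) %% 3)%N != 2) then a (k - 2)%N else 0
  else if (0 < k)%N then a (k - 1)%N else 0 else 0.
Definition mapB (b : nat -> R) : fps2 R := fun k m => if m == 0%N then
  if n == 3%N then if (k %% 3 == 2)%N then 0 else b k
  else if odd k then 0 else b k./2 else 0.

Lemma fI_of_I p A : fmul (fpow (fI R) p.+1) (of_I A) =
  fmul (fI R) (of_I (fun k m => if (p <= k)%N then A (k - p)%N m else 0)).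
Proof.
set D := fun _ _ => _; suff E : (fI R : ser R) ^+ p * (of_I A : ser R) = of_I D.
  by rewrite !fmulE fpowE exprS -mulrA E.
have ih := iota_gh R; apply: iota_inj; apply: ser_ext => i j m.
rewrite (ghM ih) (gh_exp ih) iota_fI.
have -> : (sC (cR 2^-1) * mon 1%N 1%N 0%N) ^+ p = sC (cR (2^-1 ^+ p)) * mon p p 0%N.
  by rewrite exprMn sC_exp (rmorphXn (real_complex R)) /mon !expr1 expr0 !mulr1 exprMn.
rewrite -mulrA sCM monM_coef (iota_of_I D) /D leq0n andbT subn0.
have [pi|ip] := leqP p i; last first.
  by rewrite /= mulr0; case: eqP => // _; rewrite mul0r.
have [pj|jp] := leqP p j; last first.
  by rewrite /= mulr0; case: eqP => // h; move: jp; rewrite -h ltnNge pi.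
rewrite /= iota_of_I; have -> : (i - p == j - p)%N = (i == j).
  by apply/eqP/eqP; move: pi pj; clear; lia.
case: eqP => _; last by rewrite mulr0.
rewrite -cRM; congr cR; have -> : 2 ^+ i = 2 ^+ p * 2 ^+ (i - p) :> R by rewrite -exprD subnKC.
by rewrite invfM exprVn mulrCA mulrA.
Qed.

Lemma map_ham_hamAB a b : map_ham n a b = hamAB n (mapA a) (mapB b).
Proof.
rewrite /map_ham /hamAB; case: eqP => [e3|/eqP ne3].
  rewrite /map_ham_3 /of_I1 (fI_of_I 2); congr fadd; last first.
    congr (fmul _ (of_I _)); first by rewrite e3.
    by apply/funext => k; apply/funext => m; rewrite /mapB e3.
  congr (fmul _ (of_I _)); apply/funext => k; apply/funext => m; rewrite /mapA e3 eqxx.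
  by case: eqP => // _; case: leqP => //= _; case: eqP.
rewrite /map_ham_ge4 /of_I1 (fI_of_I 1); congr fadd; last first.
  congr (fmul _ (of_I _)).
  by apply/funext => k; apply/funext => m; rewrite /mapB (negPf ne3).
congr (fmul _ (of_I _)); apply/funext => k; apply/funext => m; rewrite /mapA (negPf ne3).
by case: eqP => // _; case: ifP.
Qed.

Lemma map_shape a b : family_shape n (mapA a) (mapB b).
Proof.
split=> [n4|e3].
  have ne : (n == 3%N) = false by apply/negbTE; rewrite neq_ltn n4 orbT.
  by split=> [|k m ok]; rewrite /mapA /mapB ne //= ok; case: ifP.
rewrite /mapA /mapB e3 /=; split=> // k m h; case: eqP => //= _.
  by case: ifP => // /andP[h2 h3]; exfalso; move: h h2 h3; clear; lia.
by rewrite h.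
Qed.

Definition eps0 (A : fps2 R) : fps2 R := fun k m => if m == 0%N then A k m else 0.

Lemma at_eps0_hamAB A B : at_eps0 (hamAB n A B) = hamAB n (eps0 A) (eps0 B).
Proof.
have [ah aC aX aY aE] := at_eps0E R.
have ofI D : at_eps0 (of_I D) = of_I (eps0 D).
  apply: ser_ext => i j m; rewrite /at_eps0 /of_I /eps0; case: (m =P 0%N) => [->|_] //.
  by rewrite big1 // => k _; rewrite mul0r.
have aI : at_eps0 (fI R) = fI R.
  by rewrite /fI fscaleE faddE !fpowE fxE fyE (ghM ah) aC (ghD ah) !(gh_exp ah) aX aY.
have ac : at_eps0 (fcpow R n).1 = (fcpow R n).1 /\ at_eps0 (fcpow R n).2 = (fcpow R n).2.
  elim: (n) => [|k [IH1 IH2]]; first by rewrite /= foneE fzeroE (gh1 ah) (gh0 ah).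
  by rewrite /= fsubE faddE !fmulE fxE fyE (ghB ah) (ghD ah) !(ghM ah) aX aY IH1 IH2.
rewrite /hamAB !faddE !fmulE (ghD ah) !(ghM ah) !ofI aI /fIcos fscaleE (ghM ah) aC.
have [-> _] := ac. reflexivity.
Qed.

(** The conditions on the lowest coefficients of A at eps = 0 allow I^2, or I^3 for n = 3, to be
    factored out. *)
Lemma at_eps0_map A B : family_shape n A B -> 0 < B 0%N 0%N ->
  exists a b : nat -> R, 0 < b 0%N /\ at_eps0 (hamAB n A B) = map_ham n a b.
Proof.
move=> [h4 h3] B0.
exists (fun k => A (if n == 3%N then k + 2 else k + 1)%N 0%N),
  (fun k => B (if n == 3%N then k else k.*2) 0%N).
split; first by case: ifP.
rewrite at_eps0_hamAB map_ham_hamAB /eps0 /mapA /mapB.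
congr hamAB; apply/funext => k; apply/funext => m; case: (m =P 0%N) => [->|_] //.
  have [e3|ne3] := eqVneq n 3%N.
    have [hA A0 A1 _] := h3 e3.
    case: k => [|[|k]] //; rewrite /= !subSS subn0 addn2; case: eqP => //= hk.
    by rewrite hA //; move: hk; clear; lia.
  have [|A0 _] := h4; first by rewrite ltn_neqAle eq_sym ne3.
  by case: k => [|k] //=; rewrite subSS subn0 addn1.
have [e3|ne3] := eqVneq n 3%N.
  by have [_ _ _ hB] := h3 e3; case: eqP => // hk; rewrite hB.
have [|_ hB] := h4; first by rewrite ltn_neqAle eq_sym ne3.
case: ifP => [ok|nok]; first by rewrite hB.
by rewrite -[in LHS](odd_double_half k) nok.
Qed.
End Shapes.

(** * Taylor series and rotation angle *)

Section Analysis.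
Variable R : realType.
Local Notation cR := (real_complex R).

Lemma iter_pderive_eps0 (f : R -> R -> R -> R) (r : R) : (forall t, `|t| < r -> f 0 0 t = 0) ->
  forall k t, `|t| < r -> iter_pderive (nseq k Ceps) f 0 0 t = 0.
Proof.
move=> f0; elim=> [|k IH] t tr; first exact: f0.
rewrite /= /pderive /= derive1E (near_eq_derive (g := cst 0)) ?derive_cst //.
near=> x; apply: IH; rewrite -[x](subrK t).
apply: le_lt_trans (ler_normD _ _) _; rewrite -ltrBrDr distrC.
near: x; apply/nbhs_ballP; exists (r - `|t|); first by rewrite /= subr_gt0.
by move=> y; rewrite -ball_normE.
Unshelve. all: by end_near. Qed.

Lemma taylor_vanish (F : R -> R * R -> R * R) : area_preserving_family F ->
  xyge 1 (taylor_map F).1 /\ xyge 1 (taylor_map F).2.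
Proof.
case=> r r0 [_ F0 _].
have z (f : R -> R -> R -> R) : (forall t, `|t| < r -> f 0 0 t = 0) -> xyge 1 (taylor f).
  move=> f0 [|i] [|j] k //= _; rewrite /taylor /= (iter_pderive_eps0 f0) ?mul0r //.
  by rewrite normr0.
by split; apply: z => t tr; rewrite /comp1 /comp2 F0.
Qed.

(** Both components of an eigenvector are annihilated by (mu - cos)^2 + sin^2, and one of them is
    nonzero. *)
Lemma rot_eigenvalue (al : R) (mu : R[i]) : complex_eigenvalue (rot_mx al) mu ->
  mu = Complex (cos al) (sin al) \/ mu = Complex (cos al) (- sin al).
Proof.
move=> /eigenvalueP [v Ev nv].
set c := cR (cos al); set s := cR (sin al).
pose a := v 0 0; pose b := v 0 (lift 0 0).
have E0 : a * c + b * s = mu * a.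
  have := congr1 (fun u : 'rV[R[i]]_2 => u 0 0) Ev; rewrite !mxE big_ord_recl big_ord1.
  by rewrite !mxE /= => <-.
have E1 : - (a * s) + b * c = mu * b.
  have := congr1 (fun u : 'rV[R[i]]_2 => u 0 (lift 0 0)) Ev; rewrite !mxE big_ord_recl big_ord1.
  by rewrite !mxE /= (rmorphN (real_complex R)) mulrN => <-.
have K (x : R[i]) : x = a \/ x = b -> ((mu - c) ^+ 2 + s ^+ 2) * x = 0.
  have h0 : (mu - c) * a = s * b by rewrite mulrBl -E0; ring.
  have h1 : (mu - c) * b = - (s * a) by rewrite mulrBl -E1; ring.
  by case=> ->; rewrite mulrDl !expr2 -!mulrA; [rewrite h0 mulrCA h1|rewrite h1 mulrN mulrCA h0]; ring.
have D : (mu - c) ^+ 2 + s ^+ 2 = 0.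
  apply/eqP; apply: contraT => nz; case/eqP: nv.
  apply/rowP => j; rewrite !mxE.
  have /orP[/eqP ->|/eqP ->] : (j == 0) || (j == lift 0 0) by case: j => -[|[|]].
    by apply: (mulfI nz); rewrite mulr0; apply: K; left.
  by apply: (mulfI nz); rewrite mulr0; apply: K; right.
have i2 := ic2 R.
have : (mu - (c + ic R * s)) * (mu - (c - ic R * s)) = 0.
  transitivity ((mu - c) ^+ 2 - (ic R * ic R) * s ^+ 2); first ring.
  by rewrite i2 mulN1r opprK.
move=> /eqP; rewrite mulf_eq0 !subr_eq0 => /orP[/eqP ->|/eqP ->]; [left|right].
  by rewrite [RHS]complexE.
by rewrite [RHS]complexE /= (rmorphN (real_complex R)) mulrN.
Qed.

Lemma eigenvalue_conj (M P : 'M[R]_2) mu : \det P = 1 -> complex_eigenvalue M mu ->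
  complex_eigenvalue (P *m M *m invmx P) mu.
Proof.
move=> dP /eigenvalueP [v Ev nv]; apply/eigenvalueP.
have uP : P \in unitmx by rewrite unitmxE dP unitr1.
pose Pc := map_mx (real_complex R) P; have uPc : Pc \in unitmx by rewrite map_unitmx.
exists (v *m invmx Pc).
  rewrite !map_mxM map_invmx -/Pc !mulmxA mulmxKV // Ev.
  by rewrite scalemxAl.
by apply: contraNneq nv => /(congr1 (fun u => u *m Pc)); rewrite mulmxKV // mul0mx => ->.
Qed.

(** The given eigenvalue is exp(i al) or its conjugate, and conjugation preserves primitive roots.
    If sin al vanished, the square of the root would be 1, against n >= 3. *)
Lemma rotation_primitive (M : 'M[R]_2) n (al : R) : (3 <= n)%N -> resonance_order M n ->
  rotation_angle M al -> n.-primitive_root (Complex (cos al) (sin al)) /\ sin al != 0.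
Proof.
move=> n3 [mu emu pmu] [P dP E].
have := eigenvalue_conj dP emu; rewrite E => /rot_eigenvalue h.
have pr : n.-primitive_root (Complex (cos al) (sin al)).
  case: h => h; first by rewrite -h.
  have -> : Complex (cos al) (sin al) = conjc mu by rewrite h /= opprK.
  by rewrite (fmorph_primitive_root (@conjc R)).
split=> //; apply: contraTneq pr => s0; apply/negP => pr.
have z2 : Complex (cos al) (sin al) ^+ 2 = 1.
  have := cos2Dsin2 al; rewrite s0 expr0n addr0 => c2.
  by apply/eqP; rewrite expr2 eq_complex /= -expr2 c2; apply/andP; split; apply/eqP; ring.
have := prim_order_dvd pr 2; rewrite z2 eqxx => h2.
by have := leq_trans n3 (@dvdn_leq n 2 (erefl true) h2).
Qed.
End Analysis.

Theorem theorem1p4 (R : realType) (F : R -> R * R -> R * R)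
    (n : nat) (alpha : R) (H0 : fps3 R) (A0 B0 : fps2 R)
    (hF : area_preserving_family F)
    (hell : elliptic (diff_mx F 0 0 0))
    (hn : (3 <= n)%N)
    (hres : resonance_order (diff_mx F 0 0 0) n)
    (halpha : rotation_angle (diff_mx F 0 0 0) alpha)
    (hlead : leading_normal_form n alpha (taylor_map F) H0 A0 B0)
    (hnd4 : (4 <= n)%N -> dI A0 0%N 0%N * B0 0%N 0%N != 0)
    (hnd3 : n = 3%N -> B0 0%N 0%N != 0) :
  exists A B : fps2 R,
    [/\ family_shape n A B,
        0 < B 0%N 0%N,
        formally_conjugate (taylor_map F) alpha (hamAB n A B),
        unique (map_normal_form n alpha (map_at_eps0 (taylor_map F)))
               (at_eps0 (hamAB n A B)) &
        forall A' B' : fps2 R,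
          family_shape n A' B' -> 0 < B' 0%N 0%N ->
          formally_conjugate (taylor_map F) alpha (hamAB n A' B') ->
          A' = A /\ B' = B].
Proof.
have [f1 f2] := taylor_vanish hF.
have [pr s0] := rotation_primitive hn hres halpha.
have cs := cos2Dsin2 alpha; have hng := gofP hn.
have [/(formally_conjugateE _ _ f1 f2) [fH0 [phi0 ip0 E0]] inv0 tr0] := hlead.
have F0 : Filt n (gof n) 0 H0.
  apply/(Fil0_rot (gof n) _ cs pr); rewrite -sub_frot -fsubstE //.
    by rewrite frotE; have [_ _ <- _ _] := rotP (cos alpha) (sin alpha); exact: can_X (can_rot cs).
  by rewrite frotE; have [_ _ _ <- _] := rotP (cos alpha) (sin alpha); exact: can_Y (can_rot cs).
have [a [b L0]] := leading_lead hn fH0 F0 tr0 hnd4 hnd3.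
have [phi [H [a1 [b1 [ip L b10 nf E]]]]] := exist_conj hng cs pr ip0 L0 E0.
have [A [B [sh EH B00]]] := NF_shape hn nf (ld_Fil L).
have Bpos : 0 < B 0%N 0%N.
  by rewrite B00 (ld_b L) /= divr_gt0 // cn_gt0.
have hb A' B' : (@zcoords R) (hamAB n A' B') n 0%N 0%N = real_complex R (cn R n * B' 0%N 0%N).
  by have := ham_off hn A' B' 0 0; rewrite add0n expr0 divr1.
have fcj : formally_conjugate (taylor_map F) alpha (hamAB n A B).
  by apply/formally_conjugateE => //; rewrite -EH; split; [exact: ld_fham L|exists phi].
exists A, B; split=> //; last first.
  move=> A' B' sh' B'pos /(formally_conjugateE _ _ f1 f2) [fH' [phi' ip' E']].
  have e : hamAB n A' B' = H.
    apply: (uniq_conj hng cs pr s0 ip' ip fH' L b10 _ (hb A' B') (shape_NF hn sh') nf E' E).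
    by rewrite mulr_gt0 ?cn_gt0.
  by apply: (ham_inj hn); rewrite e.
have [fHh [T cT cj]] := fcj.
have fHAB : fham (hamAB n A B) by apply/formal_hamiltonianE.
have [cT0 eT0 cj0] := conj_at_eps0 f1 f2 cT fHAB cj.
have g1 : xyge 1 (map_at_eps0 (taylor_map F)).1 by exact: xyge_eps0.
have g2 : xyge 1 (map_at_eps0 (taylor_map F)).2 by exact: xyge_eps0.
have f0 : fham (at_eps0 (hamAB n A B)).
  have [ah _ _ _ _] := at_eps0E R; case: fHAB => x o.
  by split; [apply: xyge_eps0|apply: (gh_ord ah)].
split.
  split; first by exact: at_eps0_map.
    exact/formal_hamiltonianE.
  by exists (map_at_eps0 T).
move=> K [[u [v [v0 ->]]] /formal_hamiltonianE fK [T' [cT' _ cj']]].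
have [a2 [b2 [b20 EK]]] := at_eps0_map hn sh Bpos.
(* The leading part is free of eps and survives at eps = 0. Series free of eps are particular
   families, so the uniqueness for families applies to the individual map. *)
have L1 : leading n (gof n) (at_eps0 (hamAB n A B)) a1 b1.
  have ei p q m : (@zcoords R) (at_eps0 (hamAB n A B)) p q m = if m == 0%N then (@zcoords R) H p q m else 0.
    rewrite at_eps0_hamAB EH !iota_hamAB /eps0; case: (m =P 0%N) => // _.
    by rewrite !mul0r mulr0 !if_same !addr0.
  case: (L) => fH FH Ha Hb b0; split=> //.
  - by move=> p q m; rewrite ei; case: ifP => [_ /FH //|]; rewrite eqxx.
  - by move=> g1'; rewrite ei eqxx; exact: Ha.
  - by rewrite ei.
have [t1 t2] : xyge 1 T'.1 /\ xyge 1 T'.2 by case: cT' => /vanishesE.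
have [s1 s2] : xyge 1 (map_at_eps0 T).1 /\ xyge 1 (map_at_eps0 T).2.
  by case: cT0 => /vanishesE.
have E1 := (conjugatesE alpha g1 g2 t1 t2 fK).1 cj'.
have E2 := (conjugatesE alpha g1 g2 s1 s2 f0).1 cj0.
have nf2 : normal_form n (gof n) ((@zcoords R) (at_eps0 (hamAB n A B))).
  by rewrite EK map_ham_hamAB; exact: (shape_NF hn (map_shape n a2 b2)).
rewrite map_ham_hamAB in fK E1 *; apply/esym.
have nf1 := shape_NF hn (map_shape n u v).
apply: (uniq_conj hng cs pr s0 (canonical_iso cT') (canonical_iso cT0) fK L1 b10 _ (hb _ _) nf1 nf2 E1 E2).
rewrite mulr_gt0 ?cn_gt0 // /mapB /=.
by case: ifP => //; case: eqP.
Qed.
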